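(* For every $n\in\mathbb N=\{1,2,\ldots\}$, $$\mathbb J_{n,1}(1/2)=\frac{n(n^2+1)(n^2+n+2)\pi}{(n+3)2^{n(2n+1)}}\binom{n+1}{\frac12(n+1)}^{n-1}\binom{n^2}{\frac12n^2}=\frac{n(n^2+1)(n^2+n+2)}{2^{n+1}(n+3)\pi^{\frac{n-2}2}}\left(\frac{\Gamma(\frac{n+2}2)}{\Gamma(\frac{n+3}2)}\right)^{n-1}\frac{\Gamma(\frac{n^2+1}2)}{\Gamma(\frac{n^2+2}2)}.$$
   Context: For $n\ge2$ let $X_1,\ldots,X_n$ be i.i.d. random points in $\mathbb R^{n-1}$ with density proportional to $(1-\|x\|^2)^{1/2}\mathbf 1_{\{\|x\|<1\}}$. $\mathbb J_{n,1}(1/2)$ is the expected sum of the internal solid angles at the $n$ vertices of the simplex $[X_1,\ldots,X_n]$ (convex hull); for $n=1$, $\mathbb J_{1,1}(1/2)=1$ by definition. Angles are normalized so that the full-space angle is $1$: the internal angle of a full-dimensional polytope $P\subset\mathbb R^{n-1}$ at a vertex $v$ is $\mathbb P[U\in T]$, where $U$ is uniform on the unit sphere of $\mathbb R^{n-1}$ and $T=\{y\in\mathbb R^{n-1}:\exists\varepsilon>0,\ v+\varepsilon y\in P\}$ is the tangent cone. Binomial coefficients with non-integer entries are $\binom{z}{z/2}=\Gamma(z+1)/\Gamma(\frac z2+1)^2$. *)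

(* Defs.v *)
From HB Require Import structures.
From mathcomp Require Import all_boot all_order all_algebra.
From mathcomp Require Import all_classical all_reals all_analysis.

Set Implicit Arguments.
Unset Strict Implicit.
Unset Printing Implicit Defensive.

Import Order.TTheory GRing.Theory Num.Theory.
Import numFieldNormedType.Exports.

Local Open Scope classical_set_scope.
Local Open Scope ring_scope.

(* The sigma-algebra on row vectors is the one generated by the coordinates,
   that is, the Borel sigma-algebra of R^d. *)
Definition measure_rV_display : measure_display -> measure_display.
Proof. exact. Qed.

Section measurable_rV.
Context {R : realType}.
Variable d : nat.

Let coors : 'I_d -> 'rV[R]_d -> measurableTypeR R := fun i x => x ord0 i.

Let rV_set0 : g_sigma_preimage coors set0.
Proof. exact: sigma_algebra0. Qed.

Let rV_setC A : g_sigma_preimage coors A -> g_sigma_preimage coors (~` A).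
Proof. exact: sigma_algebraC. Qed.

Let rV_bigcup (F : _^nat) : (forall i, g_sigma_preimage coors (F i)) ->
  g_sigma_preimage coors (\bigcup_i (F i)).
Proof. exact: sigma_algebra_bigcup. Qed.

HB.instance Definition _ := @isMeasurable.Build
  (measure_rV_display (R.-ocitv.-measurable).-sigma)
  'rV[R]_d (g_sigma_preimage coors) rV_set0 rV_setC rV_bigcup.

Lemma measurable_rV_coord (i : 'I_d) :
  measurable_fun [set: 'rV[R]_d] (fun x => x ord0 i : measurableTypeR R).
Proof.
move=> _ Y mY; rewrite setTI; apply: sub_sigma_algebra => /=.
rewrite -bigcup_seq/=; exists i => /=; first by rewrite mem_index_enum.
by exists Y => //; rewrite setTI.
Qed.

Lemma measurable_fun_rVP d' (T : measurableType d') (f : T -> 'rV[R]_d) :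
  measurable_fun [set: T] f <->
  forall i, measurable_fun [set: T] (fun t => f t ord0 i : measurableTypeR R).
Proof.
split=> [mf i|mf]; first exact: measurableT_comp (measurable_rV_coord i) mf.
suff H : g_sigma_preimage (fun i => coors i \o f) `<=` measurable.
  move=> _ A mA; rewrite setTI; apply: H.
  by rewrite g_sigma_preimage_comp; exists A => //; rewrite setTI.
apply: smallest_sub; first exact: sigma_algebra_measurable.
rewrite -bigcup_seq => A [i _] [B mB <-].
exact: mf.
Qed.

End measurable_rV.

(* d-dimensional Lebesgue measure, by induction on d, as the image of the
   product of the one-dimensional Lebesgue measure and of the d-dimensional one
   under the identification R * R^d = R^(1 + d); R^0 is a single point, of
   measure 1. *)
Section lebesgue_rV.
Context {R : realType}.

Definition rV_cons d (p : measurableTypeR R * 'rV[R]_d) : 'rV[R]_d.+1 :=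
  \row_i oapp (p.2 ord0) p.1 (unlift ord0 i).

Definition rV_uncons d (x : 'rV[R]_d.+1) : measurableTypeR R * 'rV[R]_d :=
  (x ord0 ord0, \row_j x ord0 (lift ord0 j)).

Lemma rV_consK d : cancel (@rV_cons d) (@rV_uncons d).
Proof.
move=> [a v]; rewrite /rV_cons /rV_uncons /= mxE unlift_none /=; congr pair.
by apply/rowP => j; rewrite !mxE liftK.
Qed.

Lemma measurable_rV_cons d : measurable_fun setT (@rV_cons d).
Proof.
apply/measurable_fun_rVP => i; case: (unliftP ord0 i) => [j|] ->.
  rewrite (_ : (fun _ => _) =
    (fun x : 'rV[R]_d => x ord0 j : measurableTypeR R) \o snd).
    exact: measurableT_comp (measurable_rV_coord j) measurable_snd.
  by apply/funext => p; rewrite /rV_cons mxE liftK.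
rewrite (_ : (fun _ => _) = fst); first exact: measurable_fst.
by apply/funext => p; rewrite /rV_cons mxE unlift_none.
Qed.

Lemma measurable_rV_uncons d : measurable_fun setT (@rV_uncons d).
Proof.
apply/measurable_fun_pairP; split.
  exact: measurable_rV_coord.
apply/measurable_fun_rVP => i /=.
rewrite (_ : (fun _ => _) =
  (fun x : 'rV[R]_d.+1 => x ord0 (lift ord0 i) : measurableTypeR R)).
  exact: measurable_rV_coord.
by apply/funext => x /=; rewrite mxE.
Qed.

Section step.
Variables (d : nat) (mu : {sigma_finite_measure set 'rV[R]_d -> \bar R}).

Definition lebesgue_rV_step : set 'rV[R]_d.+1 -> \bar R :=
  pushforward (@lebesgue_measure R \x mu)%E (@rV_cons d).

(* The library has this fact, but canonical inference on products of measures
   finds the instance for subprobabilities instead. *)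
Let product_sigma_finite :
  sigma_finite setT (@lebesgue_measure R \x mu)%E.
Proof.
have /sigma_finiteP[F [TF ndF Foo]] := sigma_finiteT (@lebesgue_measure R).
have /sigma_finiteP[G [TG ndG Goo]] := sigma_finiteT mu.
exists (fun n => F n `*` G n).
  rewrite -setXTT TF TG predeqE => -[x y]; split.
    move=> [/= [n _ Fnx] [k _ Gky]]; exists (maxn n k) => //; split.
    - by move: x Fnx; exact/subsetPset/ndF/leq_maxl.
    - by move: y Gky; exact/subsetPset/ndG/leq_maxr.
  by move=> [n _ []/= ? ?]; split; exists n.
move=> k; have [? ?] := Foo k; have [? ?] := Goo k.
split; first exact: measurableX.
by rewrite product_measure1E// lte_mul_pinfty// ge0_fin_numE.
Qed.

Let step0 : lebesgue_rV_step set0 = 0%E.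
Proof. by rewrite /lebesgue_rV_step /pushforward preimage_set0 measure0. Qed.

Let step_ge0 A : (0 <= lebesgue_rV_step A)%E.
Proof. by rewrite /lebesgue_rV_step /pushforward; apply: measure_ge0. Qed.

Let step_sigma_additive : semi_sigma_additive lebesgue_rV_step.
Proof.
move=> F mF tF mUF; rewrite /lebesgue_rV_step /pushforward preimage_bigcup.
have mcons A : measurable A -> measurable (@rV_cons d @^-1` A).
  by move=> mA; rewrite -[X in measurable X]setTI; exact: measurable_rV_cons.
apply: measure_semi_sigma_additive => [n||].
- exact: mcons.
- apply/trivIsetP => /= i j _ _ ij; rewrite -preimage_setI.
  by move/trivIsetP : tF => /(_ _ _ _ _ ij) ->//; rewrite preimage_set0.
- by rewrite -preimage_bigcup; exact: mcons.
Qed.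

HB.instance Definition _ := isMeasure.Build _ _ _ lebesgue_rV_step
  step0 step_ge0 step_sigma_additive.

Let step_sigma_finite : sigma_finite setT lebesgue_rV_step.
Proof.
have [F TF Foo] := product_sigma_finite.
exists (fun i => @rV_uncons d @^-1` F i).
  by rewrite -preimage_bigcup -TF preimage_setT.
move=> i; have [mFi Fioo] := Foo i; split.
  by rewrite -[X in measurable X]setTI; exact: measurable_rV_uncons.
rewrite /lebesgue_rV_step /pushforward -comp_preimage.
rewrite (_ : _ \o _ = id) ?preimage_id//.
by apply/funext => p /=; rewrite rV_consK.
Qed.

HB.instance Definition _ := Measure_isSigmaFinite.Build _ _ _ lebesgue_rV_step
  step_sigma_finite.

End step.

Fixpoint lebesgue_rV d : {sigma_finite_measure set 'rV[R]_d -> \bar R} :=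
  match d with
  | 0 => \d_(0 : 'rV[R]_0)
  | d'.+1 => lebesgue_rV_step (lebesgue_rV d')
  end.

Lemma lebesgue_rV_box d (a b : 'I_d -> R) :
  (forall i, a i <= b i) ->
  lebesgue_rV d [set x : 'rV[R]_d | forall i, a i <= x ord0 i <= b i] =
  (\prod_(i < d) (b i - a i))%:E.
Proof.
elim: d a b => [|d IH] a b ab.
  rewrite big_ord0 /= diracE (_ : _ \in _ = true)//.
  by apply/mem_set; case.
rewrite /= /lebesgue_rV_step /pushforward.
rewrite (_ : _ @^-1` _ = `[a ord0, b ord0]%classic `*`
  [set x : 'rV[R]_d | forall i, a (lift ord0 i) <= x ord0 i <= b (lift ord0 i)]).
  have mbox (e : nat) (f g : 'I_e -> R) : measurable
      [set x : 'rV[R]_e | forall i, f i <= x ord0 i <= g i].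
    rewrite (_ : [set x | _] = \bigcap_(i in [set: 'I_e])
        ((fun x : 'rV[R]_e => x ord0 i : measurableTypeR R)
         @^-1` `[f i, g i]%classic)).
      apply: fin_bigcap_measurable => // i _.
      by rewrite -[X in measurable X]setTI; exact: measurable_rV_coord.
    apply/seteqP; split=> x /=.
      by move=> H i _ /=; rewrite in_itv /= H.
    by move=> H i; have := H i Logic.I; rewrite /= in_itv.
  rewrite product_measure1E//.
  rewrite [X in (_ * X)%E]IH// big_ord_recl EFinM;
    first congr (_ * _)%E.
    transitivity (@lebesgue_measure R `[a ord0, b ord0]%classic) => //.
    rewrite lebesgue_measure_itv /= lte_fin.
    have [//|ba] := ltP (a ord0) (b ord0).
    have /le_anti -> : a ord0 <= b ord0 <= a ord0 by rewrite ab.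
    by rewrite subrr.
  exact: mbox.
apply/seteqP; split=> -[u v] /= H.
  split; first by have := H ord0; rewrite mxE unlift_none /= in_itv.
  by move=> i; have := H (lift ord0 i); rewrite mxE liftK.
move=> i; case: (unliftP ord0 i) => [j|] ->; rewrite mxE ?liftK ?unlift_none /=.
  exact: H.2.
by case: H; rewrite /= in_itv.
Qed.

End lebesgue_rV.

Section euclidean.
Context {R : realType} {d : nat}.

(* The library norm on matrices is the sup norm. *)
Definition enorm (x : 'rV[R]_d) : R := Num.sqrt (\sum_(i < d) x ord0 i ^+ 2).

Definition unit_ball : set 'rV[R]_d := [set x | enorm x < 1].

(* Uniform distribution on the unit sphere (normalized surface measure): the
   law of Z / |Z| for a uniform point Z of the unit ball.  Only meaningful for
   d > 0; the junk value at Z = 0 is then irrelevant. *)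
Definition sphere_uniform (A : set 'rV[R]_d) : R :=
  fine (lebesgue_rV d (unit_ball `&` [set z | A ((enorm z)^-1 *: z)])) /
  fine (lebesgue_rV d unit_ball).

Definition tangent_cone (P : set 'rV[R]_d) (v : 'rV[R]_d) : set 'rV[R]_d :=
  [set y | exists2 eps : R, 0 < eps & P (v + eps *: y)].

Definition internal_angle (P : set 'rV[R]_d) (v : 'rV[R]_d) : R :=
  sphere_uniform (tangent_cone P v).

Definition simplex (n : nat) (x : 'I_n -> 'rV[R]_d) : set 'rV[R]_d :=
  [set p | exists w : 'I_n -> R, [/\ forall i, 0 <= w i,
    \sum_(i < n) w i = 1 & p = \sum_(i < n) w i *: x i]].

Definition angle_sum (n : nat) (x : 'I_n -> 'rV[R]_d) : R :=
  \sum_(i < n) internal_angle (simplex x) (x i).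

Definition beta_kernel (beta : R) (x : 'rV[R]_d) : R :=
  (1 - enorm x ^+ 2) `^ beta * \1_unit_ball x.

End euclidean.

Section random_points.
Context {R : realType} {dT : measure_display} {T : measurableType dT}.
Variable P : probability T R.

Definition mutually_independent dE (E : measurableType dE) (n : nat)
    (X : 'I_n -> {RV P >-> E}) : Prop :=
  forall (J : {set 'I_n}) (A : 'I_n -> set E),
    (forall i, measurable (A i)) ->
    P (\bigcap_(i in [set` J]) (X i @^-1` A i)) =
    (\prod_(i in J) P (X i @^-1` A i))%E.

Definition has_density_proportional_to d (X : {RV P >-> 'rV[R]_d})
    (f : 'rV[R]_d -> R) : Prop :=
  exists2 c : R, 0 < c & forall A, measurable A ->
    distribution P X A = (\int[lebesgue_rV d]_(x in A) (c * f x)%:E)%E.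

Definition iid_beta (beta : R) (n d : nat)
    (X : 'I_n -> {RV P >-> 'rV[R]_d}) : Prop :=
  mutually_independent X /\
  forall i, has_density_proportional_to (X i) (beta_kernel beta).

(* J_{n,1}(beta), computed from a sample X of n points of R^(n-1).  The value 1
   for n = 1 is a convention: R^0 has no unit sphere. *)
Definition J1 (n : nat) (X : 'I_n -> {RV P >-> 'rV[R]_n.-1}) : \bar R :=
  if n == 1%N then 1%E else ('E_P[fun t => angle_sum (fun i => X i t)])%E.

End random_points.

Section gamma.
Context {R : realType}.

Definition Gamma (z : R) : R :=
  \int[lebesgue_measure]_(t in `]0, +oo[) (t `^ (z - 1) * expR (- t)).

(* "z choose z/2" for real z *)
Definition central_binomial (z : R) : R := Gamma (z + 1) / Gamma (z / 2 + 1) ^+ 2.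

End gamma.

(* Main.v *)
(* Write n = D + 2.  The density is invariant under rotations, so averaging the
   internal angle at a vertex over the direction U amounts to computing the
   probability that the axis e belongs to the tangent cone at the first vertex;
   by Fubini the angle sum has expectation n times this probability.

   Split X_i = (y_i, x_i) with y_i the coordinate along e.  By Cramer, the
   barycentric coordinates of the direction e are gamma_i / det, where det is the
   determinant of the points in homogeneous coordinates and gamma_i depends on
   the x_i only.  The flip y -> -y changes the sign of det, so twice the
   probability is the probability that gamma_1, ..., gamma_(n-1) have the same
   sign, that is, that x_0 belongs to the simplex [x_1, ..., x_(n-1)] of R^D.
   Integrating out y turns the weight (1 - |X|^2)^(1/2) into 1 - |x|^2, up to a
   constant.

   For the weight 1 - |x|^2 the integral over x_0 in the simplex is explicit: it
   is |det| times a quadratic form in the vertices.  The factor |det| is the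
   Jacobian of the affine Blaschke-Petkantschin formula, which turns the
   remaining integral over D + 1 points of R^D into one over D + 1 points of
   R^(D + 1) with the same weights and no determinant.  There the mixed terms of
   the quadratic form vanish by symmetry, and what is left is a product of
   one-point integrals, each a quotient of Gamma values. *)
Require Import Defs.
From HB Require Import structures.
From mathcomp Require Import all_boot all_order all_algebra fingroup perm.
From mathcomp Require Import all_classical all_reals all_analysis.
From mathcomp Require Import measurable_realfun.
From mathcomp Require Import ring lra zify.
Set Implicit Arguments.
Unset Strict Implicit.
Unset Printing Implicit Defensive.
Import Order.TTheory GRing.Theory Num.Theory.
Import numFieldNormedType.Exports.
Local Open Scope classical_set_scope.
Local Open Scope ring_scope.

(** * Null sets and product measures *)

(** Cramer's rule says nothing when the determinant vanishes, and the angle sum is identified with a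
    measurable function only almost surely. Both obstacles are met by changing a nonnegative
    integrand on a null set.

    The constants need neither polar coordinates nor the Beta function: an exponential or Gaussian
    variable is added and the resulting double integral is evaluated in both orders, with a scaling
    in one of them.

    In the Blaschke-Petkantschin step, b is rescaled to the signed distance h of the hyperplane from
    the origin. The section of the ball is then a ball of radius sqrt (1 - h^2), and the homogeneity
    of the weights separates the integrals over h, over a and over the points. *)

Section integral_off_null.
Context d (T : measurableType d) (R : realType).
Variable mu : {measure set T -> \bar R}.
Import HBNNSimple.

(* The integral of a nonnegative function is a supremum over the simple
   functions below it, hence no measurability is needed here. *)
Lemma ge0_integral_off_null (N : set T) (f g : T -> \bar R) :
  measurable N -> mu N = 0%E ->
  (forall x, 0 <= f x)%E -> (forall x, 0 <= g x)%E ->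
  (forall x, ~ N x -> f x = g x) ->
  (\int[mu]_x f x = \int[mu]_x g x)%E.
Proof.
move=> mN N0.
wlog suff : f g / (forall x, 0 <= f x)%E -> (forall x, 0 <= g x)%E ->
    (forall x, ~ N x -> f x = g x) -> (\int[mu]_x f x <= \int[mu]_x g x)%E.
  by move=> H f0 g0 fg; apply/le_anti/andP; split; apply: H => // x Nx;
    rewrite fg.
move=> f0 g0 fg.
rewrite [leLHS]ge0_integralTE//; apply: ge_ereal_sup => _ [h /= hf <-].
have mC : measurable (~` N) by exact: measurableC.
have mh : measurable_fun setT (EFin \o h) by exact/measurable_EFinP.
(* Cutting [h] down to the complement of [N] keeps its integral and puts it below [g] everywhere. *)
have -> : sintegral mu h = sintegral mu (proj_nnsfun h mC).
  rewrite -!integralT_nnsfun.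
  apply: ge0_ae_eq_integral => //.
  - exact/measurable_EFinP.
  - by move=> x _; rewrite lee_fin.
  - by move=> x _; rewrite lee_fin.
  exists N; split => // x /= hx; apply: contrapT => Nx; apply: hx => _.
  by rewrite mindicE mem_set// mulr1.
rewrite [leRHS]ge0_integralTE//; apply: ereal_sup_ubound.
exists (proj_nnsfun h mC) => //= x; rewrite mindicE.
have [Nx|Nx] := pselect (N x); first by rewrite memNset//= mulr0.
by rewrite mem_set// mulr1 -fg//; exact: hf.
Qed.

End integral_off_null.

Section tcons.
Variable E : Type.

Definition tcons n (p : E * n.-tuple E) : n.+1.-tuple E :=
  [tuple of p.1 :: p.2].

Definition tuncons n (t : n.+1.-tuple E) : E * n.-tuple E :=
  (tnth t ord0, [tuple of behead t]).

Lemma tconsK n : cancel (@tcons n) (@tuncons n).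
Proof. by move=> [x t]; congr pair; apply: val_inj. Qed.

End tcons.

Section tuple_measure.
Context d (E : measurableType d) (R : realType).
Variable mu : {sigma_finite_measure set E -> \bar R}.

Lemma measurable_tcons n : measurable_fun setT (@tcons E n).
Proof. exact: measurable_cons. Qed.

Lemma measurable_tuncons n : measurable_fun setT (@tuncons E n).
Proof.
apply/measurable_fun_pairP; split; first exact: measurable_tnth.
exact: measurable_behead.
Qed.

Section step.
Variables (n : nat) (nu : {sigma_finite_measure set n.-tuple E -> \bar R}).

Definition tuple_measure_step : set (n.+1.-tuple E) -> \bar R :=
  pushforward (mu \x nu)%E (@tcons E n).

Let product_sigma_finite : sigma_finite setT (mu \x nu)%E.
Proof.
have /sigma_finiteP[F [TF ndF Foo]] := sigma_finiteT mu.
have /sigma_finiteP[G [TG ndG Goo]] := sigma_finiteT nu.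
exists (fun n => F n `*` G n).
  rewrite -setXTT TF TG predeqE => -[x y]; split.
    move=> [/= [i _ Fnx] [k _ Gky]]; exists (maxn i k) => //; split.
    - by move: x Fnx; exact/subsetPset/ndF/leq_maxl.
    - by move: y Gky; exact/subsetPset/ndG/leq_maxr.
  by move=> [i _ []/= ? ?]; split; exists i.
move=> k; have [? ?] := Foo k; have [? ?] := Goo k.
split; first exact: measurableX.
by rewrite product_measure1E// lte_mul_pinfty// ge0_fin_numE.
Qed.

Let step0 : tuple_measure_step set0 = 0%E.
Proof. by rewrite /tuple_measure_step /pushforward preimage_set0 measure0. Qed.

Let step_ge0 A : (0 <= tuple_measure_step A)%E.
Proof. by rewrite /tuple_measure_step /pushforward; apply: measure_ge0. Qed.

Let step_sigma_additive : semi_sigma_additive tuple_measure_step.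
Proof.
move=> F mF tF mUF; rewrite /tuple_measure_step /pushforward preimage_bigcup.
have mcons A : measurable A -> measurable (@tcons E n @^-1` A).
  by move=> mA; rewrite -[X in measurable X]setTI; exact: measurable_tcons.
apply: measure_semi_sigma_additive => [i||].
- exact: mcons.
- apply/trivIsetP => /= i j _ _ ij; rewrite -preimage_setI.
  by move/trivIsetP : tF => /(_ _ _ _ _ ij) ->//; rewrite preimage_set0.
- by rewrite -preimage_bigcup; exact: mcons.
Qed.

HB.instance Definition _ := isMeasure.Build _ _ _ tuple_measure_step
  step0 step_ge0 step_sigma_additive.

Let step_sigma_finite : sigma_finite setT tuple_measure_step.
Proof.
have [F TF Foo] := product_sigma_finite.
exists (fun i => @tuncons E n @^-1` F i).
  by rewrite -preimage_bigcup -TF preimage_setT.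
move=> i; have [mFi Fioo] := Foo i; split.
  by rewrite -[X in measurable X]setTI; exact: measurable_tuncons.
rewrite /tuple_measure_step /pushforward -comp_preimage.
rewrite (_ : _ \o _ = id) ?preimage_id//.
by apply/funext => p /=; rewrite tconsK.
Qed.

HB.instance Definition _ := Measure_isSigmaFinite.Build _ _ _
  tuple_measure_step step_sigma_finite.

End step.

(** The n-fold product measure, built like [lebesgue_rV] so that Tonelli peels off one point at a
    time; the Dirac mass is the empty product. *)
Fixpoint tuple_measure n : {sigma_finite_measure set n.-tuple E -> \bar R} :=
  match n with
  | 0 => \d_([tuple] : 0.-tuple E)
  | n'.+1 => tuple_measure_step (tuple_measure n')
  end.

Lemma integral_tuple0 (F : 0.-tuple E -> \bar R) :
  measurable_fun setT F -> (\int[tuple_measure 0]_t F t = F [tuple])%E.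
Proof. by move=> mF; rewrite integral_dirac// diracT mul1e. Qed.

Lemma integral_tupleS n (F : n.+1.-tuple E -> \bar R) :
  measurable_fun setT F -> (forall t, 0 <= F t)%E ->
  (\int[tuple_measure n.+1]_t F t =
   \int[mu]_x \int[tuple_measure n]_t F (tcons (x, t)))%E.
Proof.
move=> mF F0.
have H := @ge0_integral_pushforward _ _ _ _ R (@tcons E n) (@measurable_tcons n)
  (mu \x tuple_measure n)%E setT F measurableT mF.
have {H} -> := H (fun x _ => F0 x).
rewrite preimage_setT (fubini_tonelli1 (F \o @tcons E n))//.
  exact: measurableT_comp mF (@measurable_tcons n).
by move=> x; exact: F0.
Qed.

End tuple_measure.

Lemma integral_rV0 (R : realType) (F : 'rV[R]_0 -> \bar R) :
  measurable_fun setT F -> (\int[lebesgue_rV 0]_t F t = F 0%R)%E.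
Proof. by move=> mF; rewrite integral_dirac// diracT mul1e. Qed.

Lemma integral_rVS (R : realType) n (F : 'rV[R]_n.+1 -> \bar R) :
  measurable_fun setT F -> (forall t, 0 <= F t)%E ->
  (\int[lebesgue_rV n.+1]_t F t =
   \int[@lebesgue_measure R]_x \int[lebesgue_rV n]_v F (rV_cons (x, v)))%E.
Proof.
move=> mF F0.
have H := @ge0_integral_pushforward _ _ _ _ R (@rV_cons R n)
  (@measurable_rV_cons R n)
  (@lebesgue_measure R \x @lebesgue_rV R n)%E setT F measurableT mF.
have {H} -> := H (fun x _ => F0 x).
rewrite preimage_setT (fubini_tonelli1 (F \o @rV_cons R n))//.
  exact: measurableT_comp mF (@measurable_rV_cons R n).
by move=> x; exact: F0.
Qed.

(** * Measurability and homogeneous coordinates *)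

Section measurability.
Context d (T : measurableType d) (R : realType).
Implicit Types (f g : T -> R) (b c : T -> bool).
Local Notation mf := (measurable_fun setT).

Lemma mfun_D f g : mf f -> mf g -> mf (fun x => f x + g x).
Proof. exact: measurable_funD. Qed.

Lemma mfun_M f g : mf f -> mf g -> mf (fun x => f x * g x).
Proof. exact: measurable_funM. Qed.

Lemma mfun_N f : mf f -> mf (fun x => - f x).
Proof. exact: measurable_funN. Qed.

Lemma mfun_X f n : mf f -> mf (fun x => f x ^+ n).
Proof. exact: measurable_funX. Qed.

Lemma mfun_Mn f n : mf f -> mf (fun x => f x *+ n).
Proof.
move=> h; rewrite (_ : (fun _ => _) = (fun x => f x * n%:R)).
  exact: mfun_M h (measurable_cst _).
by apply/funext => x; rewrite mulr_natr.
Qed.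

Lemma mfun_expR f : mf f -> mf (fun x => expR (f x)).
Proof. by move=> h; apply: measurableT_comp h. Qed.

Lemma mfun_sqrt f : mf f -> mf (fun x => Num.sqrt (f x)).
Proof.
have h : measurable_fun setT (@Num.sqrt R).
  by apply: continuous_measurable_fun; exact: sqrt_continuous.
by move=> mff; exact: (measurableT_comp h mff).
Qed.

Lemma mfun_powR f p : mf f -> mf (fun x => f x `^ p).
Proof. by move=> h; exact: (measurableT_comp (measurable_powR p) h). Qed.

Lemma mfun_norm f : mf f -> mf (fun x => `|f x|).
Proof. by move=> h; apply: measurableT_comp h. Qed.

Lemma mfun_sum (I : Type) (s : seq I) (F : T -> I -> R) :
  (forall i, mf (F ^~ i)) -> mf (fun x => \sum_(i <- s) F x i).
Proof. exact: measurable_sum. Qed.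

Lemma mfun_prod (I : eqType) (s : seq I) (F : T -> I -> R) :
  (forall i, mf (F ^~ i)) -> mf (fun x => \prod_(i <- s) F x i).
Proof. by move=> h; apply: measurable_prod. Qed.

Lemma mfun_ler f g : mf f -> mf g -> mf (fun x => f x <= g x).
Proof. exact: measurable_fun_ler. Qed.

Lemma mfun_ltr f g : mf f -> mf g -> mf (fun x => f x < g x).
Proof. exact: measurable_fun_ltr. Qed.

Lemma mfun_eqr f g : mf f -> mf g -> mf (fun x => f x == g x).
Proof. exact: measurable_fun_eqr. Qed.

Lemma mfun_and b c : mf b -> mf c -> mf (fun x => b x && c x).
Proof. exact: measurable_and. Qed.

Lemma mfun_neg b : mf b -> mf (fun x => ~~ b x).
Proof. by move=> h; apply: (measurable_neg h). Qed.

Lemma mfun_all (I : finType) (b : T -> I -> bool) :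
  (forall i, mf (b ^~ i)) -> mf (fun x => [forall i, b x i]).
Proof.
move=> h; rewrite (_ : (fun _ => _) = (fun x => all (b x) (enum I))).
  elim: (enum I) => [|i s ih] /=; first exact: measurable_cst.
  exact: measurable_and.
apply/funext => x; apply/forallP/allP => [H i _|H i]; first exact: H.
by apply: H; rewrite mem_enum.
Qed.

Lemma mfun_natb b : mf b -> mf (fun x => (b x)%:R : R).
Proof.
move=> h; rewrite (_ : (fun _ => _) = (fun x => if b x then 1 else 0)).
  by apply: measurable_fun_ifT => //; exact: measurable_cst.
by apply/funext => x; case: (b x).
Qed.

Lemma mfun_inv f : mf f -> mf (fun x => (f x)^-1).
Proof.
(* The power [-1] is the inverse only for a nonnegative base, hence the case distinction on the
   sign. *)
move=> h; rewrite (_ : (fun _ => _) = (fun x =>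
  if 0 <= f x then f x `^ (-1) else - (- f x) `^ (-1))).
  apply: measurable_fun_ifT.
  - by apply: mfun_ler => //; exact: measurable_cst.
  - exact: mfun_powR.
  - by apply: mfun_N; apply: mfun_powR; exact: mfun_N.
apply/funext => x; case: ifPn => H; first by rewrite powR_inv1.
by rewrite powR_inv1 ?invrN ?opprK// oppr_ge0 ltW// ltNge.
Qed.

Lemma mfun_E f : mf f -> mf (fun x => (f x)%:E).
Proof. by move=> /measurable_EFinP. Qed.

Lemma emfun_D (f g : T -> \bar R) : mf f -> mf g -> mf (fun x => f x + g x)%E.
Proof. exact: emeasurable_funD. Qed.

Lemma emfun_M (f g : T -> \bar R) : mf f -> mf g -> mf (fun x => f x * g x)%E.
Proof. exact: emeasurable_funM. Qed.

Lemma mfun_rV n (f : T -> 'rV[R]_n) (i : 'I_1) (j : 'I_n) :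
  mf f -> mf (fun x => f x i j).
Proof.
by rewrite (ord1 i); exact: (measurableT_comp (measurable_rV_coord j)).
Qed.

Lemma mfun_tnth d' (E : measurableType d') n (f : T -> n.-tuple E) (i : 'I_n) :
  mf f -> mf (fun x => tnth (f x) i).
Proof. by move=> h; apply: (measurableT_comp (measurable_tnth i) h). Qed.

Lemma mfun_fst d1 d2 (E : measurableType d1) (E' : measurableType d2)
  (f : T -> E * E') : mf f -> mf (fun x => (f x).1).
Proof. by move=> h; apply: (measurableT_comp measurable_fst h). Qed.

Lemma mfun_snd d1 d2 (E : measurableType d1) (E' : measurableType d2)
  (f : T -> E * E') : mf f -> mf (fun x => (f x).2).
Proof. by move=> h; apply: (measurableT_comp measurable_snd h). Qed.

Lemma mfun_pair d1 d2 (E : measurableType d1) (E' : measurableType d2)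
  (f : T -> E) (g : T -> E') : mf f -> mf g -> mf (fun x => (f x, g x)).
Proof. by move=> h k; apply/measurable_fun_pairP. Qed.

Lemma mfun_tcons d' (E : measurableType d') n (p : T -> E * n.-tuple E) :
  mf p -> mf (fun x => tcons (p x)).
Proof. by move=> h; apply: (measurableT_comp (@measurable_tcons _ E n) h). Qed.

Lemma mfun_rV_cons n (p : T -> measurableTypeR R * 'rV[R]_n) :
  mf p -> mf (fun x => rV_cons (p x)).
Proof.
by move=> h; apply: (measurableT_comp (@measurable_rV_cons R n) h).
Qed.

Lemma mfun_if d' (E : measurableType d') b (f g : T -> E) :
  mf b -> mf f -> mf g -> mf (fun x => if b x then f x else g x).
Proof. exact: measurable_fun_ifT. Qed.

Lemma mfun_integral d' (E : measurableType d')
    (nu : {sigma_finite_measure set E -> \bar R}) (F : T -> E -> \bar R) :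
  (forall x y, 0 <= F x y)%E -> mf (fun p : T * E => F p.1 p.2) ->
  mf (fun x => \int[nu]_y F x y)%E.
Proof.
move=> F0 mF.
by apply: (measurable_fun_fubini_tonelli_F (m2 := nu)
  (fun p : T * E => F p.1 p.2)).
Qed.

End measurability.

Lemma mfun_rVP d (T : measurableType d) (R : realType) n (f : T -> 'rV[R]_n) :
  (forall i, measurable_fun setT (fun t => f t ord0 i)) ->
  measurable_fun setT f.
Proof. by move=> h; apply/measurable_fun_rVP. Qed.

Lemma measurable_rV_add n d (T : measurableType d) (R : realType)
    (f g : T -> 'rV[R]_n) :
  measurable_fun setT f -> measurable_fun setT g ->
  measurable_fun setT (fun x => f x + g x).
Proof.
move=> h k; apply: mfun_rVP => i.
rewrite (_ : (fun _ => _) = (fun t => f t ord0 i + g t ord0 i)).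
  exact: mfun_D (mfun_rV _ _ h) (mfun_rV _ _ k).
by apply/funext => t; rewrite mxE.
Qed.

Lemma measurable_rV_mulmx m n d (T : measurableType d)
    (R : realType) (f : T -> 'rV[R]_m) (M : 'M[R]_(m, n)) :
  measurable_fun setT f -> measurable_fun setT (fun x => f x *m M).
Proof.
move=> h; apply: mfun_rVP => i.
rewrite (_ : (fun _ => _) = (fun t => \sum_j f t ord0 j * M j i)).
  apply: mfun_sum => j; apply: mfun_M; first exact: mfun_rV.
  exact: measurable_cst.
by apply/funext => t; rewrite mxE.
Qed.

Lemma measurable_mktuple d d' (T : measurableType d) (E : measurableType d') n
    (f : T -> 'I_n -> E) :
  (forall i, measurable_fun setT (f ^~ i)) ->
  measurable_fun setT (fun t => [tuple f t i | i < n]).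
Proof.
move=> h; apply/measurable_fun_tnthP => i.
rewrite (_ : _ \o _ = f ^~ i) //.
by apply/funext => t /=; rewrite tnth_mktuple.
Qed.

(** The first coordinates of all the points are kept in a single row vector, so that one linear
    change of variables acts on all of them. *)
Definition attach (R : realType) m n (y : 'rV[R]_m) (x : m.-tuple 'rV[R]_n) :
    m.-tuple 'rV[R]_n.+1 := [tuple rV_cons (y ord0 i, tnth x i) | i < m].

Lemma measurable_attach m n d (T : measurableType d) (R : realType)
    (f : T -> 'rV[R]_m) (g : T -> m.-tuple 'rV[R]_n) :
  measurable_fun setT f -> measurable_fun setT g ->
  measurable_fun setT (fun t => attach (f t) (g t)).
Proof.
move=> mf mg; apply: measurable_mktuple => i; apply: mfun_rV_cons.
by apply: mfun_pair; [exact: mfun_rV | exact: mfun_tnth].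
Qed.

Section homogeneous_coordinates.
Context (R : realType).

Definition hom n (x : 'rV[R]_n) : 'rV[R]_n.+1 := rV_cons (1, x).

(** For n + 1 points of R^n, the absolute determinant is n! times the volume of the simplex; affine
    maps act by right multiplication. *)
Definition hmx m n (x : m.-tuple 'rV[R]_n) : 'M[R]_(m, n.+1) :=
  \matrix_(i, j) hom (tnth x i) ord0 j.

Lemma measurable_det_entries d (T : measurableType d) n (M : T -> 'M[R]_n) :
  (forall i j, measurable_fun setT (fun t => M t i j)) ->
  measurable_fun setT (fun t => \det (M t)).
Proof.
move=> h; rewrite /determinant; apply: mfun_sum => s.
apply: mfun_M; first exact: measurable_cst.
by apply: mfun_prod => i; exact: h.
Qed.

Lemma measurable_det_hmx d (T : measurableType d) n
    (f : T -> n.+1.-tuple 'rV[R]_n) : measurable_fun setT f ->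
  measurable_fun setT (fun t => \det (hmx (f t))).
Proof.
move=> mf; apply: measurable_det_entries => i j.
rewrite (_ : (fun _ => _) = (fun t => rV_cons (1, tnth (f t) i) ord0 j)).
  apply: mfun_rV; apply: mfun_rV_cons; apply: mfun_pair.
    exact: measurable_cst.
  exact: mfun_tnth.
by apply/funext => t; rewrite mxE.
Qed.

Definition dot n (x y : 'rV[R]_n) : R := \sum_i x ord0 i * y ord0 i.

(** The weight (1 - |x|^2)^(m/2) on the unit ball. The value m = 1 is the density of the points up
    to a constant, m = 2 its marginal, m = 0 the indicator of the ball, and m = 4 arises from the
    diagonal terms of [quad]. *)
Definition bker m n (x : 'rV[R]_n) : R :=
  (dot x x < 1)%R%:R * Num.sqrt (1 - dot x x) ^+ m.

Lemma measurable_dot d (T : measurableType d) n (f g : T -> 'rV[R]_n) :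
  measurable_fun setT f -> measurable_fun setT g ->
  measurable_fun setT (fun t => dot (f t) (g t)).
Proof.
move=> mf mg; apply: mfun_sum => i.
by apply: mfun_M; exact: mfun_rV.
Qed.

Lemma measurable_bker d (T : measurableType d) m n (f : T -> 'rV[R]_n) :
  measurable_fun setT f -> measurable_fun setT (fun t => bker m (f t)).
Proof.
move=> mf; have md := measurable_dot mf mf; apply: mfun_M.
  by apply: mfun_natb; apply: mfun_ltr => //; exact: measurable_cst.
apply: mfun_X; apply: mfun_sqrt; apply: mfun_D; last exact: mfun_N.
exact: measurable_cst.
Qed.

Lemma measurable_rV_scale d (T : measurableType d) n (a : T -> R)
    (f : T -> 'rV[R]_n) : measurable_fun setT a -> measurable_fun setT f ->
  measurable_fun setT (fun t => a t *: f t).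
Proof.
move=> ma mf; apply: mfun_rVP => i.
rewrite (_ : (fun _ => _) = (fun t => a t * f t ord0 i)).
  by apply: mfun_M => //; exact: mfun_rV.
by apply/funext => t; rewrite mxE.
Qed.

End homogeneous_coordinates.

Section dot_ge0.
Context (R : realType).

Lemma dot_ge0 n (x : 'rV[R]_n) : 0 <= dot x x.
Proof. by apply: sumr_ge0 => i _; rewrite -expr2 sqr_ge0. Qed.

Lemma bker_ge0 m n (x : 'rV[R]_n) : 0 <= bker m x.
Proof. by rewrite mulr_ge0// exprn_ge0// sqrtr_ge0. Qed.

End dot_ge0.

Section dot_theory.
Context (R : realType) (n : nat).
Implicit Types x y z : 'rV[R]_n.

Lemma dotC x y : dot x y = dot y x.
Proof. by apply: eq_bigr => i _; rewrite mulrC. Qed.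

Lemma dotDl x y z : dot (x + y) z = dot x z + dot y z.
Proof. by rewrite -big_split; apply: eq_bigr => i _; rewrite mxE mulrDl. Qed.

Lemma dotZl (a : R) x y : dot (a *: x) y = a * dot x y.
Proof. by rewrite mulr_sumr; apply: eq_bigr => i _; rewrite mxE mulrA. Qed.

Lemma dotDr x y z : dot x (y + z) = dot x y + dot x z.
Proof. by rewrite dotC dotDl !(dotC _ x). Qed.

Lemma dotZr (a : R) x y : dot x (a *: y) = a * dot x y.
Proof. by rewrite dotC dotZl dotC. Qed.

Lemma dotNl x y : dot (- x) y = - dot x y.
Proof. by rewrite -scaleN1r dotZl mulN1r. Qed.

Lemma dotNr x y : dot x (- y) = - dot x y.
Proof. by rewrite dotC dotNl dotC. Qed.

Lemma mulmx_dot x y : x *m y^T = (dot x y)%:M.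
Proof.
rewrite [LHS]mx11_scalar mxE; congr (_ %:M).
by apply: eq_bigr => i _; rewrite mxE.
Qed.

(** Expanding |x - y|^2 >= 0 gives 2 x . y <= |x|^2 + |y|^2 < 2. *)
Lemma dot_lt1 x y : dot x x < 1 -> dot y y < 1 -> dot x y < 1.
Proof.
move=> x1 y1; have := dot_ge0 (x - y).
rewrite dotDl !dotDr !dotNl !dotNr (dotC y x) => h.
by lra.
Qed.

End dot_theory.

Section quadratic_weight.
Context (R : realType).

(* For m = n + 1, the integral of 1 - |p|^2 over the simplex with vertices x is
   quad x times |det (hmx x)| / (m + 1)!, by the second moments of the uniform
   distribution on the barycentric coordinates. *)
Definition quad m n (x : m.-tuple 'rV[R]_n) : R :=
  \sum_i \sum_j (1 + (i == j)%:R) * (1 - dot (tnth x i) (tnth x j)).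

Definition bprod k m n (x : m.-tuple 'rV[R]_n) : R :=
  \prod_i bker k (tnth x i).

Lemma bprod_ge0 k m n (x : m.-tuple 'rV[R]_n) : 0 <= bprod k x.
Proof. by apply: prodr_ge0 => i _; exact: bker_ge0. Qed.

Lemma bprod_neq0 k m n (x : m.-tuple 'rV[R]_n) : bprod k x != 0 ->
  forall i, dot (tnth x i) (tnth x i) < 1.
Proof.
move=> /prodf_neq0 H i; have := H i isT; rewrite /bker.
by case: ltP => //; rewrite mul0r eqxx.
Qed.

(** [quad] can be negative for points outside the ball, where [bprod] vanishes; only the product is
    fit for Tonelli. *)
Lemma bprod_quad_ge0 k m n (x : m.-tuple 'rV[R]_n) : 0 <= bprod k x * quad x.
Proof.
have [->|/bprod_neq0 H] := eqVneq (bprod k x) 0; first by rewrite mul0r.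
apply: mulr_ge0; first exact: bprod_ge0.
apply: sumr_ge0 => i _; apply: sumr_ge0 => j _; apply: mulr_ge0.
  by rewrite addr_ge0.
by rewrite subr_ge0 ltW// dot_lt1.
Qed.

Lemma measurable_quad d (T : measurableType d) m n (f : T -> m.-tuple 'rV[R]_n) :
  measurable_fun setT f -> measurable_fun setT (fun t => quad (f t)).
Proof.
move=> mf; apply: mfun_sum => i; apply: mfun_sum => j.
apply: mfun_M; first exact: measurable_cst.
apply: mfun_D; first exact: measurable_cst.
by apply: mfun_N; apply: measurable_dot; exact: mfun_tnth.
Qed.

Lemma measurable_bprod d (T : measurableType d) k m n
    (f : T -> m.-tuple 'rV[R]_n) :
  measurable_fun setT f -> measurable_fun setT (fun t => bprod k (f t)).
Proof.
by move=> mf; apply: mfun_prod => i; apply: measurable_bker; exact: mfun_tnth.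
Qed.

End quadratic_weight.

Ltac pos := intros; rewrite ?lee_fin; repeat first
  [ done | exact: sqrtr_ge0 | exact: expR_ge0 | exact: sqr_ge0
  | exact: normr_ge0 | exact: powR_ge0 | exact: ltW
  | exact: bprod_quad_ge0 | exact: bker_ge0 | exact: dot_ge0
  | exact: bprod_ge0 | apply: mulr_ge0
  | apply: addr_ge0 | apply: prodr_ge0 => ? _ | apply: sumr_ge0 => ? _
  | apply: exprn_ge0 | rewrite invr_ge0 | apply: mule_ge0
  | apply: integral_ge0 => ? _; rewrite ?lee_fin ].

(** One step of a syntax-directed measurability proof; a function that is not a visible abstraction
    is eta-expanded by the last case. *)
Ltac mfun_step F := lazymatch F with
  | (fun x => x) => exact: measurable_id
  | (fun x => (@?f x + @?g x)%R) => first [apply: mfun_D | apply: measurable_rV_add]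
  | (fun x => (@?f x * @?g x)%R) => apply: mfun_M
  | (fun x => (- (@?f x))%R) => apply: mfun_N
  | (fun x => ((@?f x) ^-1)%R) => apply: mfun_inv
  | (fun x => ((@?f x) ^+ ?n)%R) => apply: mfun_X
  | (fun x => (nat_of_bool (@?f x))%:R%R) => apply: mfun_natb
  | (fun x => ((@?f x) *+ ?n)%R) => apply: mfun_Mn
  | (fun x => expR (@?f x)) => apply: mfun_expR
  | (fun x => Num.sqrt (@?f x)) => apply: mfun_sqrt
  | (fun x => Num.norm (@?f x)) => apply: mfun_norm
  | (fun x => powR (@?f x) ?n) => apply: mfun_powR
  | (fun x => (\sum_(i <- ?s) (@?f x i))%R) => apply: mfun_sum => ?
  | (fun x => (\prod_(i <- ?s) (@?f x i))%R) => apply: mfun_prod => ?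
  | (fun x => (@?f x <= @?g x)%R) => apply: mfun_ler
  | (fun x => (@?f x < @?g x)%R) => apply: mfun_ltr
  | (fun x => (@?f x == @?g x)%R) => apply: mfun_eqr
  | (fun x => @?f x && @?g x) => apply: mfun_and
  | (fun x => ~~ (@?f x)) => apply: mfun_neg
  | (fun x => (@?f x)%:E) => apply: mfun_E
  | (fun x => (@?f x + @?g x)%E) => apply: emfun_D
  | (fun x => (@?f x * @?g x)%E) => apply: emfun_M
  | (fun x => integral ?mu setT (@?f x)) =>
      apply: mfun_integral; [try solve [pos] | ]
  | (fun x => (@?f x, @?g x)) => apply: mfun_pair
  | (fun x => (@?f x).1) => apply: mfun_fst
  | (fun x => (@?f x).2) => apply: mfun_snd
  | (fun x => tnth (@?f x) ?i) => apply: mfun_tnth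
  | (fun x => tcons (@?f x)) => apply: mfun_tcons
  | (fun x => rV_cons (@?f x)) => apply: mfun_rV_cons
  | (fun x => fun_of_matrix (@?f x) ?i ?j) => apply: mfun_rV
  | (fun x => mulmx (@?f x) ?M) => apply: measurable_rV_mulmx
  | @rV_cons _ _ => exact: measurable_rV_cons
  | @tcons _ _ => exact: measurable_tcons
  | (fun x => mktuple (@?f x)) => apply: measurable_mktuple => ?
  | (fun x => attach (@?f x) (@?g x)) => apply: measurable_attach
  | (fun x => determinant (hmx (@?f x))) => apply: measurable_det_hmx
  | (fun x => dot (@?f x) (@?g x)) => apply: measurable_dot
  | (fun x => bker ?m (@?f x)) => apply: measurable_bker
  | (fun x => (@?a x) *: (@?f x)) => apply: measurable_rV_scale
  | (fun x => quad (@?f x)) => apply: measurable_quad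
  | (fun x => bprod ?k (@?f x)) => apply: measurable_bprod
  | fst => exact: measurable_fst
  | snd => exact: measurable_snd
  | (fun x => @?f x) =>
      first [exact: measurable_cst | apply: mfun_all => ? | apply: mfun_if]
  | ?G => lazymatch goal with |- @measurable_fun ?d ?e ?T ?U ?D _ =>
      change (@measurable_fun d e T U D (fun x => G x)) end
  end.

Ltac mfun := repeat match goal with
  | |- @measurable_fun _ _ _ _ _ ?F => mfun_step F
  | H : @measurable_fun _ _ _ _ _ ?f |- @measurable_fun _ _ _ _ _ ?F =>
    first [exact: H | apply: (measurableT_comp H)]
  | H : forall i, @measurable_fun _ _ _ _ _ _ |- @measurable_fun _ _ _ _ _ _ =>
    first [exact: H | apply: (measurableT_comp (H _))]
  end.

(* Equations are left alone, so that the main goal survives. *)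
Ltac side := try lazymatch goal with
  | |- @measurable_fun _ _ _ _ _ _ => solve [mfun]
  | |- @eq _ _ _ => fail
  | |- is_true _ => solve [pos]
  | |- _ => solve [done | pos]
  end.

(** * Linear changes of variables *)

Section affine_line.
Context (R : realType).
Local Notation leb := (@lebesgue_measure R).

Let aff (a b : R) : measurableTypeR R -> measurableTypeR R :=
  fun x => a * x + b.

Let measurable_aff a b : measurable_fun setT (aff a b).
Proof. by rewrite /aff; mfun. Qed.

Let lebesgue_aff_itv (a b c d : R) : a != 0 ->
  (`|a|%:E * leb (aff a b @^-1` `]c, d]) = leb `]c, d])%E.
Proof.
move=> a0; have [a_gt0|a_lt0] : 0 < a \/ a < 0.
  by move: a0; rewrite neq_lt => /orP[]; [right|left].
- rewrite (_ : _ @^-1` _ = `](c - b) / a, (d - b) / a]%classic).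
    rewrite !lebesgue_measure_itv /= !lte_fin ltr_pM2r ?invr_gt0// ltrBlDr.
    rewrite subrK gtr0_norm//; case: ifPn => _; last by rewrite mule0.
    by rewrite -EFinB -EFinM -EFinB; congr EFin; field.
  apply/seteqP; split=> x /=; rewrite /aff !in_itv /= => /andP[h1 h2];
    apply/andP; split.
  + by rewrite ltr_pdivrMr// ltrBlDr mulrC.
  + by rewrite ler_pdivlMr// lerBrDr mulrC.
  + by move: h1; rewrite ltr_pdivrMr// ltrBlDr mulrC.
  + by move: h2; rewrite ler_pdivlMr// lerBrDr mulrC.
(* A negative slope moves the open end of the interval to the other side, which leaves the length
   unchanged. *)
- rewrite (_ : _ @^-1` _ = `[(d - b) / a, (c - b) / a[%classic).
    rewrite !lebesgue_measure_itv /= !lte_fin ltr_nM2r ?invr_lt0// ltrBlDr.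
    rewrite subrK ltr0_norm//; case: ifPn => _; last by rewrite mule0.
    by rewrite -EFinB -EFinM -EFinB; congr EFin; field.
  apply/seteqP; split=> x /=; rewrite /aff !in_itv /= => /andP[h1 h2];
    apply/andP; split.
  + by rewrite ler_ndivrMr// lerBrDr mulrC.
  + by rewrite ltr_ndivlMr// ltrBlDr mulrC.
  + by move: h2; rewrite ltr_ndivlMr// ltrBlDr mulrC.
  + by move: h1; rewrite ler_ndivrMr// lerBrDr mulrC.
Qed.

(** The image of Lebesgue measure under x -> a x + b, multiplied by |a|, agrees with Lebesgue
    measure on half-open intervals, hence everywhere by uniqueness. *)
Lemma integral_affine (a b : R) (F : R -> \bar R) : a != 0 ->
  measurable_fun setT F -> (forall x, 0 <= F x)%E ->
  (\int[leb]_x F x = `|a|%:E * \int[leb]_x F (a * x + b)%R)%E.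
Proof.
move=> a0 mF F0.
pose p : {measure set (measurableTypeR R) -> \bar R} :=
  measure_function_pushforward__canonical__measure_function_Measure
    leb (measurable_aff a b).
pose m := mscale (NngNum (normr_ge0 a)) p.
have mE A : measurable A -> leb A = m A.
  apply: lebesgue_measure_unique => _ [[c d] _ <-] /=.
  by rewrite -[LHS](lebesgue_aff_itv b _ _ a0).
rewrite (@eq_measure_integral _ _ _ _ m)//; last by move=> A mA _; exact: mE.
rewrite ge0_integral_mscale//; congr (_ * _)%E.
rewrite ge0_integral_pushforward// => *; exact: F0.
Qed.

Lemma integral_shift (b : R) (F : R -> \bar R) :
  measurable_fun setT F -> (forall x, 0 <= F x)%E ->
  (\int[leb]_x F (x + b)%R = \int[leb]_x F x)%E.
Proof.
move=> mF F0; rewrite [RHS](@integral_affine 1 b)//.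
by rewrite normr1 mul1e; under [in RHS]eq_integral do rewrite mul1r.
Qed.

End affine_line.

Section affine_space.
Context (R : realType).
Local Notation leb := (@lebesgue_measure R).

Lemma rV_consD n (a b : R) (u v : 'rV[R]_n) :
  rV_cons (a + b, u + v) = rV_cons (a, u) + rV_cons (b, v).
Proof.
by apply/rowP => i; rewrite !mxE; case: (unlift ord0 i) => //= j; rewrite mxE.
Qed.

(** Gives access to block matrix products, [1 + n] and [n.+1] being convertible. *)
Lemma rV_consE n (a : R) (u : 'rV[R]_n) :
  rV_cons (a, u) = row_mx (a%:M : 'M[R]_1) u :> 'rV[R]_(1 + n).
Proof.
apply/rowP => i; rewrite !mxE; case: splitP => [j|j] ij.
  rewrite (_ : i = ord0) ?unlift_none /=; last by apply: val_inj => /=; rewrite ij ord1.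
  by rewrite (ord1 j) mxE eqxx mulr1n.
rewrite (_ : i = lift ord0 j) ?liftK//.
exact: val_inj.
Qed.

Lemma rV_cons_uncons n (x : 'rV[R]_n.+1) :
  x = rV_cons (x ord0 ord0, \row_j x ord0 (lift ord0 j)).
Proof.
apply/rowP => i; rewrite !mxE; case: unliftP => [j|] -> //=.
by rewrite mxE.
Qed.

Lemma integral_rV_shift n (v : 'rV[R]_n) (F : 'rV[R]_n -> \bar R) :
  measurable_fun setT F -> (forall x, 0 <= F x)%E ->
  (\int[lebesgue_rV n]_x F (x + v)%R = \int[lebesgue_rV n]_x F x)%E.
Proof.
elim: n v F => [|n IH] v F mF F0.
  by apply: eq_integral => x _; congr F; apply/rowP => -[].
have mFv : measurable_fun setT (fun x : 'rV[R]_n.+1 => F (x + v)).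
  by mfun.
rewrite (integral_rVS mFv (fun x => F0 _)) (integral_rVS mF F0).
rewrite -[RHS](@integral_shift _ (v ord0 ord0)).
- apply: eq_integral => x _.
  pose w := \row_j v ord0 (lift ord0 j).
  rewrite -(IH w (fun u => F (rV_cons (x + v ord0 ord0, u)))).
  + apply: eq_integral => u _; congr F.
    by rewrite [in LHS](rV_cons_uncons v) -rV_consD.
  + by mfun.
  + by move=> u; exact: F0.
- by mfun.
- by move=> x; apply: integral_ge0 => u _; exact: F0.
Qed.

End affine_space.

Section linear_change_of_variables.
Context (R : realType).

Let cov n (M : 'M[R]_n) := forall F : 'rV[R]_n -> \bar R,
  measurable_fun setT F -> (forall x, 0 <= F x)%E ->
  (\int[lebesgue_rV n]_x F x =
   `|\det M|%:E * \int[lebesgue_rV n]_x F (x *m M)%R)%E.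

Let cov_mul n (M N : 'M[R]_n) : cov M -> cov N -> cov (M *m N).
Proof.
move=> cM cN F mF F0; rewrite cN// (cM (fun x => F (x *m N)))//; last first.
  by mfun.
rewrite muleA -EFinM -normrM mulrC det_mulmx; congr (_ * _)%E.
by apply: eq_integral => x _; rewrite mulmxA.
Qed.

Let rV_consME n (t : R) (v : 'rV[R]_n) (a : R) (u : 'rV[R]_n) (w : 'cV[R]_n)
    (N : 'M[R]_n) :
  rV_cons (t, v) *m (block_mx a%:M u w N : 'M[R]_(1 + n)) =
  rV_cons (t * a + (v *m w) ord0 ord0, t *: u + v *m N) :> 'rV[R]_n.+1.
Proof.
rewrite !rV_consE.
have E : (t * a + (v *m w) ord0 ord0)%:M = t%:M *m a%:M + v *m w :> 'M[R]_1.
  by rewrite [v *m w]mx11_scalar raddfD /= -scalar_mxM mxE eqxx mulr1n.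
by rewrite E -mul_scalar_mx -(mul_row_block (t%:M : 'M[R]_1) v a%:M u w N).
Qed.

(** The first coordinate t is rescaled by [a]; for fixed t, the others undergo [N] and a translation
    by t u. *)
Let cov_upper n (a : R) (u : 'rV[R]_n) (N : 'M[R]_n) : a != 0 ->
  cov N -> @cov n.+1 (block_mx (a%:M : 'M[R]_1) u 0 N : 'M[R]_(1 + n)).
Proof.
move=> a0 cN F mF F0.
have mFM : measurable_fun setT (fun x : 'rV[R]_n.+1 =>
    F (x *m (block_mx (a%:M : 'M[R]_1) u 0 N : 'M[R]_(1 + n)))) by mfun.
rewrite (integral_rVS mF F0) (integral_rVS mFM (fun x => F0 _)).
rewrite [LHS](@integral_affine _ a 0 _ a0); last 2 first.
- by mfun.
- by move=> x; apply: integral_ge0 => *; exact: F0.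
have -> : @determinant _ n.+1 (block_mx (a%:M : 'M[R]_1) u 0 N) = a * \det N.
  by have := det_ublock (a%:M : 'M[R]_1) u N; rewrite det_scalar1.
rewrite normrM EFinM -muleA; congr (_ * _)%E.
rewrite -ge0_integralZl_EFin//; last 2 first.
- by move=> x _; apply: integral_ge0 => *; exact: F0.
- by mfun.
apply: eq_integral => t _; rewrite addr0.
have mG : measurable_fun setT (fun v : 'rV[R]_n => F (rV_cons (a * t, v))).
  by mfun.
have mG' : measurable_fun setT
    (fun v : 'rV[R]_n => F (rV_cons (a * t, v + t *: u))) by mfun.
rewrite -(integral_rV_shift (t *: u) mG (fun x => F0 _)) (cN _ mG' _)//.
congr (_ * _)%E; apply: eq_integral => v _; rewrite rV_consME.
by rewrite mulmx0 mxE addr0 mulrC [_ *: _ + _]addrC.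
Qed.

(** For fixed [v], the first coordinate is merely translated, by v w. *)
Let cov_lower n (w : 'cV[R]_n) :
  @cov n.+1 (block_mx (1%:M : 'M[R]_1) 0 w 1%:M : 'M[R]_(1 + n)).
Proof.
move=> F mF F0.
have mFM : measurable_fun setT (fun x : 'rV[R]_n.+1 =>
    F (x *m (block_mx (1%:M : 'M[R]_1) 0 w 1%:M : 'M[R]_(1 + n)))) by mfun.
rewrite (integral_rVS mF F0) (integral_rVS mFM (fun x => F0 _)).
have -> : @determinant _ n.+1 (block_mx (1%:M : 'M[R]_1) 0 w 1%:M) = 1.
  by have := det_lblock (1%:M : 'M[R]_1) w 1%:M; rewrite !det1 mulr1.
rewrite normr1 mul1e.
have mF1 : measurable_fun setT (fun p : measurableTypeR R * 'rV[R]_n =>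
  F (rV_cons p)) by mfun.
have mF2 : measurable_fun setT (fun p : measurableTypeR R * 'rV[R]_n =>
  F (rV_cons p *m (block_mx (1%:M : 'M[R]_1) 0 w 1%:M : 'M[R]_(1 + n)))).
  by mfun.
rewrite (fubini_tonelli _ mF1 (fun x => F0 _)).
rewrite (fubini_tonelli _ mF2 (fun x => F0 _)).
apply: eq_integral => v _.
rewrite -(@integral_shift _ ((v *m w) ord0 ord0)); last by move=> *; exact: F0.
  apply: eq_integral => t _; rewrite rV_consME.
  by rewrite mulr1 scaler0 add0r mulmx1.
by mfun.
Qed.

(** Gaussian elimination: since [cov] is multiplicative, a block triangular factorization reduces
    the size by one. *)
Let cov_step n (M : 'M[R]_(1 + n)) :
  (forall N : 'M[R]_n, N \in unitmx -> cov N) -> M \in unitmx -> cov M.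
Proof.
move=> IH uM.
have pivot (a : R) (u : 'rV[R]_n) (w : 'cV[R]_n) (N : 'M[R]_n) : a != 0 ->
    (block_mx (a%:M : 'M[R]_1) u w N : 'M[R]_(1 + n)) \in unitmx ->
    cov (block_mx (a%:M : 'M[R]_1) u w N : 'M[R]_(1 + n)).
  move=> a0.
  (* The lower right block of the second factor is the Schur complement of the pivot [a]. *)
  have -> : (block_mx (a%:M : 'M[R]_1) u w N : 'M[R]_(1 + n)) =
      (block_mx (1%:M : 'M[R]_1) 0 (a^-1 *: w) 1%:M : 'M[R]_(1 + n)) *m
      (block_mx (a%:M : 'M[R]_1) u 0 (N - (a^-1 *: w) *m u)).
    rewrite mulmx_block !mul1mx !mul0mx !addr0 addrC subrK.
    by rewrite mul_mx_scalar scalerA mulfV// scale1r.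
  rewrite unitmx_mul => /andP[_ uU]; apply: cov_mul; first exact: cov_lower.
  apply: cov_upper => //; apply: IH.
  move: uU; rewrite !unitmxE det_ublock det_scalar1 !unitfE mulf_eq0 negb_or.
  by case/andP.
rewrite -[M](@submxK _ 1 n 1 n) in uM *.
rewrite [ulsubmx _]mx11_scalar in uM *.
set a := ulsubmx _ _ _ in uM *; set u := ursubmx _ in uM *.
set w := dlsubmx _ in uM *; set N := drsubmx _ in uM *.
have [a0|a0] := eqVneq a 0; last exact: pivot.
have [j uj] : exists j, u ord0 j != 0.
  apply/existsP; apply: contraTT uM; rewrite negb_exists => /forallP u0.
  have -> : u = 0 by apply/rowP => j; rewrite [RHS]mxE; apply/eqP/negPn.
  by rewrite a0 unitmxE det_lblock det_scalar1 mul0r unitr0.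
pose S (z : 'cV[R]_n) : 'M[R]_(1 + n) := block_mx (1%:M : 'M[R]_1) 0 z 1%:M.
pose z : 'cV[R]_n := delta_mx j ord0.
have detS y : \det (S y) = 1 by rewrite /S det_lblock !det1 mulr1.
set M' := block_mx _ _ _ _.
(* When the corner entry is 0, right multiplication by [S z] adds the column of the nonzero entry
   [u ord0 j] to the first one and so creates a pivot. *)
have -> : M' = M' *m S z *m S (- z).
  rewrite -mulmxA /S mulmx_block !mulmx1 !mul1mx !mul0mx !addr0 !mulmx0 add0r.
  by rewrite subrr -scalar_mx_block mulmx1.
apply: cov_mul; last exact: cov_lower.
have uMS : M' *m S z \in unitmx.
  by rewrite unitmx_mul uM unitmxE detS unitr1.
move: uMS; rewrite /S mulmx_block !mulmx1 !mulmx0 !add0r.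
rewrite [_ + u *m z]mx11_scalar; apply: pivot.
rewrite a0 raddf0 add0r mxE (bigD1 j)//= [z j _]mxE !eqxx mulr1.
rewrite big1 ?addr0// => k kj.
by rewrite [z k _]mxE (negbTE kj) mulr0.
Qed.

Theorem integral_mulmx n (M : 'M[R]_n) (F : 'rV[R]_n -> \bar R) :
  M \in unitmx -> measurable_fun setT F -> (forall x, 0 <= F x)%E ->
  (\int[lebesgue_rV n]_x F x =
   `|\det M|%:E * \int[lebesgue_rV n]_x F (x *m M)%R)%E.
Proof.
move=> uM; move: F; change (cov M).
elim: n M uM => [|n IH] M uM.
  move=> F mF F0; rewrite det_mx00 normr1 mul1e.
  by apply: eq_integral => x _; congr F; apply/rowP => -[].
exact: cov_step.
Qed.

End linear_change_of_variables.

(** * Integrals over tuples of points *)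

Section tuple_integrals.
Context (R : realType).

Lemma tnth_tcons0 (E : Type) n (p : E * n.-tuple E) : tnth (tcons p) ord0 = p.1.
Proof. by []. Qed.

Lemma tnth_tconsS (E : Type) n (p : E * n.-tuple E) i :
  tnth (tcons p) (lift ord0 i) = tnth p.2 i.
Proof. by rewrite tnthS /=; congr tnth; apply: val_inj. Qed.

Lemma mktuple_tcons (E : Type) n (f : 'I_n.+1 -> E) :
  [tuple f i | i < n.+1] = tcons (f ord0, [tuple f (lift ord0 i) | i < n]).
Proof.
apply: eq_from_tnth => i; rewrite tnth_mktuple.
by case: (unliftP ord0 i) => [j|] ->; rewrite ?tnth_tconsS ?tnth_mktuple.
Qed.

Lemma integral_tuple_prod d (E : measurableType d)
    (mu : {sigma_finite_measure set E -> \bar R}) n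
    (h : 'I_n -> E -> R) (c : 'I_n -> R) :
  (forall i, measurable_fun setT (h i)) -> (forall i x, 0 <= h i x) ->
  (forall i, \int[mu]_x (h i x)%:E = (c i)%:E)%E ->
  (\int[tuple_measure mu n]_t (\prod_i h i (tnth t i))%:E =
   (\prod_i c i)%:E)%E.
Proof.
elim: n h c => [|n IH] h c mh h0 hc.
  rewrite integral_tuple0; last by mfun.
  by rewrite !big_ord0.
have mP : measurable_fun setT (fun t : n.+1.-tuple E =>
  (\prod_i h i (tnth t i))%:E) by mfun.
rewrite (integral_tupleS _ mP); last first.
  by move=> t; rewrite lee_fin; apply: prodr_ge0.
rewrite big_ord_recl EFinM -(IH (fun i => h (lift ord0 i)))//.
rewrite -hc -ge0_integralZr//; last 3 first.
- by mfun.
- by move=> x _; rewrite lee_fin.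
- by apply: integral_ge0 => t _; rewrite lee_fin; apply: prodr_ge0.
apply: eq_integral => x _.
rewrite -ge0_integralZl_EFin//; last 2 first.
- by move=> t _; rewrite lee_fin; apply: prodr_ge0.
- by mfun.
apply: eq_integral => t _; rewrite -EFinM big_ord_recl tnth_tcons0.
by congr (_ * _)%:E; apply: eq_bigr => i _; rewrite tnth_tconsS.
Qed.

Lemma integral_rV_prod n (h : 'I_n -> R -> R) (c : 'I_n -> R) :
  (forall i, measurable_fun setT (h i)) -> (forall i x, 0 <= h i x) ->
  (forall i, \int[@lebesgue_measure R]_x (h i x)%:E = (c i)%:E)%E ->
  (\int[lebesgue_rV n]_y (\prod_i h i (y ord0 i))%:E = (\prod_i c i)%:E)%E.
Proof.
elim: n h c => [|n IH] h c mh h0 hc.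
  rewrite integral_rV0; last by mfun.
  by rewrite !big_ord0.
have mP : measurable_fun setT (fun y : 'rV[R]_n.+1 =>
  (\prod_i h i (y ord0 i))%:E) by mfun.
rewrite (integral_rVS mP); last first.
  by move=> t; rewrite lee_fin; apply: prodr_ge0.
rewrite big_ord_recl EFinM -(IH (fun i => h (lift ord0 i)))//.
rewrite -hc -ge0_integralZr//; last 3 first.
- by mfun.
- by move=> x _; rewrite lee_fin.
- by apply: integral_ge0 => t _; rewrite lee_fin; apply: prodr_ge0.
apply: eq_integral => x _.
rewrite -ge0_integralZl_EFin//; last 2 first.
- by move=> t _; rewrite lee_fin; apply: prodr_ge0.
- by mfun.
apply: eq_integral => t _; rewrite -EFinM big_ord_recl mxE unlift_none.
by congr (_ * _)%:E; apply: eq_bigr => i _; rewrite mxE liftK.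
Qed.

(** The map may depend on the index, which makes it possible to reflect a single point. *)
Lemma integral_tuple_map d d' (E : measurableType d) (E' : measurableType d')
    (mu : {sigma_finite_measure set E -> \bar R})
    (mu' : {sigma_finite_measure set E' -> \bar R}) n
    (phi : 'I_n -> E' -> E) (c : 'I_n -> R) (F : n.-tuple E -> \bar R) :
  (forall i, measurable_fun setT (phi i)) -> (forall i, 0 <= c i) ->
  (forall i (G : E -> \bar R), measurable_fun setT G ->
    (forall x, 0 <= G x)%E ->
    (\int[mu]_x G x = (c i)%:E * \int[mu']_x G (phi i x))%E) ->
  measurable_fun setT F -> (forall t, 0 <= F t)%E ->
  (\int[tuple_measure mu n]_t F t = (\prod_i c i)%:E *
    \int[tuple_measure mu' n]_t F [tuple phi i (tnth t i) | i < n])%E.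
Proof.
elim: n phi c F => [|n IH] phi c F mphi c0 mc mF F0.
  rewrite big_ord0 mul1e !integral_tuple0//.
    by congr F; apply: eq_from_tnth => -[].
  by mfun.
have mFm : measurable_fun setT (fun t : n.+1.-tuple E' =>
    F [tuple phi i (tnth t i) | i < n.+1]).
  by apply: (measurableT_comp mF); apply: measurable_mktuple => i; mfun.
rewrite (integral_tupleS _ mF F0) (integral_tupleS _ mFm (fun x => F0 _)).
have mFp (x : E') : measurable_fun setT (fun t : n.-tuple E' =>
    F (tcons (phi ord0 x, [tuple phi (lift ord0 i) (tnth t i) | i < n]))).
  by mfun.
rewrite (mc ord0); last 2 first.
- by mfun.
- by move=> x; apply: integral_ge0 => t _; exact: F0.
rewrite big_ord_recl EFinM -muleA; congr (_ * _)%E.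
rewrite -ge0_integralZl_EFin//; last 3 first.
- by move=> x _; apply: integral_ge0 => t _; exact: F0.
- by mfun.
- exact: prodr_ge0.
apply: eq_integral => x _.
have mFx : measurable_fun setT (fun t => F (tcons (phi ord0 x, t))) by mfun.
rewrite (IH _ _ _ (fun i => mphi (lift ord0 i)) (fun i => c0 (lift ord0 i))
  (fun i => mc (lift ord0 i)) mFx (fun t => F0 _)).
congr (_ * _)%E; apply: eq_integral => t _; congr F.
rewrite mktuple_tcons; congr tcons; congr pair.
by apply: eq_from_tnth => i; rewrite !tnth_mktuple tnth_tconsS.
Qed.

Lemma attach_cons m n (a : R) (y : 'rV[R]_m) (u : 'rV[R]_n) x :
  attach (rV_cons (a, y)) (tcons (u, x)) = tcons (rV_cons (a, u), attach y x).
Proof.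
rewrite {1}/attach mktuple_tcons mxE unlift_none; congr tcons; congr pair.
apply: eq_from_tnth => i.
by rewrite !tnth_mktuple mxE liftK tnth_tconsS.
Qed.

(** A reordering of the coordinates. By induction, the first coordinate [a] of the first point is
    moved past its other coordinates [u], then past the other coordinates of the remaining
    points. *)
Lemma integral_attach m n (F : m.-tuple 'rV[R]_n.+1 -> \bar R) :
  measurable_fun setT F -> (forall t, 0 <= F t)%E ->
  (\int[tuple_measure (lebesgue_rV n.+1) m]_t F t =
   \int[tuple_measure (lebesgue_rV n) m]_x
     \int[lebesgue_rV m]_y F (attach y x))%E.
Proof.
elim: m F => [|m IH] F mF F0.
  rewrite !integral_tuple0//.
    rewrite integral_rV0; first by congr F; apply: eq_from_tnth => -[].
    by mfun.
  by mfun.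
have mFa d (T : measurableType d) (f : T -> m.+1.-tuple 'rV[R]_n)
    (g : T -> 'rV[R]_m.+1) : measurable_fun setT f -> measurable_fun setT g ->
    measurable_fun setT (fun t => F (attach (g t) (f t))).
  by move=> mf mg; mfun.
rewrite (integral_tupleS _ mF F0).
rewrite [RHS]integral_tupleS; last 2 first.
- by mfun.
- by move=> t; apply: integral_ge0 => y _; exact: F0.
rewrite [LHS](integral_rVS (F := fun X0 : 'rV[R]_n.+1 =>
  (\int[tuple_measure (lebesgue_rV n.+1) m]_t F (tcons (X0, t)))%E)); last 2 first.
- by mfun.
- by move=> t; apply: integral_ge0 => y _; exact: F0.
rewrite (fubini_tonelli (fun p : measurableTypeR R * 'rV[R]_n =>
  (\int[tuple_measure (lebesgue_rV n.+1) m]_t F (tcons (rV_cons p, t)))%E));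
  last 2 first.
- by mfun.
- by move=> p; apply: integral_ge0 => y _; exact: F0.
apply: eq_integral => u _.
pose G (a : R) (x : m.-tuple 'rV[R]_n) (y : 'rV[R]_m) :=
  F (tcons (rV_cons (a, u), attach y x)).
transitivity (\int[@lebesgue_measure R]_a
  \int[tuple_measure (lebesgue_rV n) m]_x \int[lebesgue_rV m]_y G a x y)%E.
  apply: eq_integral => a _.
  by rewrite (IH (fun t => F (tcons (rV_cons (a, u), t))))//; mfun.
rewrite (fubini_tonelli (fun p : measurableTypeR R * m.-tuple 'rV[R]_n =>
  (\int[lebesgue_rV m]_y G p.1 p.2 y)%E)); last 2 first.
- by rewrite /G; mfun.
- by move=> p; apply: integral_ge0 => y _; exact: F0.
apply: eq_integral => x _.
rewrite [RHS](integral_rVS (F := fun y => F (attach y (tcons (u, x))))).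
- by apply: eq_integral => a _; apply: eq_integral => y _; rewrite attach_cons.
- by mfun.
- by move=> y; exact: F0.
Qed.
End tuple_integrals.

Lemma measurable_bool d (T : measurableType d) (b : T -> bool) :
  measurable_fun setT b -> measurable [set x | b x].
Proof.
move=> mb; rewrite (_ : [set x | b x] = b @^-1` [set true]).
  by rewrite -[X in measurable X]setTI; exact: mb.
by apply/seteqP; split => x /=.
Qed.

Lemma measure_bool d (T : measurableType d) (R : realType)
    (mu : {measure set T -> \bar R}) (b : T -> bool) :
  measurable_fun setT b ->
  mu [set x | b x] = (\int[mu]_x (b x)%:R%:E)%E.
Proof.
move=> mb; have mB := measurable_bool mb.
rewrite -[[set x | _]]setIT -integral_indic//; apply: eq_integral => x _.
rewrite indicE; congr (_%:R)%:E; congr nat_of_bool.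
by apply/idP/idP; rewrite inE.
Qed.

(** * Affine dependences and singular configurations *)

Section homogeneous.
Context (R : realType).

Lemma row_hmx m n (x : m.-tuple 'rV[R]_n) i : row i (hmx x) = hom (tnth x i).
Proof. by apply/rowP => j; rewrite !mxE. Qed.

(** The column of first coordinates; column 0 of [hmx] is constantly 1. *)
Let j1 {n} : 'I_n.+2 := lift ord0 ord0.

Lemma col'_hmx_attach m n (y : 'rV[R]_m) (x : m.-tuple 'rV[R]_n) :
  col' j1 (hmx (attach y x)) = hmx x.
Proof.
apply/matrixP => i k; rewrite !mxE tnth_mktuple.
case: (unliftP ord0 k) => [k'|] ->.
  rewrite (_ : lift j1 (lift ord0 k') = lift ord0 (lift ord0 k')) ?liftK /=.
    by rewrite mxE liftK.
  exact: val_inj.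
rewrite (_ : lift j1 ord0 = ord0) ?unlift_none//.
exact: val_inj.
Qed.

Lemma hmx_attach1 m n (y : 'rV[R]_m) (x : m.-tuple 'rV[R]_n) i :
  hmx (attach y x) i j1 = y ord0 i.
Proof.
by rewrite !mxE tnth_mktuple /= liftK /= mxE unlift_none.
Qed.

(* The coefficients of the affine dependence of n + 2 points of R^n. *)
Definition gam n (x : n.+2.-tuple 'rV[R]_n) (i : 'I_n.+2) : R :=
  (-1) ^+ i.+1 * \det (row' i (hmx x)).

(** Deleting the column of the [y] leaves a minor in the [x] alone, with sign (-1)^(i + 1) because
    that column has index 1. *)
Lemma cofactor_attach n (y : 'rV[R]_n.+2) (x : n.+2.-tuple 'rV[R]_n) i :
  cofactor (hmx (attach y x)) i j1 = gam x i.
Proof. by rewrite /cofactor col'_hmx_attach /= addn1. Qed.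

Lemma det_attach n (y : 'rV[R]_n.+2) (x : n.+2.-tuple 'rV[R]_n) :
  \det (hmx (attach y x)) = \sum_i y ord0 i * gam x i.
Proof.
rewrite (expand_det_col _ j1); apply: eq_bigr => i _.
by rewrite hmx_attach1 cofactor_attach.
Qed.

Lemma row'0_hmx_tcons m n (x0 : 'rV[R]_n) (xs : m.-tuple 'rV[R]_n) :
  row' ord0 (hmx (tcons (x0, xs))) = hmx xs.
Proof.
by apply/matrixP => i j; rewrite !mxE tnth_tconsS.
Qed.

Lemma gam_tcons0 n (x0 : 'rV[R]_n) (xs : n.+1.-tuple 'rV[R]_n) :
  gam (tcons (x0, xs)) ord0 = - \det (hmx xs).
Proof. by rewrite /gam row'0_hmx_tcons expr1 mulN1r. Qed.

(** If column [j] of [hmx x] is used as the [y], the determinant has two equal columns. *)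
Lemma gam_ker n (x : n.+2.-tuple 'rV[R]_n) (j : 'I_n.+1) :
  \sum_i gam x i * hmx x i j = 0.
Proof.
pose y : 'rV[R]_n.+2 := \row_i hmx x i j.
transitivity (\det (hmx (attach y x))).
  by rewrite det_attach; apply: eq_bigr => i _; rewrite [y _ _]mxE mulrC.
rewrite -det_tr; apply: (determinant_alternate (i1 := j1) (i2 := lift j1 j)).
  exact: neq_lift.
move=> i; rewrite [LHS]mxE [RHS]mxE.
have -> : hmx (attach y x) i (lift j1 j) = col' j1 (hmx (attach y x)) i j.
  by rewrite [RHS]mxE.
by rewrite hmx_attach1 col'_hmx_attach [LHS]mxE.
Qed.

(** Once the other coordinates are fixed, a single value of the first coordinate solves the
    equation. *)
Lemma hyperplane_null m (g : 'I_m.+1 -> R) : g ord0 != 0 ->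
  (\int[lebesgue_rV m.+1]_y ((\sum_i y ord0 i * g i == 0)%R%:R : R)%:E = 0)%E.
Proof.
move=> g0.
have mF : measurable_fun setT (fun y : 'rV[R]_m.+1 =>
  ((\sum_i y ord0 i * g i == 0)%R%:R : R)%:E) by mfun.
rewrite (integral_rVS mF); last by move=> y; rewrite lee_fin.
rewrite (fubini_tonelli (fun p : measurableTypeR R * 'rV[R]_m =>
  ((\sum_i (rV_cons p) ord0 i * g i == 0)%R%:R : R)%:E)); last 2 first.
- by mfun.
- by move=> p; rewrite lee_fin.
rewrite integral0_eq// => v _.
pose a := - (\sum_i v ord0 i * g (lift ord0 i)) / g ord0.
transitivity (@lebesgue_measure R [set a]); last exact: lebesgue_measure_set1.
have -> : [set a] = [set x | x == a].
  by apply/seteqP; split => x /= /eqP.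
rewrite measure_bool; last by mfun.
apply: eq_integral => t _; congr (_%:R)%:E; congr nat_of_bool.
rewrite big_ord_recl mxE unlift_none /=.
under eq_bigr do rewrite mxE liftK /=.
by rewrite addr_eq0 /a; apply/eqP/eqP => [<-|->]; rewrite ?mulfK ?divfK.
Qed.

(** Induction on the dimension. The determinant is linear in the first coordinates [y], and its
    coefficient at [y ord0 ord0] is, up to sign, a determinant of the lower dimension, nonzero
    almost everywhere. *)
Lemma singular_null n :
  (\int[tuple_measure (@lebesgue_rV R n) n.+1]_x
     (\det (hmx x) == 0)%:R%:E = 0)%E.
Proof.
elim: n => [|n IH].
  rewrite integral0_eq// => x _; rewrite det_mx11 !mxE.
  by rewrite unlift_none /= oner_eq0.
have mD : measurable_fun setT (fun x : n.+2.-tuple 'rV[R]_n.+1 =>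
    (\det (hmx x) == 0)%:R%:E : \bar R).
  by mfun.
rewrite integral_attach//.
rewrite integral_tupleS; last 2 first.
- by mfun.
- by move=> x; apply: integral_ge0 => y _; rewrite lee_fin.
rewrite integral0_eq// => x0 _.
have mS : measurable_fun setT
    (fun x : n.+1.-tuple 'rV[R]_n => \det (hmx x) == 0).
  by mfun.
rewrite -(integral0 (tuple_measure (@lebesgue_rV R n) n.+1) setT).
apply: (ge0_integral_off_null (measurable_bool mS)) => //.
- by rewrite measure_bool.
- by move=> x; apply: integral_ge0 => y _; rewrite lee_fin.
move=> xs /negP xsN0; rewrite -[RHS](hyperplane_null (g := gam (tcons (x0, xs)))).
  by apply: eq_integral => y _; rewrite det_attach.
by rewrite gam_tcons0 oppr_eq0.
Qed.

Lemma measurable_singular n :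
  measurable [set x : n.+1.-tuple 'rV[R]_n | \det (hmx x) == 0].
Proof.
apply: measurable_bool.
by mfun.
Qed.

Lemma singular_measure0 n :
  tuple_measure (@lebesgue_rV R n) n.+1 [set x | \det (hmx x) == 0] = 0%E.
Proof.
rewrite measure_bool ?singular_null//.
by mfun.
Qed.

End homogeneous.

(** * Gamma and ball integrals *)

Lemma integral_bool d (T : measurableType d) (R : realType)
    (mu : {measure set T -> \bar R}) (D : set T) (b : T -> bool) (f : T -> R) :
  (forall x, D x <-> b x) ->
  (\int[mu]_(x in D) (f x)%:E = \int[mu]_x ((b x)%:R * f x)%:E)%E.
Proof.
move=> Db; rewrite integral_mkcond; apply: eq_integral => x _; rewrite patchE.
have [Dx|Dx] := pselect (D x).
  by rewrite mem_set// (Db x).1// mul1r.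
rewrite memNset//; case: (boolP (b x)) => [/Db//|_].
by rewrite mul0r.
Qed.

Section gamma_integrals.
Context (R : realType).
Local Notation leb := (@lebesgue_measure R).

(* The integral defining Gamma (j / 2 + 1). *)
Definition gint (j : nat) : \bar R :=
  (\int[leb]_t ((0 < t)%R%:R * (Num.sqrt t ^+ j * expR (- t)))%:E)%E.

Lemma gint0 : gint 0 = 1%E.
Proof.
rewrite -(@integral_exponential_pdf R 1)// /gint.
transitivity (\int[leb]_(t in `]0%R, +oo[) (expR (- t))%:E)%E.
  rewrite [RHS](@integral_bool _ _ _ leb _ (fun t : R => 0 < t)).
    by apply: eq_integral => t _; rewrite expr0 mul1r.
  by move=> t; rewrite /= in_itv /= andbT.
rewrite integral_itv_obnd_cbnd; last first.
  by apply: measurable_funTS; mfun.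
rewrite [LHS]integral_mkcond; apply: eq_integral => t _.
rewrite /exponential_pdf !patchE; case: ifP => // _.
by rewrite mul1r mulN1r.
Qed.

Lemma integral_tail (a : R) :
  (\int[leb]_s ((a < s)%R%:R * expR (- s))%:E = (expR (- a))%:E)%E.
Proof.
rewrite -(@integral_shift _ a); last 2 first.
- by mfun.
- by move=> s; rewrite lee_fin mulr_ge0 ?expR_ge0.
rewrite -[RHS]mule1 -gint0 -ge0_integralZl_EFin//; last by mfun.
apply: eq_integral => t _; rewrite -EFinM expr0 mul1r ltrDr opprD expRD.
by congr EFin; ring.
Qed.

Lemma integral_sqrtX01 j :
  (\int[leb]_t ((0 < t < 1)%R%:R * Num.sqrt t ^+ j)%:E = (2 / j.+2%:R)%:E)%E.
Proof.
pose F (t : R) : R := 2 / j.+2%:R * Num.sqrt t ^+ j.+2.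
have cs (k : nat) : continuous (fun t : R => Num.sqrt t ^+ k).
  move=> t; apply: (@continuous_comp _ _ _ Num.sqrt (fun x => x ^+ k)).
    exact: sqrt_continuous.
  exact: exprn_continuous.
have cF : continuous F.
  by move=> t; apply: cvgM; [exact: cvg_cst | exact: cs].
(* The square root is differentiable only for t > 0; at the endpoints the fundamental theorem asks
   for continuity only. *)
have dF (t : R) : 0 < t -> is_derive t 1 F (Num.sqrt t ^+ j).
  move=> t0; have st : 0 < Num.sqrt t by rewrite sqrtr_gt0.
  have h1 := is_derive1_sqrt t0.
  have h2 := is_deriveX j.+2 h1.
  have h3 := is_deriveZ (2 / j.+2%:R) h2.
  have -> : F = (2 / j.+2%:R) \*: (@Num.sqrt R ^+ j.+2).
    by apply/funext => x; rewrite /F /= exprfctE.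
  apply: is_derive_eq h3 _.
  rewrite /GRing.scale /= exprS; field.
  by rewrite gt_eqF//= -(natrD _ 2) pnatr_eq0.
have E : (\int[leb]_(t in `[0%R, 1%R]) (Num.sqrt t ^+ j)%:E = (2 / j.+2%:R)%:E)%E.
  rewrite (@continuous_FTC2 _ _ F)//.
  - by rewrite /F sqrtr1 sqrtr0 expr1n expr0n /= mulr0 mulr1 sube0.
  - by apply: continuous_subspaceT => t; exact: cs.
  - split.
    + move=> t; rewrite in_itv /= => /andP[t0 _].
      by have [] := dF _ t0.
    + by apply: cvg_at_right_filter; exact: cF.
    + by apply: cvg_at_left_filter; exact: cF.
  - move=> t; rewrite in_itv /= => /andP[t0 _].
    by rewrite derive1E; have [_ ->] := dF _ t0.
rewrite -E integral_itv_bndoo; last by apply: measurable_funTS; mfun.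
rewrite [RHS](@integral_bool _ _ _ leb _ (fun t : R => 0 < t < 1))//.
Qed.

(** Integration by parts in the guise of Tonelli: exp (-t) is the integral of exp (-s) over s > t,
    and for fixed s the variable t is rescaled to ]0, 1[. *)
Lemma gintSS j : gint j.+2 = ((j.+2%:R / 2)%:E * gint j)%E.
Proof.
suff -> : gint j = ((2 / j.+2%:R)%:E * gint j.+2)%E.
  rewrite muleA -EFinM mulrA divfK// divff ?mul1e//.
pose G (t s : R) : R := (0 < t)%R%:R * Num.sqrt t ^+ j * ((t < s)%R%:R * expR (- s)).
transitivity (\int[leb]_t \int[leb]_s (G t s)%:E)%E.
  apply: eq_integral => t _; rewrite /G.
  under eq_integral do rewrite EFinM.
  rewrite ge0_integralZl_EFin; side.
  by rewrite integral_tail -EFinM mulrA.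
rewrite (fubini_tonelli (fun p : measurableTypeR R * measurableTypeR R =>
  (G p.1 p.2)%:E)); rewrite /G; side.
rewrite -ge0_integralZl_EFin; side.
apply: eq_integral => s _ /=; rewrite /G /=.
have [s0|s0] := ltP 0 s; last first.
  rewrite mul0r mule0 integral0_eq// => t _.
  have [t0|] := ltP 0 t; last by rewrite !mul0r.
  by rewrite (_ : t < s = false) ?mul0r ?mulr0//; apply/negbTE; rewrite -leNgt;
    exact: le_trans s0 (ltW t0).
rewrite (@integral_affine _ s 0) ?gt_eqF//; side.
rewrite gtr0_norm// -integral_sqrtX01.
rewrite muleC [RHS]muleC mul1r !exprS mulrA -expr2 sqr_sqrtr ?ltW//.
rewrite -mulrA EFinM muleC -!muleA; congr (_ * _)%E.
rewrite -ge0_integralZl_EFin; side.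
apply: eq_integral => t _; rewrite -EFinM addr0 pmulr_rgt0//.
have -> : (s * t < s) = (t < 1) by rewrite -{2}[s]mulr1 ltr_pM2l.
rewrite sqrtrM ?ltW// exprMn.
by congr EFin; case: (0 < t); case: (t < 1); rewrite /= ?(mul0r, mulr0, mul1r)//; ring.
Qed.

(** The Gaussian integral cut into layers: exp (-u^2) is the integral of exp (-s) over s > u^2, and
    the set u^2 < s has length 2 sqrt s. *)
Lemma gint1 : gint 1 = (Num.sqrt pi / 2)%:E.
Proof.
suff : (2%:E * gint 1 = (Num.sqrt pi)%:E)%E.
  move=> /(congr1 (mule (2^-1)%:E)); rewrite muleA -!EFinM mulVf// mul1e => ->.
  by rewrite mulrC.
rewrite -integralT_gauss.
pose G (u s : R) : R := (u ^+ 2 < s)%R%:R * expR (- s).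
transitivity (\int[leb]_u \int[leb]_s (G u s)%:E)%E; last first.
  by apply: eq_integral => u _; rewrite integral_tail.
rewrite (fubini_tonelli (fun p : measurableTypeR R * measurableTypeR R =>
  (G p.1 p.2)%:E)); rewrite /G; side.
rewrite -ge0_integralZl_EFin; side.
apply: eq_integral => s _ /=; rewrite /G /=.
under [RHS]eq_integral do rewrite mulrC EFinM.
rewrite ge0_integralZl_EFin; side.
rewrite -measure_bool; side.
have [s0|s0] := ltP 0 s; last first.
  rewrite mul0r mule0 (_ : [set x | _] = set0) ?measure0 ?mule0//.
  apply/seteqP; split => // u /=; rewrite ltNge.
  by rewrite (le_trans s0)// sqr_ge0.
have ss : 0 < Num.sqrt s by rewrite sqrtr_gt0.
rewrite (_ : [set x | _] = `](- Num.sqrt s), (Num.sqrt s)[%classic).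
  have E : leb `](- Num.sqrt s), (Num.sqrt s)[%classic = (2 * Num.sqrt s)%:E.
    rewrite lebesgue_measure_itv /= lte_fin ifT; last first.
      by rewrite (lt_trans _ ss)// oppr_lt0.
    by rewrite -EFinB; congr EFin; ring.
  transitivity ((expR (- s))%:E * (2 * Num.sqrt s)%:E)%E.
    by rewrite -!EFinM; congr EFin; rewrite /= expr1 mul1r; ring.
  by congr (_ * _)%E; exact: esym E.
apply/seteqP; split => u /=; rewrite in_itv /= -ltr_norml.
  by move=> us; rewrite -sqrtr_sqr ltr_sqrt.
by rewrite -sqrtr_sqr ltr_sqrt.
Qed.

Definition Gh (k : nat) : R := Gamma (k%:R / 2).

(** [Gamma] is real-valued, defined through [fine], so finiteness is needed to compare it with
    [gint]. *)
Lemma gint_fin j : gint j \is a fin_num.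
Proof.
suff : gint j \is a fin_num /\ gint j.+1 \is a fin_num by case.
elim: j => [|j [IH1 IH2]]; first by rewrite gint0 gint1.
by split => //; rewrite gintSS fin_numM.
Qed.

Lemma GhE j : (Gh j.+2)%:E = gint j.
Proof.
rewrite /Gh /Gamma -[RHS](fineK (gint_fin j)); congr EFin.
rewrite /Rintegral; congr fine.
rewrite (@integral_bool _ _ _ leb _ (fun t : R => 0 < t)); last first.
  by move=> t; rewrite /= in_itv /= andbT.
apply: eq_integral => t _; have [t0|] := ltP 0 t; last by rewrite !mul0r.
congr (_ * (_ * _))%:E.
rewrite -powR12_sqrt ?ltW// -powR_mulrn ?powR_ge0// -powRrM; congr (_ `^ _).
by rewrite -addn2 natrD; field.
Qed.

End gamma_integrals.

(** Besides solving for [x], this shows that [x] is finite. *)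
Lemma ereal_eq_div (R : realType) (c d : R) (x : \bar R) : c != 0 ->
  (d%:E = c%:E * x)%E -> x = (d / c)%:E.
Proof.
move=> c0 /(congr1 (mule (c^-1)%:E)); rewrite muleA -!EFinM mulVf// mul1e => <-.
by rewrite mulrC.
Qed.

Section ball_integrals.
Context (R : realType).
Local Notation leb := (@lebesgue_measure R).

Lemma Gh2 : Gh R 2 = 1.
Proof. by apply: EFin_inj; rewrite GhE gint0. Qed.

Lemma Gh3 : Gh R 3 = Num.sqrt pi / 2.
Proof. by apply: EFin_inj; rewrite GhE gint1. Qed.

Lemma GhSS j : Gh R j.+4 = j.+2%:R / 2 * Gh R j.+2.
Proof. by apply: EFin_inj; rewrite EFinM !GhE gintSS. Qed.

Lemma Gh_gt0 j : 0 < Gh R j.+2.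
Proof.
suff : 0 < Gh R j.+2 /\ 0 < Gh R j.+3 by case.
elim: j => [|j [IH1 IH2]].
  by rewrite Gh2 Gh3 ltr01 divr_gt0// sqrtr_gt0 pi_gt0.
split; [exact: IH2 | rewrite (GhSS j); move: (Gh R j.+2) IH1 => g g0].
by rewrite mulr_gt0 ?divr_gt0.
Qed.

Lemma dotZ n (a : R) (x : 'rV[R]_n) : dot (a *: x) (a *: x) = a ^+ 2 * dot x x.
Proof.
rewrite /dot mulr_sumr; apply: eq_bigr => i _; rewrite !mxE; ring.
Qed.

Lemma dot_rV_cons n (a b : R) (x y : 'rV[R]_n) :
  dot (rV_cons (a, x)) (rV_cons (b, y)) = a * b + dot x y.
Proof.
rewrite /dot big_ord_recl !mxE !unlift_none; congr (_ + _).
by apply: eq_bigr => i _; rewrite !mxE liftK.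
Qed.

Lemma integral_rV_scale n (s : R) (F : 'rV[R]_n -> \bar R) : 0 < s ->
  measurable_fun setT F -> (forall x, 0 <= F x)%E ->
  (\int[lebesgue_rV n]_x F x =
   (s ^+ n)%:E * \int[lebesgue_rV n]_x F (s *: x)%R)%E.
Proof.
move=> s0 mF F0.
have us : (s%:M : 'M[R]_n) \in unitmx.
  by rewrite unitmxE det_scalar unitrX// unitfE gt_eqF.
rewrite (integral_mulmx us mF F0) det_scalar gtr0_norm ?exprn_gt0//.
by congr (_ * _)%E; apply: eq_integral => x _; rewrite mul_mx_scalar.
Qed.

Lemma integral_gauss_rV n :
  (\int[@lebesgue_rV R n]_x (expR (- dot x x)%R)%:E = (Num.sqrt pi ^+ n)%:E)%E.
Proof.
transitivity (\int[@lebesgue_rV R n]_x (\prod_(i < n) expR (- x ord0 i ^+ 2))%:E)%E.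
  by apply: eq_integral => x _; rewrite -expR_sum sumrN.
rewrite (integral_rV_prod (h := fun _ t => expR (- t ^+ 2))
  (c := fun _ => Num.sqrt pi)).
- by rewrite prodr_const card_ord.
- by move=> i; mfun.
- by move=> i t; exact: expR_ge0.
- by move=> i; exact: integralT_gauss.
Qed.

Definition ball_const n m : R := Num.sqrt pi ^+ n * Gh R m.+2 / Gh R (m + n).+2.

(** The double integral of (s - |x|^2)^(m/2) exp (-s) over s > |x|^2. Integrating over s first gives
    a Gaussian times Gamma (m/2 + 1); for fixed s, the scaling x -> sqrt s x isolates the integral
    sought and leaves Gamma ((m + n)/2 + 1). *)
Lemma integral_bker n m :
  (\int[@lebesgue_rV R n]_x (bker m x)%:E = (ball_const n m)%:E)%E.
Proof.
apply: ereal_eq_div; first by rewrite gt_eqF// Gh_gt0.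
pose G (x : 'rV[R]_n) (s : R) : R :=
  (0 < s - dot x x)%R%:R * (Num.sqrt (s - dot x x) ^+ m * expR (- s)).
have mG : measurable_fun setT (fun p : 'rV[R]_n * measurableTypeR R =>
    (G p.1 p.2)%:E).
  by rewrite /G; mfun.
have G0 x s : 0 <= G x s by rewrite /G; pos.
transitivity (\int[lebesgue_rV n]_x \int[leb]_s (G x s)%:E)%E.
  rewrite EFinM GhE muleC -integral_gauss_rV.
  rewrite -ge0_integralZl; side.
  apply: eq_integral => x _.
  rewrite -[RHS](integral_shift (dot x x)); rewrite /G; side.
  rewrite muleC -ge0_integralZl_EFin; side.
  apply: eq_integral => s _; rewrite /G addrK -EFinM opprD expRD.
  by congr EFin; ring.
rewrite (fubini_tonelli _ mG); side.
rewrite GhE -ge0_integralZr; side.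
apply: eq_integral => s _; rewrite /G /=.
have [s0|s0] := ltP 0 s; last first.
  rewrite mul0r mul0e integral0_eq// => x _.
  rewrite subr_gt0 ltNge (le_trans s0 (dot_ge0 x)).
  by rewrite mul0r.
have ss : 0 < Num.sqrt s by rewrite sqrtr_gt0.
rewrite (integral_rV_scale ss); side.
rewrite mul1r -ge0_integralZl_EFin; side.
rewrite -ge0_integralZl_EFin; side.
apply: eq_integral => x _; rewrite -!EFinM; congr EFin.
rewrite dotZ sqr_sqrtr ?ltW// /bker.
have -> : s - s * dot x x = s * (1 - dot x x) by ring.
rewrite pmulr_rgt0// subr_gt0 sqrtrM ?ltW// exprMn exprD.
by ring.
Qed.

Lemma ball_const_gt0 n m : 0 < ball_const n m.
Proof.
have h1 := Gh_gt0 m; have h2 := Gh_gt0 (m + n).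
apply: divr_gt0 h2; apply: mulr_gt0 h1.
by rewrite exprn_gt0// sqrtr_gt0 pi_gt0.
Qed.

End ball_integrals.

Section hyperplane_constant.
Context (R : realType).
Local Notation leb := (@lebesgue_measure R).

Lemma integral_gauss_half :
  (\int[leb]_t ((0 < t)%R%:R * expR (- t ^+ 2))%:E = (Num.sqrt pi / 2)%:E)%E.
Proof.
rewrite -integral0y_gauss -integral_itv_obnd_cbnd; last first.
  by apply: measurable_funTS; rewrite /gauss_fun; mfun.
rewrite [RHS](@integral_bool _ _ _ leb _ (fun t : R => 0 < t))//.
by move=> t; rewrite /= in_itv /= andbT.
Qed.

Lemma integral_X01 j :
  (\int[leb]_t ((0 < t < 1)%R%:R * t ^+ j)%:E = (j.+1%:R^-1)%:E)%E.
Proof.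
pose F (t : R) : R := (j.+1%:R)^-1 * t ^+ j.+1.
have cF : continuous F.
  by move=> t; apply: cvgM; [exact: cvg_cst | exact: exprn_continuous].
have dF (t : R) : is_derive t 1 F (t ^+ j).
  have h2 := is_deriveX j.+1 (is_derive_id t 1).
  have h3 := is_deriveZ (j.+1%:R^-1) h2.
  have -> : F = (j.+1%:R^-1) \*: (id ^+ j.+1).
    by apply/funext => x; rewrite /F /= exprfctE.
  apply: is_derive_eq h3 _.
  by rewrite /GRing.scale /= mulr1 mulrA mulVf ?mul1r ?pnatr_eq0.
have E : (\int[leb]_(t in `[0%R, 1%R]) (t ^+ j)%:E = (j.+1%:R^-1)%:E)%E.
  rewrite (@continuous_FTC2 _ _ F)//.
  - by rewrite /F expr1n expr0n /= mulr0 mulr1 sube0.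
  - by apply: continuous_subspaceT => t; exact: exprn_continuous.
  - split.
    + by move=> t _; have [] := dF t.
    + by apply: cvg_at_right_filter; exact: cF.
    + by apply: cvg_at_left_filter; exact: cF.
  - by move=> t _; rewrite derive1E; have [_ ->] := dF t.
rewrite -E integral_itv_bndoo; last by apply: measurable_funTS; mfun.
by rewrite [RHS](@integral_bool _ _ _ leb _ (fun t : R => 0 < t < 1)).
Qed.

(** The value Gamma ((j + 1)/2) / 2, written with [Gh R j.+3] so that the index is at least 2, as in
    [GhE]. *)
Lemma integral_X_gauss j :
  (\int[leb]_t ((0 < t)%R%:R * t ^+ j * expR (- t ^+ 2))%:E =
   (Gh R j.+3 / j.+1%:R)%:E)%E.
Proof.
pose G (t s : R) : R :=
  ((0 < t)%R%:R * t ^+ j) * ((t ^+ 2 < s)%R%:R * expR (- s)).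
have G0 t s : 0 <= G t s.
  rewrite /G; have [t0|] := ltP 0 t; last by rewrite !mul0r.
  by rewrite mul1r; pos.
transitivity (\int[leb]_t \int[leb]_s (G t s)%:E)%E.
  apply: eq_integral => t _; rewrite /G.
  under eq_integral do rewrite EFinM.
  rewrite ge0_integralZl_EFin; side.
    by rewrite integral_tail -EFinM.
  have [t0|] := ltP 0 t; last by rewrite !mul0r.
  by rewrite mul1r; pos.
rewrite (fubini_tonelli (fun p : measurableTypeR R * measurableTypeR R =>
  (G p.1 p.2)%:E)); side; last by rewrite /G; mfun.
rewrite EFinM GhE -ge0_integralZr; side.
apply: eq_integral => s _; rewrite /=.
have [s0|s0] := ltP 0 s; last first.
  rewrite mul0r mul0e integral0_eq// => t _; rewrite /G.
  by rewrite (ltNge (_ ^+ 2)) (le_trans s0 (sqr_ge0 _)) mul0r mulr0.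
have ss : 0 < Num.sqrt s by rewrite sqrtr_gt0.
rewrite (@integral_affine _ (Num.sqrt s) 0) ?gt_eqF//; side; last first.
  by rewrite /G; mfun.
rewrite gtr0_norm// -integral_X01.
rewrite mul1r exprS -mulrA EFinM -muleA; congr (_ * _)%E.
rewrite -ge0_integralZl_EFin; side; last first.
  move=> t _; rewrite lee_fin; have [t0|] := ltP 0 t; last by rewrite !mul0r.
  by case: (t < 1); rewrite ?mul0r// mul1r; pos.
apply: eq_integral => t _; rewrite -EFinM addr0 /G pmulr_rgt0//.
rewrite !exprMn sqr_sqrtr ?ltW//.
have [t0|t0] := ltP 0 t; last by rewrite ?(mul0r, mulr0).
have -> : (s * t ^+ 2 < s) = (t < 1).
  by rewrite -{2}[s]mulr1 ltr_pM2l// expr_lt1// ltW.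
by congr EFin; rewrite /=; ring.
Qed.

(** Half the area of the unit sphere of R^(D + 1): (1 + |a|^2)^(-(D + 1)/2) da is the area element
    of a hemisphere in central projection, and [a] stands for the normal direction of a
    hyperplane. *)
Definition hyper_const D : R :=
  Num.sqrt pi ^+ D.+1 * D.+1%:R / (2 * Gh R D.+3).

(** The double integral of t^D exp (-t^2 (1 + |a|^2)) over t > 0 and a: scaling t by 1 / sqrt (1 +
    |a|^2) isolates the integral sought, while scaling a by 1 / t leaves a product of Gaussians. *)
Lemma integral_hyper D :
  (\int[@lebesgue_rV R D]_a ((Num.sqrt (1 + dot a a))^-1 ^+ D.+1)%:E =
   (hyper_const D)%:E)%E.
Proof.
have -> : hyper_const D =
    (Num.sqrt pi ^+ D * (Num.sqrt pi / 2)) / (Gh R D.+3 / D.+1%:R).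
  rewrite /hyper_const exprSr; field.
  by rewrite nat1r pnatr_eq0/= lt0r_neq0// Gh_gt0.
apply: ereal_eq_div.
  by rewrite mulf_neq0 ?gt_eqF ?Gh_gt0// invr_gt0.
pose G (a : 'rV[R]_D) (t : R) : R :=
  (0 < t)%R%:R * (t ^+ D * expR (- (t ^+ 2 * (1 + dot a a)))).
have G0 a t : 0 <= G a t.
  rewrite /G; have [t0|] := ltP 0 t; last by rewrite !mul0r.
  by rewrite mul1r; pos.
transitivity (\int[lebesgue_rV D]_a \int[leb]_t (G a t)%:E)%E; last first.
  rewrite -ge0_integralZl_EFin; side; last first.
    by rewrite divr_ge0// ltW// Gh_gt0.
  apply: eq_integral => a _.
  have r0 : 0 < Num.sqrt (1 + dot a a).
    by rewrite sqrtr_gt0 ltr_pwDl// dot_ge0.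
  set r := Num.sqrt _ in r0 *.
  rewrite (@integral_affine _ r^-1 0); side; last 2 first.
  - by rewrite gt_eqF// invr_gt0.
  - by rewrite /G; mfun.
  rewrite gtr0_norm ?invr_gt0// -integral_X_gauss [RHS]muleC exprS EFinM -muleA.
  congr (_ * _)%E.
  rewrite -ge0_integralZl_EFin; side; last first.
    move=> t _; rewrite lee_fin; have [t0|] := ltP 0 t; last by rewrite !mul0r.
    by rewrite mul1r; pos.
  apply: eq_integral => t _; rewrite -EFinM /G addr0 pmulr_rgt0 ?invr_gt0//.
  have -> : (r^-1 * t) ^+ 2 * (1 + dot a a) = t ^+ 2.
    have -> : 1 + dot a a = r ^+ 2 by rewrite sqr_sqrtr// addr_ge0// dot_ge0.
    by field; rewrite gt_eqF.
  by congr EFin; rewrite exprMn; ring.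
rewrite (fubini_tonelli (fun p : 'rV[R]_D * measurableTypeR R =>
  (G p.1 p.2)%:E)); side; last by rewrite /G; mfun.
rewrite EFinM -integral_gauss_half -ge0_integralZl_EFin; side.
apply: eq_integral => t _; rewrite /G /=.
have [t0|t0] := ltP 0 t; last first.
  by rewrite !mul0r mule0 integral0_eq// => a _; rewrite mul0r.
rewrite mul1r muleC -integral_gauss_rV -ge0_integralZl_EFin; side.
rewrite [LHS](integral_rV_scale t0); side.
rewrite -ge0_integralZl_EFin; side.
apply: eq_integral => a _; rewrite -!EFinM dotZ -expRD mul1r.
by congr (_ * expR _)%:E; ring.
Qed.

Lemma hyper_const_gt0 D : 0 < hyper_const D.
Proof.
have h := Gh_gt0 R D.+1.
rewrite /hyper_const divr_gt0// mulr_gt0// exprn_gt0// sqrtr_gt0.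
exact: pi_gt0.
Qed.

End hyperplane_constant.

(** * The Blaschke-Petkantschin formula *)

Section quadratic_weight.
Context (R : realType).

(** [Lint] and [Mint] are the two sides of the Blaschke-Petkantschin formula: [Mint] is what the
    angle requires, while [Lint] has no determinant and can be computed. *)
Definition Lint D : \bar R :=
  (\int[tuple_measure (@lebesgue_rV R D.+1) D.+1]_x
    (bprod 2 x * quad x)%:E)%E.

Definition Mint D : \bar R :=
  (\int[tuple_measure (@lebesgue_rV R D) D.+1]_x
    (`|\det (hmx x)| * (bprod 2 x * quad x))%:E)%E.

Lemma integral_rV_affine n (M : 'M[R]_n) (v : 'rV[R]_n)
    (F : 'rV[R]_n -> \bar R) :
  M \in unitmx -> measurable_fun setT F -> (forall x, 0 <= F x)%E ->
  (\int[lebesgue_rV n]_x F x =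
   `|\det M|%:E * \int[lebesgue_rV n]_x F (x *m M + v)%R)%E.
Proof.
move=> uM mF F0; rewrite -(integral_rV_shift v mF F0).
by rewrite (integral_mulmx uM (F := fun x => F (x + v)))//; mfun.
Qed.

Lemma hom_affine n (M : 'M[R]_n) (v x : 'rV[R]_n) :
  hom (x *m M + v) =
  hom x *m (block_mx (1%:M : 'M[R]_1) v 0 M : 'M[R]_(1 + n)) :> 'rV[R]_n.+1.
Proof.
rewrite /hom !rV_consE.
have := mul_row_block (1%:M : 'M[R]_1) x 1%:M v 0 M.
by rewrite !mul1mx mulmx0 addr0 addrC => ->.
Qed.

Lemma hmx_affine m n (M : 'M[R]_n) (v : 'rV[R]_n) (x : m.-tuple 'rV[R]_n) :
  hmx [tuple tnth x i *m M + v | i < m] =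
  hmx x *m (block_mx (1%:M : 'M[R]_1) v 0 M : 'M[R]_(1 + n)) :> 'M[R]_(m, n.+1).
Proof.
apply/row_matrixP => i; rewrite row_mul !row_hmx tnth_mktuple.
exact: hom_affine.
Qed.

Lemma det_hmx_affine n (M : 'M[R]_n) (v : 'rV[R]_n) (x : n.+1.-tuple 'rV[R]_n) :
  \det (hmx [tuple tnth x i *m M + v | i < n.+1]) = \det (hmx x) * \det M.
Proof.
rewrite hmx_affine det_mulmx; congr (_ * _).
by have := det_ublock (1%:M : 'M[R]_1) v M; rewrite det1 mul1r.
Qed.

Lemma bker2E n (x : 'rV[R]_n) :
  bker 2 x = (dot x x < 1)%R%:R * (1 - dot x x).
Proof.
rewrite /bker; case: ltP => h; last by rewrite !mul0r.
by rewrite sqr_sqrtr// subr_ge0 ltW.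
Qed.

End quadratic_weight.

Section hyperplane_integral.
Context (R : realType).
Local Notation leb := (@lebesgue_measure R).

(** Two triangular factorizations of the same bordered matrix [B]. *)
Lemma det_shrink n (a : 'rV[R]_n) (c : R) :
  \det (1%:M - c *: (a^T *m a)) = 1 - c * dot a a.
Proof.
pose B : 'M[R]_(n + 1) := block_mx 1%:M (c *: a^T) a 1%:M.
have E1 : \det B = 1 - c * dot a a.
  have -> : B = (block_mx 1%:M 0 a 1%:M : 'M[R]_(n + 1)) *m
      (block_mx 1%:M (c *: a^T) 0 (1 - c * dot a a)%:M).
    rewrite mulmx_block !mul1mx !mul0mx !mulmx1 !addr0 /B.
    congr block_mx; rewrite -scalemxAr mulmx_dot scale_scalar_mx.
    by rewrite addrC -raddfD /= subrK.
  by rewrite det_mulmx det_lblock det_ublock !det1 !mul1r det_scalar1.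
rewrite -E1.
have -> : B = (block_mx 1%:M (c *: a^T) 0 1%:M : 'M[R]_(n + 1)) *m
    (block_mx (1%:M - c *: (a^T *m a)) 0 a 1%:M).
  rewrite mulmx_block !mul1mx !mul0mx !mulmx1 !add0r /B.
  by rewrite -scalemxAl subrK.
by rewrite det_mulmx det_ublock det_lblock !det1 !mul1r mulr1.
Qed.

Definition lift_graph m n (b : R) (a : 'rV[R]_n) (x : m.-tuple 'rV[R]_n) :
    m.-tuple 'rV[R]_n.+1 :=
  [tuple rV_cons (b + dot a (tnth x i), tnth x i) | i < m].

Lemma attach_hmx m n (b : R) (a : 'rV[R]_n) (x : m.-tuple 'rV[R]_n) :
  attach (rV_cons (b, a) *m (hmx x)^T) x = lift_graph b a x.
Proof.
apply: eq_from_tnth => i; rewrite !tnth_mktuple; congr (rV_cons (_, _)).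
rewrite mxE big_ord_recl !mxE unlift_none mulr1; congr (_ + _).
by apply: eq_bigr => j _; rewrite !mxE liftK.
Qed.

Section fixed_hyperplane.
Variables (D : nat) (a : 'rV[R]_D) (h : R).

(** The hyperplane y = r h + a . x has unit normal (1, -a) / r and signed distance h from the
    origin; for |h| < 1 it meets the unit ball in a ball of radius [s]. *)
Let r := Num.sqrt (1 + dot a a).
Let s := Num.sqrt (1 - h ^+ 2).

Let r2 : r ^+ 2 = 1 + dot a a.
Proof. by rewrite sqr_sqrtr// addr_ge0// dot_ge0. Qed.

Let r_gt0 : 0 < r.
Proof. by rewrite sqrtr_gt0 ltr_pwDl// dot_ge0. Qed.

Let aa : dot a a = r ^+ 2 - 1. Proof. by rewrite r2; ring. Qed.

Let r1_gt0 : 0 < 1 + r. Proof. by rewrite addr_gt0. Qed.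

(** This value gives 1 - c |a|^2 = 1 / r, without dividing by |a|^2, which may vanish. So z -> z M +
    v maps the unit ball onto the projection of the section along y: an ellipsoid with centre [v],
    shortened by 1 / r in the direction of [a]. *)
Let c := (r * (1 + r))^-1.

Let M : 'M[R]_D := s *: (1%:M - c *: (a^T *m a)).

Let v : 'rV[R]_D := - (h / r) *: a.

Let detM : \det M = s ^+ D / r.
Proof.
rewrite detZ det_shrink /c aa; congr (_ * _).
by field; rewrite !gt_eqF.
Qed.

Let mulM (z : 'rV[R]_D) : z *m M + v = s *: z - (s * c * dot z a + h / r) *: a.
Proof.
rewrite /M /v -scalemxAr mulmxBr mulmx1 -scalemxAr mulmxA mulmx_dot.
rewrite mul_scalar_mx scalerBr !scalerA scaleNr scalerDl opprD addrA.
by rewrite mulrA.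
Qed.

(** On the hyperplane the map is an isometry scaled by [s], followed by the translation to the foot
    of the perpendicular from the origin, of squared norm h^2. *)
Lemma dot_graph (z w : 'rV[R]_D) : h ^+ 2 < 1 ->
  1 - dot (rV_cons (r * h + dot a (z *m M + v), z *m M + v))
          (rV_cons (r * h + dot a (w *m M + v), w *m M + v)) =
  s ^+ 2 * (1 - dot z w).
Proof.
move=> h1; rewrite dot_rV_cons !mulM !dotDl !dotDr !dotNl !dotNr.
rewrite !dotZl !dotZr (dotC a z) (dotC a w) aa /c.
transitivity (1 - h ^+ 2 - s ^+ 2 * dot z w).
  by field; rewrite !gt_eqF.
have -> : s ^+ 2 = 1 - h ^+ 2 by rewrite sqr_sqrtr// subr_ge0 ltW.
by ring.
Qed.

Let phi (z : D.+1.-tuple 'rV[R]_D) := [tuple tnth z i *m M + v | i < D.+1].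

(** Each of the D + 1 weights contributes a factor s^2, and [quad] one more. *)
Lemma weight_graph (z : D.+1.-tuple 'rV[R]_D) : h ^+ 2 < 1 ->
  bprod 2 (lift_graph (r * h) a (phi z)) *
    quad (lift_graph (r * h) a (phi z)) =
  s ^+ (2 * D.+2) * (bprod 2 z * quad z).
Proof.
move=> h1.
have s0 : 0 < s ^+ 2 by rewrite exprn_gt0// sqrtr_gt0 subr_gt0.
have dE i j : 1 - dot (tnth (lift_graph (r * h) a (phi z)) i)
    (tnth (lift_graph (r * h) a (phi z)) j) =
    s ^+ 2 * (1 - dot (tnth z i) (tnth z j)).
  by rewrite !tnth_mktuple dot_graph.
have -> : quad (lift_graph (r * h) a (phi z)) = s ^+ 2 * quad z.
  rewrite /quad mulr_sumr; apply: eq_bigr => i _; rewrite mulr_sumr.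
  by apply: eq_bigr => j _; rewrite dE; ring.
have -> : bprod 2 (lift_graph (r * h) a (phi z)) =
    (s ^+ 2) ^+ D.+1 * bprod 2 z.
  transitivity (\prod_(i < D.+1) (s ^+ 2 * bker 2 (tnth z i))).
    apply: eq_bigr => i _; rewrite !bker2E dE -subr_gt0 dE pmulr_rgt0//.
    by rewrite subr_gt0; ring.
  by rewrite big_split /= prodr_const card_ord.
by rewrite exprM [in RHS]exprS mulrACA [_ * s ^+ 2]mulrC.
Qed.

Lemma weight_graph0 (x : D.+1.-tuple 'rV[R]_D) : 1 <= h ^+ 2 ->
  bprod 2 (lift_graph (r * h) a x) = 0.
Proof.
move=> h1; rewrite /bprod big_ord_recl bker2E tnth_mktuple dot_rV_cons.
set x0 := tnth x ord0.
suff H : 1 <= (r * h + dot a x0) * (r * h + dot a x0) + dot x0 x0.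
  by rewrite ltNge H !mul0r.
apply: le_trans h1 _.
(* Pythagoras at the foot (h / r) (1, -a) of the perpendicular: the two squares add up to the
   squared norm of the point minus h^2. *)
have := dot_ge0 (x0 + (h / r) *: a).
rewrite dotDl !dotDr !dotZl !dotZr (dotC x0 a) aa => H.
have := sqr_ge0 (r * h + dot a x0 - h / r) => H2.
rewrite -subr_ge0; apply: le_trans (addr_ge0 H H2) _.
by rewrite le_eqVlt; apply/orP; left; apply/eqP; field; rewrite gt_eqF.
Qed.

(** The Jacobian s^D / r occurs D + 2 times, once per point and once from the determinant; with the
    factor s^(2 (D + 2)) of the weights, the exponent of s is (D + 2)^2. *)
Lemma integral_fixed_hyperplane :
  (\int[tuple_measure (@lebesgue_rV R D) D.+1]_x
    (`|\det (hmx x)| * (bprod 2 (lift_graph (r * h) a x) *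
      quad (lift_graph (r * h) a x)))%:E =
   (r^-1 ^+ D.+2 * ((h ^+ 2 < 1)%R%:R * s ^+ (D.+2 ^ 2)))%:E * Mint R D)%E.
Proof.
have [h1|h1] := ltP (h ^+ 2) 1; last first.
  rewrite mul0r mulr0 mul0e integral0_eq// => x _.
  by rewrite weight_graph0// mul0r mulr0.
have s_gt0 : 0 < s by rewrite sqrtr_gt0 subr_gt0.
have detM_gt0 : 0 < \det M by rewrite detM divr_gt0// exprn_gt0.
have uM : M \in unitmx by rewrite unitmxE unitfE gt_eqF.
pose F (x : D.+1.-tuple 'rV[R]_D) : \bar R :=
  (`|\det (hmx x)| * (bprod 2 (lift_graph (r * h) a x) *
      quad (lift_graph (r * h) a x)))%:E.
rewrite (integral_tuple_map (mu' := lebesgue_rV D) (F := F)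
  (phi := fun _ z => z *m M + v) (c := fun=> \det M)); last 5 first.
- by move=> i; mfun.
- by move=> i; exact: ltW.
- move=> i G mG G0; rewrite (integral_rV_affine v uM mG G0).
  by rewrite gtr0_norm.
- by rewrite /F /bprod /quad /lift_graph; mfun.
- by move=> x; rewrite lee_fin mulr_ge0// bprod_quad_ge0.
have mF : measurable_fun setT F by rewrite /F /lift_graph; mfun.
have F0 x : (0 <= F x)%E by pos.
rewrite prodr_const card_ord /Mint -!ge0_integralZl_EFin; side; last first.
  by rewrite mul1r mulr_ge0// exprn_ge0// ?invr_ge0 ltW.
apply: eq_integral => z _; rewrite /F -!EFinM; congr EFin.
rewrite -/(phi z) weight_graph// det_hmx_affine normrM (gtr0_norm detM_gt0).
rewrite detM mul1r.
have -> : (D.+2 ^ 2 = D * D.+2 + 2 * D.+2)%N by rewrite -mulnDl addn2 mulnn.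
rewrite exprD (exprM s D) (exprM s 2) [X in _ = X * _]mulrA -exprMn [r^-1 * _]mulrC.
move: (s ^+ D / r) (s ^+ 2 ^+ D.+2) => u w; rewrite [in RHS]exprSr.
by move: (u ^+ D.+1) => U; ring.
Qed.

End fixed_hyperplane.

Lemma integral_bker1 m :
  (\int[leb]_h ((h ^+ 2 < 1)%R%:R * Num.sqrt (1 - h ^+ 2) ^+ m)%:E =
   (ball_const R 1 m)%:E)%E.
Proof.
rewrite -integral_bker integral_rVS; side.
apply: eq_integral => h _; rewrite integral_rV0; side.
rewrite /bker; have -> : dot (rV_cons (h, 0)) (rV_cons (h, 0 : 'rV[R]_0)) = h ^+ 2.
  by rewrite dot_rV_cons /dot big_ord0 addr0 expr2.
by [].
Qed.

(* Affine Blaschke-Petkantschin formula: the hyperplane through the points is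
   y = b + a . x, and the change of variables from (b, a) to the first
   coordinates of the points has Jacobian det (hmx x). *)
Lemma integral_hyperplanes D :
  Lint R D = ((hyper_const R D * ball_const R 1 (D.+2 ^ 2))%:E * Mint R D)%E.
Proof.
have F0 n (X : D.+1.-tuple 'rV[R]_n) : (0 <= (bprod 2 X * quad X)%:E)%E.
  by rewrite lee_fin bprod_quad_ge0.
rewrite /Lint integral_attach//; last by mfun.
pose H (x : D.+1.-tuple 'rV[R]_D) (b : R) (a : 'rV[R]_D) : R :=
  `|\det (hmx x)| * (bprod 2 (lift_graph b a x) * quad (lift_graph b a x)).
have H0 x b a : 0 <= H x b a by rewrite mulr_ge0// bprod_quad_ge0.
transitivity (\int[tuple_measure (@lebesgue_rV R D) D.+1]_x
    \int[@lebesgue_rV R D]_a \int[leb]_b (H x b a)%:E)%E.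
  (* Only affinely independent [x] determine the hyperplane from the first coordinates. *)
  apply: (@ge0_integral_off_null _ _ R (tuple_measure (@lebesgue_rV R D) D.+1)
    [set x | \det (hmx x) == 0]).
  - exact: measurable_singular.
  - exact: singular_measure0.
  - by move=> x; apply: integral_ge0.
  - by move=> x; apply: integral_ge0 => a _; apply: integral_ge0 => b _;
      rewrite lee_fin.
  move=> x /negP xN0.
  have ux : (hmx x)^T \in unitmx by rewrite unitmx_tr unitmxE unitfE.
  rewrite (integral_mulmx ux); side.
  rewrite integral_rVS; side.
  rewrite (fubini_tonelli (fun p : measurableTypeR R * 'rV[R]_D =>
    (bprod 2 (attach (rV_cons p *m (hmx x)^T) x) *
     quad (attach (rV_cons p *m (hmx x)^T) x))%:E)); side.
  rewrite -ge0_integralZl_EFin; side.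
  apply: eq_integral => a _.
  rewrite -ge0_integralZl_EFin; side.
  by apply: eq_integral => b _; rewrite attach_hmx det_tr -EFinM.
have M0 : (0 <= Mint R D)%E by rewrite /Mint; pos.
rewrite (fubini_tonelli (fun p : D.+1.-tuple 'rV[R]_D * 'rV[R]_D =>
  (\int[leb]_b (H p.1 b p.2)%:E)%E)); side; last first.
  by rewrite /H /lift_graph; mfun.
rewrite EFinM -muleA -integral_hyper -ge0_integralZr; side; last first.
  by rewrite mule_ge0// lee_fin ltW// ball_const_gt0.
apply: eq_integral => a _.
rewrite (fubini_tonelli (fun p : D.+1.-tuple 'rV[R]_D * measurableTypeR R =>
  (H p.1 p.2 a)%:E)); side; last by rewrite /H /lift_graph; mfun.
set r := Num.sqrt (1 + dot a a).
have r_gt0 : 0 < r by rewrite sqrtr_gt0 ltr_pwDl// dot_ge0.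
(* The substitution b = r h. Its factor r turns r^(-(D + 2)) into r^(-(D + 1)), the integrand of
   [integral_hyper]. *)
rewrite (@integral_affine _ r 0) ?gt_eqF//; side; last first.
  by rewrite /H /lift_graph; mfun.
have -> : (\int[leb]_x \int[tuple_measure (@lebesgue_rV R D) D.+1]_y
    (H y (r * x + 0)%R a)%:E =
    \int[leb]_x (((r^-1 ^+ D.+2)%:E * ((x ^+ 2 < 1)%R%:R *
      Num.sqrt (1 - x ^+ 2) ^+ (D.+2 ^ 2))%:E) * Mint R D))%E.
  apply: eq_integral => h _.
  rewrite -EFinM -integral_fixed_hyperplane.
  by apply: eq_integral => x _; rewrite addr0.
rewrite ge0_integralZr; side; last first.
  by move=> h _; rewrite -EFinM lee_fin mulr_ge0// ?exprn_ge0 ?invr_ge0 ?ltW//; pos.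
rewrite ge0_integralZl_EFin; side; last first.
  by rewrite exprn_ge0// invr_ge0 ltW.
rewrite integral_bker1 gtr0_norm// !muleA -!EFinM; congr (_%:E * _)%E.
congr (_ * _); rewrite exprS mulrA divff ?mul1r//.
by rewrite gt_eqF.
Qed.

End hyperplane_integral.

(** * The determinant-free integral *)

Section weight_integrals.
Context (R : realType).
Local Notation leb := (@lebesgue_measure R).

Lemma integral_rV_opp n (F : 'rV[R]_n -> \bar R) :
  measurable_fun setT F -> (forall x, 0 <= F x)%E ->
  (\int[lebesgue_rV n]_x F (- x)%R = \int[lebesgue_rV n]_x F x)%E.
Proof.
move=> mF F0.
have u1 : (- 1%:M : 'M[R]_n) \in unitmx.
  by rewrite unitmxE -scaleN1r detZ det1 mulr1 unitrX// unitrN1.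
rewrite [RHS](integral_mulmx u1 mF F0) -scaleN1r detZ det1 mulr1 normrX.
rewrite normrN normr1 expr1n mul1e; apply: eq_integral => x _.
by rewrite -scalemxAr mulmx1 scaleN1r.
Qed.

Lemma bker4E n (x : 'rV[R]_n) : bker 2 x * (1 - dot x x) = bker 4 x.
Proof.
rewrite /bker; case: ltP => h; last by rewrite !mul0r.
by rewrite (exprM _ 2 2) sqr_sqrtr ?subr_ge0 ?ltW//; ring.
Qed.

Lemma bprod_dot_ge0 m n (x : m.-tuple 'rV[R]_n) i j :
  0 <= bprod 2 x * (1 - dot (tnth x i) (tnth x j)).
Proof.
have [->|/bprod_neq0 H] := eqVneq (bprod 2 x) 0; first by rewrite mul0r.
by rewrite mulr_ge0 ?bprod_ge0// subr_ge0 ltW// dot_lt1.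
Qed.

(** For i = j, the extra factor raises the weight exponent of one point from 2 to 4. For distinct i
    and j, reflecting x_i exchanges 1 - x_i . x_j and 1 + x_i . x_j; both are nonnegative on the
    support and their sum is 2. *)
Lemma integral_bprod_dot m n (i j : 'I_m) :
  (\int[tuple_measure (@lebesgue_rV R n) m]_x
     (bprod 2 x * (1 - dot (tnth x i) (tnth x j)))%:E =
   (ball_const R n 2 ^+ m.-1 *
     ball_const R n (if i == j then 4 else 2)%N)%:E)%E.
Proof.
have m0 : (0 < m)%N by case: m i j => // -[].
pose h (l : nat) (k : 'I_m) (x : 'rV[R]_n) := if k == i then bker l x else bker 2 x.
have hE l : (\int[tuple_measure (@lebesgue_rV R n) m]_x
    (\prod_k h l k (tnth x k))%:E =
    (ball_const R n 2 ^+ m.-1 * ball_const R n l)%:E)%E.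
  rewrite (integral_tuple_prod (h := h l)
    (c := fun k => ball_const R n (if k == i then l else 2)%N)).
  - congr EFin; rewrite (bigD1 i)//= eqxx mulrC; congr (_ * _).
    rewrite (eq_bigr (fun=> ball_const R n 2)); last first.
      by move=> k /negbTE ->.
    rewrite prodr_const; congr (_ ^+ _).
    transitivity #|predC1 i|; first exact: eq_card.
    by rewrite cardC1 card_ord.
  - by move=> k; rewrite /h; case: (k == i); mfun.
  - by move=> k x; rewrite /h; case: (k == i); pos.
  - by move=> k; rewrite /h; case: (k == i); exact: integral_bker.
have [<-|ij] := eqVneq i j.
  rewrite -hE; apply: eq_integral => x _; congr EFin.
  rewrite /bprod [LHS]mulrC (bigD1 i)//= [RHS](bigD1 i)//= /h eqxx -bker4E.
  rewrite mulrA [_ * bker 2 _]mulrC; congr (_ * _).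
  by apply: eq_bigr => k /negbTE ->.
pose T := (\int[tuple_measure (@lebesgue_rV R n) m]_x
     (bprod 2 x * (1 - dot (tnth x i) (tnth x j)))%:E)%E.
pose T' := (\int[tuple_measure (@lebesgue_rV R n) m]_x
     (bprod 2 x * (1 + dot (tnth x i) (tnth x j)))%:E)%E.
pose phi (k : 'I_m) (x : 'rV[R]_n) := if k == i then - x else x.
have bphi (x : m.-tuple 'rV[R]_n) :
    bprod 2 [tuple phi k (tnth x k) | k < m] = bprod 2 x.
  apply: eq_bigr => k _; rewrite tnth_mktuple /phi /bker.
  by case: ifP => // _; rewrite dotNl dotNr opprK.
have dphi (x : m.-tuple 'rV[R]_n) :
    dot (tnth [tuple phi k (tnth x k) | k < m] i)
        (tnth [tuple phi k (tnth x k) | k < m] j) = - dot (tnth x i) (tnth x j).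
  by rewrite !tnth_mktuple /phi eqxx eq_sym (negbTE ij) dotNl.
have b1 (x : m.-tuple 'rV[R]_n) :
    0 <= bprod 2 x * (1 + dot (tnth x i) (tnth x j)).
  have := bprod_dot_ge0 [tuple phi k (tnth x k) | k < m] i j.
  by rewrite bphi dphi opprK.
have TT' : T = T'.
  have mphi k : measurable_fun setT (phi k).
    rewrite /phi; case: (k == i); last by mfun.
    rewrite (_ : -%R = fun x : 'rV[R]_n => (-1) *: x); first by mfun.
    by apply/funext => x; rewrite scaleN1r.
  rewrite /T (integral_tuple_map (mu' := lebesgue_rV n) (c := fun=> 1)
    (phi := phi) (F := fun x => (bprod 2 x *
    (1 - dot (tnth x i) (tnth x j)))%:E))//.
  - rewrite big1// mul1e; apply: eq_integral => x _.
    by rewrite bphi dphi opprK.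
  - move=> k G mG G0; rewrite mul1e /phi; case: (k == i) => //.
    by rewrite integral_rV_opp.
  - by mfun.
  - by move=> x; rewrite lee_fin bprod_dot_ge0.
have TD : (T + T' = (2 * (ball_const R n 2 ^+ m.-1 * ball_const R n 2))%:E)%E.
  rewrite -ge0_integralD; side; last first.
    by move=> x _; rewrite lee_fin bprod_dot_ge0.
  rewrite EFinM -hE -ge0_integralZl_EFin; side; last 2 first.
  - by move=> x _; rewrite lee_fin; apply: prodr_ge0 => k _; rewrite /h;
      case: (k == i); pos.
  - apply: mfun_E; apply: mfun_prod => k; rewrite /h.
    by case: (k == i); mfun.
  apply: eq_integral => x _; rewrite -EFinD -EFinM; congr EFin.
  rewrite [in RHS](_ : \prod_k _ = bprod 2 x).
    by ring.
  by apply: eq_bigr => k _; rewrite /h if_same.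
(* The finite value of T + T excludes infinite T. *)
rewrite -[LHS]/T; rewrite -TT' in TD; case: T TD {TT'} => //= t.
by move: (_ ^+ _ * _) => q; rewrite -EFinD => -[tt]; congr EFin; lra.
Qed.

(** The D + 1 diagonal terms of [quad] have coefficient 2; the D (D + 1) others have coefficient
    1. *)
Definition Lval D : R :=
  let G := ball_const R D.+1 2 in
  D.+1%:R * (2 * (G ^+ D * ball_const R D.+1 4) + D%:R * G ^+ D.+1).

Lemma LintE D : Lint R D = (Lval D)%:E.
Proof.
rewrite /Lint.
transitivity (\sum_(i < D.+1) \sum_(j < D.+1)
  \int[tuple_measure (@lebesgue_rV R D.+1) D.+1]_x
    ((1 + (i == j)%:R) * (bprod 2 x * (1 - dot (tnth x i) (tnth x j))))%:E)%E.
  under [RHS]eq_bigr => i _.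
    rewrite -ge0_integral_sum//; last 2 first.
    - by move=> j; mfun.
    - move=> j x _; rewrite lee_fin mulr_ge0 ?addr_ge0//; exact: bprod_dot_ge0.
    over.
  rewrite -ge0_integral_sum//; last 2 first.
  - by move=> i; apply: emeasurable_sum => j; mfun.
  - move=> i x _; apply: sume_ge0 => j _; rewrite lee_fin mulr_ge0 ?addr_ge0//.
    exact: bprod_dot_ge0.
  apply: eq_integral => x _; rewrite /quad mulr_sumr -sumEFin.
  apply: eq_bigr => i _; rewrite mulr_sumr -sumEFin.
  by apply: eq_bigr => j _; congr EFin; ring.
set G := ball_const R D.+1 2.
transitivity (\sum_(i < D.+1) \sum_(j < D.+1)
  (if i == j then 2 * (G ^+ D * ball_const R D.+1 4) else G ^+ D.+1)%:E)%E.
  apply: eq_bigr => i _; apply: eq_bigr => j _.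
  under eq_integral do rewrite EFinM.
  rewrite ge0_integralZl_EFin; side; last first.
    by move=> x _; rewrite lee_fin bprod_dot_ge0.
  rewrite integral_bprod_dot -EFinM /=; congr EFin.
  by case: (i == j); [congr (_ * _); ring | rewrite addr0 mul1r exprSr].
under eq_bigr => i _ do rewrite sumEFin.
rewrite sumEFin; congr EFin; rewrite /Lval -/G.
under eq_bigr => i _.
  rewrite (bigD1 i)//= eqxx (eq_bigr (fun=> G ^+ D.+1)); last first.
    by move=> j /negbTE ji; rewrite eq_sym ji.
  rewrite sumr_const (_ : #|_| = D); last first.
    transitivity #|predC1 i|; first exact: eq_card.
    by rewrite cardC1 card_ord.
  over.
by rewrite sumr_const card_ord -[LHS]mulr_natl -[_ *+ D]mulr_natl.
Qed.

End weight_integrals.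

(** * Integration over a simplex *)

Section simplex_integral.
Context (R : realType).
Local Notation leb := (@lebesgue_measure R).

Lemma Gh_fact k : Gh R (2 * k).+2 = k`!%:R.
Proof.
elim: k => [|k IH]; first by rewrite muln0 Gh2.
rewrite mulnS GhSS IH factS natrM; congr (_ * _).
by rewrite -[(2 * k).+2]/(2 + 2 * k)%N -mulnS mulnC natrM mulfK.
Qed.

Lemma integral_expX k :
  (\int[leb]_t ((0 < t)%R%:R * (t ^+ k * expR (- t)))%:E = (k`!%:R)%:E)%E.
Proof.
rewrite -Gh_fact GhE; apply: eq_integral => t _.
have [t0|] := ltP 0 t; last by rewrite !mul0r.
by rewrite exprM sqr_sqrtr// ltW.
Qed.

Lemma integral_expX0 k :
  (\int[leb]_t ((0 <= t)%R%:R * (t ^+ k * expR (- t)))%:E = (k`!%:R)%:E)%E.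
Proof.
rewrite -integral_expX.
transitivity (\int[leb]_(t in `[0%R, +oo[) (t ^+ k * expR (- t))%:E)%E.
  rewrite [RHS](@integral_bool _ _ _ leb _ (fun t : R => 0 <= t))//.
  by move=> t; rewrite /= in_itv /= andbT.
rewrite -integral_itv_obnd_cbnd; last by apply: measurable_funTS; mfun.
rewrite [LHS](@integral_bool _ _ _ leb _ (fun t : R => 0 < t))//.
by move=> t; rewrite /= in_itv /= andbT.
Qed.

Section fixed_vertices.
Variables (n : nat) (x : n.+1.-tuple 'rV[R]_n).
Hypothesis x1 : forall i, dot (tnth x i) (tnth x i) < 1.
Hypothesis xN0 : \det (hmx x) != 0.

Let ux : hmx x \in unitmx. Proof. by rewrite unitmxE unitfE. Qed.

Let q i j := 1 - dot (tnth x i) (tnth x j).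

Let q_ge0 i j : 0 <= q i j.
Proof. by rewrite subr_ge0 ltW// dot_lt1. Qed.

Let expw (w : 'rV[R]_n.+1) : R :=
  \prod_k ((0 <= w ord0 k)%R%:R * expR (- w ord0 k)).

Let expw_ge0 w : 0 <= expw w. Proof. by rewrite /expw; pos. Qed.

Let moment_ge0 w i j : 0 <= expw w * (w ord0 i * w ord0 j).
Proof.
have [w0|] := boolP [forall i, 0 <= w ord0 i].
  apply: mulr_ge0; first exact: expw_ge0.
  by apply: mulr_ge0; exact: (forallP w0).
rewrite negb_forall => /existsP[k wk].
by rewrite /expw (bigD1 k)//= (negbTE wk) !mul0r.
Qed.

(** Second moments of independent standard exponential variables, whose density is [expw]. *)
Let integral_moment (i j : 'I_n.+1) :
  (\int[@lebesgue_rV R n.+1]_w (expw w * (w ord0 i * w ord0 j))%:E =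
   (1 + (i == j)%:R)%:E)%E.
Proof.
pose m (k : 'I_n.+1) := ((k == i) + (k == j))%N.
transitivity (\int[@lebesgue_rV R n.+1]_w
  (\prod_k ((0 <= w ord0 k)%R%:R * (w ord0 k ^+ m k * expR (- w ord0 k))))%:E)%E.
  apply: eq_integral => w _; congr EFin; rewrite /expw.
  have E (l : 'I_n.+1) : w ord0 l = \prod_k w ord0 k ^+ (k == l).
    rewrite (bigD1 l)//= eqxx expr1 big1 ?mulr1// => k /negbTE ->.
    by rewrite expr0.
  rewrite [X in _ * (X * _)](E i) [X in _ * (_ * X)](E j) -!big_split /=.
  apply: eq_bigr => k _.
  by rewrite /m exprD; ring.
rewrite (integral_rV_prod (h := fun k t => (0 <= t)%R%:R * (t ^+ m k * expR (- t)))
  (c := fun k => (m k)`!%:R)).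
- congr EFin; rewrite /m; have [<-|ij] := eqVneq i j.
    rewrite (bigD1 i)//= eqxx big1 ?mulr1 ?(natrD _ 1 1)//.
    by move=> k /negbTE ->.
  rewrite big1 ?addr0// => k _.
  case: eqVneq => [->|]; first by rewrite (negbTE ij).
  by move=> _; case: (k == j).
- by move=> k; mfun.
- move=> k t; have [t0|] := leP 0 t; last by rewrite mul0r.
  by rewrite mul1r mulr_ge0 ?exprn_ge0 ?expR_ge0.
- by move=> k; exact: integral_expX0.
Qed.

(** The entries are the barycentric coordinates of [p], so this is membership in the simplex. *)
Definition bary (p : 'rV[R]_n) : bool :=
  [forall i, 0 <= (hom p *m invmx (hmx x)) ord0 i].

Lemma mulmx_hmx (w : 'rV[R]_n.+1) : w *m hmx x =
  rV_cons (\sum_i w ord0 i, \sum_i w ord0 i *: tnth x i).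
Proof.
apply/rowP => j; rewrite [LHS]mxE; case: (unliftP ord0 j) => [k|] ->.
  rewrite mxE liftK /= summxE; apply: eq_bigr => i _.
  by rewrite !mxE liftK.
rewrite mxE unlift_none /=; apply: eq_bigr => i _.
by rewrite !mxE unlift_none mulr1.
Qed.

Let quadw (w : 'rV[R]_n.+1) :
  (\sum_i w ord0 i) ^+ 2 -
    dot (\sum_i w ord0 i *: tnth x i) (\sum_i w ord0 i *: tnth x i) =
  \sum_i \sum_j q i j * (w ord0 i * w ord0 j).
Proof.
have dot_sum (I : finType) (f : I -> 'rV[R]_n) y :
    dot (\sum_i f i) y = \sum_i dot (f i) y.
  rewrite /dot exchange_big /=; apply: eq_bigr => i _.
  by rewrite summxE mulr_suml.
rewrite dot_sum expr2 mulr_suml -sumrB; apply: eq_bigr => i _.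
rewrite mulr_sumr dotC dot_sum -sumrB; apply: eq_bigr => j _.
by rewrite dotZl dotZr dotC /q; ring.
Qed.

(** The weight 1 - |p|^2 made homogeneous, t^2 - |v|^2, on the cone over the simplex, and damped by
    exp (-t). *)
Let phi (u : 'rV[R]_n.+1) : R :=
  let t := u ord0 ord0 in
  let v : 'rV[R]_n := \row_j u ord0 (lift ord0 j) in
  (0 < t)%R%:R * expR (- t) * ((dot v v < t ^+ 2)%R%:R * (t ^+ 2 - dot v v)) *
  ([forall i, 0 <= (u *m invmx (hmx x)) ord0 i])%:R.

Let phi_ge0 u : 0 <= phi u.
Proof.
rewrite /phi; apply: mulr_ge0 => //; apply: mulr_ge0; first by pos.
by case: ltP => h; rewrite ?mul0r// mul1r subr_ge0 ltW.
Qed.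

Let mphi : measurable_fun setT phi.
Proof.
have mrow : measurable_fun setT (fun u : 'rV[R]_n.+1 =>
    \row_j u ord0 (lift ord0 j) : 'rV[R]_n).
  apply: mfun_rVP => i.
  rewrite (_ : (fun _ => _) = fun u : 'rV[R]_n.+1 => u ord0 (lift ord0 i)).
    by mfun.
  by apply/funext => u; rewrite mxE.
by rewrite /phi; mfun.
Qed.

Let phi_mul w : phi (w *m hmx x) =
  \sum_i \sum_j q i j * (expw w * (w ord0 i * w ord0 j)).
Proof.
have -> : \sum_i \sum_j q i j * (expw w * (w ord0 i * w ord0 j)) =
    expw w * \sum_i \sum_j q i j * (w ord0 i * w ord0 j).
  rewrite mulr_sumr; apply: eq_bigr => i _; rewrite mulr_sumr.
  by apply: eq_bigr => j _; ring.
rewrite -quadw /phi mulmxK// mulmx_hmx mxE unlift_none /=.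
set t := \sum_i _; set v := \sum_i _.
have -> : (\row_j rV_cons (t, v) ord0 (lift ord0 j)) = v.
  by apply/rowP => j; rewrite !mxE liftK.
have [w0|wN0] := boolP [forall i, 0 <= w ord0 i]; last first.
  rewrite mulr0; move: wN0; rewrite negb_forall => /existsP[i wi].
  by rewrite /expw (bigD1 i)//= (negbTE wi) !mul0r.
rewrite mulr1 /expw big_split /=.
have w0' i : 0 <= w ord0 i by exact: (forallP w0).
rewrite big1 ?mul1r; last by move=> i _; rewrite w0'.
rewrite -expR_sum sumrN -/t.
have qw : 0 <= t ^+ 2 - dot v v.
  rewrite quadw; apply: sumr_ge0 => i _; apply: sumr_ge0 => j _.
  by rewrite mulr_ge0// mulr_ge0.
have -> : (dot v v < t ^+ 2)%R%:R * (t ^+ 2 - dot v v) = t ^+ 2 - dot v v.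
  case: ltP => h; rewrite ?mul1r// mul0r; apply/eqP.
  by rewrite eq_le qw/= subr_le0.
(* If the sum t of the nonnegative coordinates is not positive, it is 0 and both sides vanish. *)
have [t0|t0] := ltP 0 t; first by rewrite mul1r.
have t00 : t = 0 by apply/le_anti; rewrite t0/= sumr_ge0.
have -> : t ^+ 2 - dot v v = 0.
  apply/le_anti; rewrite qw andbT t00 expr0n /= sub0r oppr_le0.
  exact: dot_ge0.
by rewrite !mulr0.
Qed.

(** The integral of [phi] in two ways. Slicing at height t gives t^(n + 2) exp (-t) times the
    integral over the simplex, hence (n + 2)!. The coordinates w turn the cone into the positive
    orthant with exponential density and Jacobian the determinant, and the second moments produce
    [quad]. *)
Lemma integral_simplex :
  (((n.+2)`!%:R)%:E *
     \int[@lebesgue_rV R n]_p (bker 2 p * (bary p)%:R)%:E =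
   (`|\det (hmx x)| * quad x)%:E)%E.
Proof.
have mb : measurable_fun setT (fun p : 'rV[R]_n => bker 2 p * (bary p)%:R).
  by rewrite /bary /hom; mfun.
have b0 p : 0 <= bker 2 p * (bary p)%:R by pos.
transitivity (\int[@lebesgue_rV R n.+1]_u (phi u)%:E)%E; last first.
  rewrite (integral_mulmx ux); side.
  rewrite EFinM; congr (_ * _)%E.
  transitivity (\int[@lebesgue_rV R n.+1]_w \sum_i \sum_j
    (q i j * (expw w * (w ord0 i * w ord0 j)))%:E)%E.
    apply: eq_integral => w _; rewrite phi_mul -sumEFin.
    by apply: eq_bigr => i _; rewrite -sumEFin.
  have mexp : measurable_fun setT expw by rewrite /expw; mfun.
  rewrite ge0_integral_sum//; last 2 first.
  - by move=> i; apply: emeasurable_sum => j; mfun.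
  - move=> i w _; apply: sume_ge0 => j _; rewrite lee_fin.
    exact: mulr_ge0.
  rewrite /quad -sumEFin; apply: eq_bigr => i _.
  rewrite ge0_integral_sum//; last 2 first.
  - by move=> j; mfun.
  - by move=> j w _; rewrite lee_fin mulr_ge0.
  rewrite -sumEFin; apply: eq_bigr => j _.
  under eq_integral do rewrite EFinM.
  rewrite ge0_integralZl_EFin; side.
  by rewrite integral_moment -EFinM mulrC.
rewrite -integral_expX -ge0_integralZr; side; last first.
  move=> t _; rewrite lee_fin; have [t0|] := ltP 0 t; last by rewrite mul0r.
  by rewrite mul1r mulr_ge0 ?exprn_ge0 ?expR_ge0 ?ltW.
rewrite integral_rVS; side.
apply: eq_integral => t _.
have [t0|t0] := ltP 0 t; last first.
  rewrite mul0r mul0e integral0_eq// => v _.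
  by rewrite /phi mxE unlift_none /= ltNge t0 !mul0r.
have ti0 : 0 < t^-1 by rewrite invr_gt0.
rewrite mul1r (integral_rV_scale ti0); side; last by rewrite /bary /hom; mfun.
rewrite muleA -EFinM -ge0_integralZl_EFin; side; last first.
- have t3 := mulr_gt0 (exprn_gt0 n.+2 t0) (expR_gt0 (- t)).
  exact: ltW (mulr_gt0 t3 (exprn_gt0 n ti0)).
- by rewrite /bary /hom; mfun.
apply: eq_integral => v _; rewrite -EFinM; congr EFin.
rewrite /phi mxE unlift_none /= t0 mul1r.
have -> : (\row_j rV_cons (t, v) ord0 (lift ord0 j)) = v.
  by apply/rowP => j; rewrite !mxE liftK.
have homt : hom (t^-1 *: v) = t^-1 *: rV_cons (t, v).
  apply/rowP => j; rewrite !mxE; case: (unliftP ord0 j) => [k _|_] /=.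
    by rewrite mxE.
  by rewrite mulVf ?gt_eqF.
have -> : bary (t^-1 *: v) =
    [forall i, 0 <= (rV_cons (t, v) *m invmx (hmx x)) ord0 i].
  rewrite /bary homt; apply: eq_forallb => i.
  by rewrite -scalemxAl mxE pmulr_rge0.
rewrite bker2E dotZ (exprVn t 2).
have -> : (t ^- 2 * dot v v < 1) = (dot v v < t ^+ 2).
  by rewrite ltr_pdivrMl ?exprn_gt0// mulr1.
rewrite mulrA.
have -> : t ^+ n.+2 * expR (- t) * t^-1 ^+ n = expR (- t) * t ^+ 2.
  rewrite -addn2 exprD exprVn; field.
  by rewrite expf_neq0// gt_eqF.
have -> : t ^+ 2 - dot v v = t ^+ 2 * (1 - t ^- 2 * dot v v).
  by field; rewrite gt_eqF.
by ring.
Qed.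

End fixed_vertices.

End simplex_integral.

(** * The tangent cone at a vertex *)

Section cone_integral.
Context (R : realType).

(* For nonsingular x, the solid tangent cone at the first vertex of the simplex
   with vertices x: by Cramer, the ratios are the barycentric coordinates of
   the direction z, and all but the first must be nonnegative. *)
Definition cone n (x : n.+1.-tuple 'rV[R]_n) (z : 'rV[R]_n) : bool :=
  (\det (hmx x) != 0) && [forall j,
    0 <= (rV_cons (0, z) *m \adj (hmx x)) ord0 (lift ord0 j) / \det (hmx x)].

(** The use of the adjugate in [cone] pays off here: its entries are determinants, measurable
    without any invertibility assumption. *)
Lemma measurable_cone d (T : measurableType d) n
    (f : T -> n.+1.-tuple 'rV[R]_n) (g : T -> 'rV[R]_n) :
  measurable_fun setT f -> measurable_fun setT g ->
  measurable_fun setT (fun t => cone (f t) (g t)).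
Proof.
move=> mf mg; rewrite /cone; apply: mfun_and; first by mfun.
apply: mfun_all => j; apply: mfun_ler; first by mfun.
apply: mfun_M; last by mfun.
rewrite (_ : (fun _ => _) = (fun t => \sum_k rV_cons (0, g t) ord0 k *
    ((-1) ^+ (lift ord0 j + k) * \det (row' (lift ord0 j) (col' k (hmx (f t))))))).
  apply: mfun_sum => k; apply: mfun_M; first by mfun.
  apply: mfun_M; first by mfun.
  apply: measurable_det_entries => a b.
  rewrite (_ : (fun _ => _) = (fun t =>
      hom (tnth (f t) (lift (lift ord0 j) a)) ord0 (lift k b))).
    by rewrite /hom; mfun.
  by apply/funext => t; rewrite !mxE.
by apply/funext => t; rewrite mxE; apply: eq_bigr => k _; rewrite [X in _ * X]mxE.
Qed.

Definition axis n : 'rV[R]_n.+1 := rV_cons (1, 0).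

Lemma axis_adj n (y : 'rV[R]_n.+2) (x : n.+2.-tuple 'rV[R]_n) j :
  (rV_cons (0, axis n) *m \adj (hmx (attach y x))) ord0 j = gam x j.
Proof.
have -> : rV_cons (0, axis n) = delta_mx ord0 (lift ord0 ord0).
  apply/rowP => k; rewrite [RHS]mxE eqxx /= mxE.
  case: (unliftP ord0 k) => [l|] -> //=.
  rewrite (inj_eq lift_inj) /axis mxE.
  by case: (unliftP ord0 l) => [m|] -> //=; rewrite mxE.
by rewrite -rowE [LHS]mxE [LHS]mxE cofactor_attach.
Qed.

Lemma measurable_gam d (T : measurableType d) n
    (f : T -> n.+2.-tuple 'rV[R]_n) i :
  measurable_fun setT f -> measurable_fun setT (fun t => gam (f t) i).
Proof.
move=> mf; apply: mfun_M; first by mfun.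
apply: measurable_det_entries => a b.
rewrite (_ : (fun _ => _) = (fun t => hom (tnth (f t) (lift i a)) ord0 b)).
  by rewrite /hom; mfun.
by apply/funext => t; rewrite !mxE.
Qed.

Lemma measurable_gam0 n :
  measurable [set x : n.+2.-tuple 'rV[R]_n | gam x ord0 == 0].
Proof.
apply: measurable_bool; apply: mfun_eqr; last by mfun.
by apply: measurable_gam; mfun.
Qed.

Lemma gam0_measure0 n :
  tuple_measure (@lebesgue_rV R n) n.+2 [set x | gam x ord0 == 0] = 0%E.
Proof.
have mg : measurable_fun setT (fun x : n.+2.-tuple 'rV[R]_n => gam x ord0 == 0).
  by apply: mfun_eqr; [apply: measurable_gam|]; mfun.
rewrite measure_bool// integral_tupleS; side; last exact: mfun_E (mfun_natb mg).
rewrite integral0_eq// => x0 _; rewrite -[RHS](@singular_null R n).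
by apply: eq_integral => xs _; rewrite gam_tcons0 oppr_eq0.
Qed.

(** A sum of two indicators, one for each sign of the determinant; both hold only if all these
    coefficients vanish. *)
Definition sgn_gam n (x : n.+2.-tuple 'rV[R]_n) : R :=
  [forall j, 0 <= gam x (lift ord0 j)]%:R + [forall j, gam x (lift ord0 j) <= 0]%:R.

Lemma sgn_gam_ge0 n (x : n.+2.-tuple 'rV[R]_n) : 0 <= sgn_gam x.
Proof. by rewrite addr_ge0. Qed.

Lemma measurable_sgn_gam d (T : measurableType d) n
    (f : T -> n.+2.-tuple 'rV[R]_n) :
  measurable_fun setT f -> measurable_fun setT (fun t => sgn_gam (f t)).
Proof.
move=> mf; have mg i := @measurable_gam _ _ _ _ i mf.
by rewrite /sgn_gam; mfun.
Qed.

(** Changing the sign of [y] negates the determinant but leaves [gam] alone, so each of the two sign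
    conditions is tested exactly once. *)
Lemma cone_axis_flip n (y : 'rV[R]_n.+2) (x : n.+2.-tuple 'rV[R]_n) :
  \det (hmx (attach y x)) != 0 ->
  (cone (attach y x) (axis n))%:R + (cone (attach (- y) x) (axis n))%:R =
  sgn_gam x :> R.
Proof.
have detN : \det (hmx (attach (- y) x)) = - \det (hmx (attach y x)).
  by rewrite !det_attach -sumrN; apply: eq_bigr => i _; rewrite mxE mulNr.
rewrite /cone detN oppr_eq0 => d0; rewrite d0 /=.
under eq_forallb do rewrite axis_adj.
under [X in _ + (nat_of_bool X)%:R]eq_forallb do rewrite axis_adj.
rewrite /sgn_gam; have [d1|d1|d1] := ltgtP (\det (hmx (attach y x))) 0.
- rewrite addrC; congr (_%:R + _%:R); congr nat_of_bool; apply: eq_forallb => j.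
    by rewrite pmulr_lge0// invr_gt0 oppr_gt0.
  by rewrite nmulr_lge0// invr_lt0.
- congr (_%:R + _%:R); congr nat_of_bool; apply: eq_forallb => j.
    by rewrite pmulr_lge0// invr_gt0.
  by rewrite nmulr_lge0// invr_lt0 oppr_lt0.
- by rewrite d1 eqxx in d0.
Qed.

(** By [gam_ker], the ratios gam_j / (- gam_0) are the barycentric coordinates of [x0] with respect
    to [xs]. *)
Lemma sgn_gam_bary n (x0 : 'rV[R]_n) (xs : n.+1.-tuple 'rV[R]_n) :
  \det (hmx xs) != 0 ->
  sgn_gam (tcons (x0, xs)) = (bary xs x0)%:R.
Proof.
move=> d0; set x := tcons _.
have g0 : gam x ord0 != 0 by rewrite gam_tcons0 oppr_eq0.
have uxs : hmx xs \in unitmx by rewrite unitmxE unitfE.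
have W i : (hom x0 *m invmx (hmx xs)) ord0 i =
    gam x (lift ord0 i) / - gam x ord0.
  pose w : 'rV[R]_n.+1 := \row_i (gam x (lift ord0 i) / - gam x ord0).
  suff -> : hom x0 = w *m hmx xs by rewrite mulmxK// mxE.
  apply/rowP => j; have := gam_ker x j; rewrite big_ord_recl.
  have -> : hmx x ord0 j = hom x0 ord0 j by rewrite mxE.
  move=> /eqP; rewrite addr_eq0 => /eqP E.
  rewrite [RHS]mxE; transitivity ((gam x ord0 * hom x0 ord0 j) / gam x ord0).
    by rewrite mulrC mulKf.
  rewrite E mulNr -mulrN -invrN mulr_suml; apply: eq_bigr => k _.
  have -> : hmx x (lift ord0 k) j = hmx xs k j by rewrite !mxE tnth_tconsS.
  by rewrite [w _ _]mxE; ring.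
(* The coefficients add up to 0, by the column of ones, so the others cannot all have the sign of
   the first: one of the two indicators is 0. *)
have S : gam x ord0 + \sum_i gam x (lift ord0 i) = 0.
  rewrite -big_ord_recl -[RHS](gam_ker x ord0); apply: eq_bigr => i _.
  by rewrite !mxE unlift_none mulr1.
have -> : bary xs x0 = [forall j, 0 <= gam x (lift ord0 j) / - gam x ord0].
  by apply: eq_forallb => i; rewrite W.
rewrite /sgn_gam; have [g1|g1|g1] := ltgtP (gam x ord0) 0.
- have -> : [forall j, gam x (lift ord0 j) <= 0] = false.
    apply/negP => /forallP H.
    have : \sum_j gam x (lift ord0 j) <= 0 by apply: sumr_le0 => j _.
    by move: S; lra.
  rewrite addr0; congr (_%:R); congr nat_of_bool; apply: eq_forallb => j.
  by rewrite [RHS]pmulr_lge0// invr_gt0 oppr_gt0.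
- have -> : [forall j, 0 <= gam x (lift ord0 j)] = false.
    apply/negP => /forallP H.
    have : 0 <= \sum_j gam x (lift ord0 j) by apply: sumr_ge0 => j _.
    by move: S; lra.
  rewrite add0r; congr (_%:R); congr nat_of_bool; apply: eq_forallb => j.
  by rewrite [RHS]nmulr_lge0// invr_lt0 oppr_lt0.
- by rewrite g1 eqxx in g0.
Qed.

(** With s^2 = 1 - |v|^2, the substitution t -> s t gives one factor s from the Jacobian and one
    from the weight. *)
Lemma integral_bker_cons n (v : 'rV[R]_n) :
  (\int[@lebesgue_measure R]_t (bker 1 (rV_cons (t, v)))%:E =
   (ball_const R 1 1 * bker 2 v)%:E)%E.
Proof.
rewrite bker2E; have [v1|v1] := ltP (dot v v) 1; last first.
  rewrite mul0r mulr0 integral0_eq// => t _; rewrite /bker dot_rV_cons.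
  rewrite (_ : (_ < 1) = false) ?mul0r//; apply/negbTE; rewrite -leNgt.
  by rewrite (le_trans v1)// lerDr sqr_ge0.
have s2 : 0 < 1 - dot v v by rewrite subr_gt0.
pose s := Num.sqrt (1 - dot v v).
have s0 : 0 < s by rewrite sqrtr_gt0.
have sE : s ^+ 2 = 1 - dot v v by rewrite sqr_sqrtr// ltW.
rewrite (@integral_affine _ s 0) ?gt_eqF//; side.
rewrite mul1r -sE gtr0_norm//.
transitivity (s%:E * \int[@lebesgue_measure R]_t
   (s * ((t ^+ 2 < 1)%R%:R * Num.sqrt (1 - t ^+ 2) ^+ 1))%:E)%E.
  congr (_ * _)%E; apply: eq_integral => t _; congr EFin.
  rewrite /bker dot_rV_cons addr0.
  have -> : ((s * t) ^+ 2 + dot v v < 1) = (t ^+ 2 < 1).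
    rewrite -ltrBrDr -sE exprMn -[X in _ < X]mulr1 ltr_pM2l// exprn_gt0//.
  have -> : 1 - ((s * t) ^+ 2 + dot v v) = s ^+ 2 * (1 - t ^+ 2).
    by rewrite mulrBr mulr1 {1}sE; ring.
  rewrite sqrtrM ?sqr_ge0// sqrtr_sqr gtr0_norm// !expr1.
  by ring.
under eq_integral do rewrite EFinM.
rewrite ge0_integralZl_EFin; side.
rewrite integral_bker1 -!EFinM; congr EFin; ring.
Qed.

Lemma integral_bprod_attach m n (x : m.-tuple 'rV[R]_n) :
  (\int[@lebesgue_rV R m]_y (bprod 1 (attach y x))%:E =
   (ball_const R 1 1 ^+ m * bprod 2 x)%:E)%E.
Proof.
transitivity (\int[@lebesgue_rV R m]_y
  (\prod_i bker 1 (rV_cons (y ord0 i, tnth x i)))%:E)%E.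
  by apply: eq_integral => y _; congr EFin; apply: eq_bigr => i _; rewrite tnth_mktuple.
rewrite (integral_rV_prod (h := fun i t => bker 1 (rV_cons (t, tnth x i)))
  (c := fun i => ball_const R 1 1 * bker 2 (tnth x i))).
- by rewrite big_split /= big_const_ord iter_mulr_1.
- by move=> i; mfun.
- by move=> i t; pos.
- by move=> i; exact: integral_bker_cons.
Qed.

(** The first point is integrated over the simplex of the others; [integral_simplex] supplies the
    determinant and [quad]. *)
Lemma integral_sgn_gam n :
  ((n.+2)`!%:R%:E * \int[tuple_measure (@lebesgue_rV R n) n.+2]_x
     (bprod 2 x * sgn_gam x)%:E = Mint R n)%E.
Proof.
have mS := @measurable_sgn_gam.
have S0 := @sgn_gam_ge0.
rewrite integral_tupleS; last 2 first.
- by apply: mfun_E; apply: mfun_M; [mfun|exact: mS].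
- by move=> x; rewrite lee_fin mulr_ge0// bprod_ge0.
rewrite (fubini_tonelli (fun p : 'rV[R]_n * n.+1.-tuple 'rV[R]_n =>
  (bprod 2 (tcons p) * sgn_gam (tcons p))%:E)); last 2 first.
- by apply: mfun_E; apply: mfun_M; [mfun|apply: mS; mfun].
- by move=> x; rewrite lee_fin mulr_ge0// bprod_ge0.
rewrite -ge0_integralZl_EFin; side; last first.
  apply: mfun_integral => [x y|]; first by pos.
  by apply: mfun_E; apply: mfun_M; [mfun|apply: mS; mfun].
rewrite /Mint; apply: (ge0_integral_off_null (@measurable_singular R n)).
- exact: singular_measure0.
- move=> x; apply: mule_ge0 => //; apply: integral_ge0 => y _.
  by rewrite lee_fin mulr_ge0// bprod_ge0.
- by move=> x; rewrite lee_fin; pos.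
move=> xs /negP xsN0.
transitivity ((n.+2)`!%:R%:E * \int[@lebesgue_rV R n]_x
  ((bprod 2 xs)%:E * (bker 2 x * (bary xs x)%:R)%:E))%E.
  congr (_ * _)%E; apply: eq_integral => x _; rewrite -EFinM; congr EFin.
  have -> : bprod 2 (tcons (x, xs)) = bker 2 x * bprod 2 xs.
    rewrite {1}/bprod big_ord_recl; congr (_ * _).
    by apply: eq_bigr => i _; rewrite tnth_tconsS.
  by rewrite sgn_gam_bary//; ring.
have mb : measurable_fun setT (fun p : 'rV[R]_n => bker 2 p * (bary xs p)%:R).
  by rewrite /bary /hom; mfun.
rewrite ge0_integralZl_EFin; side; last exact: mfun_E mb.
have [->|b0] := eqVneq (bprod 2 xs) 0; first by rewrite mul0e mule0 mul0r mulr0.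
rewrite muleCA integral_simplex//; last exact: bprod_neq0 b0.
by rewrite -EFinM; congr EFin; ring.
Qed.

(** The factor 2 makes room for both [y] and [- y]; after [cone_axis_flip] the integrand depends on
    [y] only through the weight, which integrates out. *)
Lemma integral_cone_axis n :
  (2%:E * (n.+2)`!%:R%:E * \int[tuple_measure (@lebesgue_rV R n.+1) n.+2]_x
     (bprod 1 x * (cone x (axis n))%:R)%:E =
   (ball_const R 1 1 ^+ n.+2)%:E * Mint R n)%E.
Proof.
have mC := @measurable_cone.
rewrite integral_attach; last 2 first.
- by apply: mfun_E; apply: mfun_M; [mfun|apply: mfun_natb; apply: mC; mfun].
- by move=> x; pos.
have mF : measurable_fun setT (fun p : (n.+2.-tuple 'rV[R]_n * 'rV[R]_n.+2) =>
    (bprod 1 (attach p.2 p.1) * (cone (attach p.2 p.1) (axis n))%:R)%:E).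
  by apply: mfun_E; apply: mfun_M; [mfun|apply: mfun_natb; apply: mC; mfun].
have mF1 x : measurable_fun setT (fun y : 'rV[R]_n.+2 =>
    (bprod 1 (attach y x) * (cone (attach y x) (axis n))%:R)%:E).
  by apply: mfun_E; apply: mfun_M; [mfun|apply: mfun_natb; apply: mC; mfun].
have mF2 x : measurable_fun setT (fun y : 'rV[R]_n.+2 =>
    (bprod 1 (attach y x) * (cone (attach (- y) x) (axis n))%:R)%:E).
  apply: mfun_E; apply: mfun_M; [mfun|apply: mfun_natb; apply: mC]; last by mfun.
  apply: measurable_attach; last by mfun.
  rewrite (_ : -%R = fun y : 'rV[R]_n.+2 => y *m (-1)%:M); first by mfun.
  by apply/funext => y; rewrite mul_mx_scalar scaleN1r.
rewrite -integral_sgn_gam (muleC 2%:E) -muleA [RHS]muleCA; congr (_ * _)%E.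
rewrite -ge0_integralZl_EFin; side; last first.
  by apply: mfun_integral => // x y; pos.
rewrite -ge0_integralZl_EFin; side; last 2 first.
- by apply: mfun_E; apply: mfun_M; [mfun|apply: measurable_sgn_gam; mfun].
- by rewrite exprn_ge0// ltW// ball_const_gt0.
have mN := @measurable_gam0 n.
apply: (ge0_integral_off_null mN).
- exact: gam0_measure0.
- move=> x; apply: mule_ge0 => //; apply: integral_ge0 => y _.
  by pos.
- move=> x; rewrite -EFinM lee_fin; apply: mulr_ge0.
    by rewrite exprn_ge0// ltW// ball_const_gt0.
  by rewrite mulr_ge0 ?bprod_ge0 ?sgn_gam_ge0.
move=> x /negP x0.
have bN y : bprod 1 (attach (- y) x) = bprod 1 (attach y x).
  apply: eq_bigr => i _; rewrite !tnth_mktuple /bker !dot_rV_cons mxE.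
  by rewrite mulrNN.
have -> (a : \bar R) : (2%:E * a = a + a)%E.
  by rewrite mule_natl mule2n.
(* The second copy of the integral is evaluated at [- y]; the weight is even in [y]. *)
rewrite -[X in (_ + X)%E]integral_rV_opp//; last by move=> y; pos.
rewrite -ge0_integralD//; last 3 first.
- by move=> y _; pos.
- by move=> y _; pos.
- by under eq_fun do rewrite bN; exact: mF2.
have Z := hyperplane_null x0; rewrite -measure_bool in Z; last by mfun.
transitivity (\int[@lebesgue_rV R n.+2]_y
  ((sgn_gam x)%:E * (bprod 1 (attach y x))%:E)%E)%E.
  apply: (@ge0_integral_off_null _ _ _ _
    [set y : 'rV[R]_n.+2 | \sum_i y ord0 i * gam x i == 0]).
  - by apply: measurable_bool; mfun.
  - exact: Z.
  - by move=> y; apply: adde_ge0; pos.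
  - by move=> y; rewrite mule_ge0// lee_fin ?bprod_ge0 ?sgn_gam_ge0.
  move=> y /negP; rewrite -det_attach => d0.
  by rewrite bN -EFinD -mulrDr cone_axis_flip// mulrC.
rewrite ge0_integralZl_EFin; side.
by rewrite integral_bprod_attach -!EFinM; congr EFin; ring.
Qed.

End cone_integral.

(** * Rotation invariance and the geometric tangent cone *)

Section cone_geometry.
Context (R : realType).

Lemma dot_eq0 n (x : 'rV[R]_n) : (dot x x == 0) = (x == 0).
Proof.
apply/eqP/eqP => [h|->]; last by rewrite /dot big1 // => i _; rewrite mxE mul0r.
apply/rowP => i; rewrite mxE; apply/eqP; rewrite -sqrf_eq0 expr2; apply/eqP.
by apply: (psumr_eq0P _ h) => // k _; rewrite -expr2 sqr_ge0.
Qed.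

Lemma cone_coords n (x : n.+1.-tuple 'rV[R]_n) (z : 'rV[R]_n) :
  \det (hmx x) != 0 ->
  cone x z =
  [forall j, 0 <= (rV_cons (0, z) *m invmx (hmx x)) ord0 (lift ord0 j)].
Proof.
move=> d0; rewrite /cone d0 /= /invmx unitmxE unitfE d0.
by apply: eq_forallb => j; rewrite -scalemxAr [in RHS]mxE mulrC.
Qed.

(** Barycentric coordinates are preserved by invertible linear maps; the [+ 0] is the form required
    by [hmx_affine]. *)
Lemma cone_mulmx n (Q : 'M[R]_n) (x : n.+1.-tuple 'rV[R]_n) (z : 'rV[R]_n) :
  Q \in unitmx -> cone [tuple tnth x i *m Q + 0 | i < n.+1] (z *m Q) = cone x z.
Proof.
move=> uQ; have Q0 : \det Q != 0 by rewrite -unitfE -unitmxE.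
have dE := det_hmx_affine Q 0 x.
have [d0|d0] := eqVneq (\det (hmx x)) 0.
  by rewrite /cone dE d0 mul0r eqxx.
rewrite !cone_coords//; last by rewrite dE mulf_neq0.
apply: eq_forallb => j; congr (_ <= fun_of_matrix _ _ _).
have u : hmx x \in unitmx by rewrite unitmxE unitfE.
have uQx : hmx [tuple tnth x i *m Q + 0 | i < n.+1] \in unitmx.
  by rewrite unitmxE unitfE dE mulf_neq0.
apply: (can_inj (mulmxK uQx)); rewrite mulmxKV//.
rewrite hmx_affine mulmxA mulmxKV// !rV_consE.
have := mul_row_block (0%:M : 'M[R]_1) z 1%:M 0 0 Q.
by rewrite mulmx1 !mulmx0 addr0 add0r => ->.
Qed.

Lemma cone_scale n (x : n.+1.-tuple 'rV[R]_n) (a : R) (z : 'rV[R]_n) :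
  0 < a -> cone x (a *: z) = cone x z.
Proof.
move=> a0; congr (_ && _); apply: eq_forallb => j.
have -> : rV_cons (0, a *: z) = a *: rV_cons (0, z).
  apply/rowP => k; rewrite !mxE; case: (unliftP ord0 k) => [l|] _ /=.
    by rewrite mxE.
  by rewrite mulr0.
by rewrite -scalemxAl [X in X / _]mxE -mulrA pmulr_rge0.
Qed.

Lemma dot_reflection n (v x : 'rV[R]_n) : dot v v != 0 ->
  let y := x - (2 * dot x v / dot v v) *: v in dot y y = dot x x.
Proof.
move=> v0 /=; rewrite dotDl !dotDr !dotNl !dotNr !dotZl !dotZr (dotC v x).
by field.
Qed.

(* If u is not the axis e, take the reflection exchanging e and u. *)
Lemma exists_rotation n (u : 'rV[R]_n.+1) : dot u u = 1 ->
  exists2 Q : 'M[R]_n.+1, axis R n *m Q = u &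
    forall x : 'rV[R]_n.+1, dot (x *m Q) (x *m Q) = dot x x.
Proof.
set e := axis R n => u1.
have e1 : dot e e = 1 by rewrite dot_rV_cons /dot big1 => [|i _]; rewrite ?mxE; ring.
have [->|ue] := eqVneq u e.
  by exists 1%:M => [|x]; rewrite mulmx1.
pose v := u - e.
have v0 : dot v v != 0 by rewrite dot_eq0 subr_eq0.
pose Q : 'M[R]_n.+1 := 1%:M - (2 / dot v v) *: (v^T *m v).
have QE x : x *m Q = x - (2 * dot x v / dot v v) *: v.
  rewrite mulmxBr mulmx1 -scalemxAr mulmxA mulmx_dot mul_scalar_mx scalerA.
  by congr (_ - _ *: _); ring.
have vv : dot v v = 2 - 2 * dot e u.
  by rewrite dotDl !dotDr !dotNl !dotNr u1 e1 (dotC u e); ring.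
exists Q => [|x].
  have ev : dot e v = dot e u - 1 by rewrite dotDr dotNr e1.
  rewrite QE; have -> : 2 * dot e v / dot v v = - 1.
    by rewrite ev; apply: (mulIf v0); rewrite divfK// vv; ring.
  by rewrite scaleN1r opprK /v addrC subrK.
by rewrite QE dot_reflection.
Qed.

(** Polarization yields preservation of dot products; on basis vectors this reads Q Q^T = 1. *)
Lemma orthogonal_det n (Q : 'M[R]_n) :
  (forall x : 'rV[R]_n, dot (x *m Q) (x *m Q) = dot x x) ->
  Q \in unitmx /\ `|\det Q| = 1.
Proof.
move=> H.
have QQ : Q *m Q^T = 1%:M.
  have P x y : dot (x *m Q) (y *m Q) = dot x y.
    have := H (x + y); rewrite mulmxDl !dotDl !dotDr !H.
    by rewrite (dotC y) (dotC (y *m Q)) => E; lra.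
  have M x y : dot x y = (x *m y^T) 0 0.
    by rewrite mulmx_dot mxE.
  apply/matrixP => i j.
  have := P (delta_mx 0 i) (delta_mx 0 j).
  rewrite !M trmx_mul mulmxA -(mulmxA _ Q).
  rewrite -!rowE.
  by rewrite trmx_delta -colE !mxE eqxx andbT /= eq_sym.
have D : \det Q ^+ 2 = 1 by rewrite expr2 -{2}det_tr -det_mulmx QQ det1.
split; first by rewrite unitmxE unitfE; apply/eqP => d; move: D; rewrite d; lra.
by apply/eqP; rewrite -sqrp_eq1// -normrX D normr1.
Qed.

(** The weights are invariant under rotations and the cone under scaling, so every direction can be
    replaced by the axis. *)
Lemma integral_cone n (u : 'rV[R]_n.+1) : u != 0 ->
  (\int[tuple_measure (@lebesgue_rV R n.+1) n.+2]_x
     (bprod 1 x * (cone x u)%:R)%:E =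
   \int[tuple_measure (@lebesgue_rV R n.+1) n.+2]_x
     (bprod 1 x * (cone x (axis R n))%:R)%:E)%E.
Proof.
move=> u0.
have du : 0 < dot u u by rewrite lt_neqAle dot_ge0 andbT eq_sym dot_eq0.
pose r := Num.sqrt (dot u u).
have r0 : 0 < r by rewrite sqrtr_gt0.
have [Q Qe Qd] : exists2 Q : 'M[R]_n.+1, axis R n *m Q = r^-1 *: u &
    forall x : 'rV[R]_n.+1, dot (x *m Q) (x *m Q) = dot x x.
  apply: exists_rotation; rewrite dotZ exprVn sqr_sqrtr ?ltW// mulVf//.
  by rewrite gt_eqF.
have [uQ dQ] := orthogonal_det Qd.
have mC := @measurable_cone.
rewrite (integral_tuple_map (phi := fun _ x => x *m Q + 0) (c := fun=> 1)
  (mu' := @lebesgue_rV R n.+1)); last 5 first.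
- by move=> i; mfun.
- by [].
- by move=> i G mG G0; rewrite (integral_rV_affine 0 uQ mG G0) dQ.
- by apply: mfun_E; apply: mfun_M; [mfun|apply: mfun_natb; apply: mC; mfun].
- by move=> x; pos.
rewrite big1// mul1e; apply: eq_integral => x _; congr EFin.
have -> : u = r *: (axis R n *m Q).
  by rewrite Qe scalerA divff ?scale1r// gt_eqF.
rewrite cone_scale// cone_mulmx//; congr (_ * _).
by apply: eq_bigr => i _; rewrite tnth_mktuple /bker addr0 Qd.
Qed.

Lemma simplexP n (x : n.+1.-tuple 'rV[R]_n) (p : 'rV[R]_n) :
  simplex (tnth x) p <->
  exists2 w : 'rV[R]_n.+1, forall i, 0 <= w ord0 i & w *m hmx x = hom p.
Proof.
split=> [[w [w0 w1 ->]]|[w w0]].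
  exists (\row_i w i) => [i|]; first by rewrite mxE.
  rewrite mulmx_hmx /hom; congr (rV_cons (_, _)).
    by rewrite -w1; apply: eq_bigr => i _; rewrite mxE.
  by apply: eq_bigr => i _; rewrite mxE.
rewrite mulmx_hmx => /(can_inj (@rV_consK R n))[w1 <-].
by exists (w ord0).
Qed.

(** The barycentric coordinates of x_0 + eps z are those of the first vertex plus eps [c]: the
    coordinate 0 has slack 1, the others must not become negative. *)
Lemma tangent_coneP n (x : n.+1.-tuple 'rV[R]_n) (z : 'rV[R]_n) :
  \det (hmx x) != 0 ->
  tangent_cone (simplex (tnth x)) (tnth x ord0) z <-> cone x z.
Proof.
move=> d0; rewrite cone_coords//.
have u : hmx x \in unitmx by rewrite unitmxE unitfE.
set c := _ *m _.
have E eps : hom (tnth x ord0 + eps *: z) = (delta_mx 0 ord0 + eps *: c) *m hmx x.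
  rewrite mulmxDl -rowE row_hmx -scalemxAl mulmxKV//.
  apply/rowP => k; rewrite !mxE; case: (unliftP ord0 k) => [l|] _ /=.
    by rewrite !mxE.
  by rewrite mulr0 addr0.
have cE eps i : (delta_mx 0 ord0 + eps *: c) ord0 i =
    (i == ord0)%:R + eps * c ord0 i.
  by rewrite [LHS]mxE [X in X + _]mxE [X in _ + X]mxE.
split=> [[eps eps0 /simplexP[w w0]]|].
  rewrite E => /(can_inj (mulmxK u)) wE; apply/forallP => j.
  by have := w0 (lift ord0 j); rewrite wE cE add0r pmulr_rge0.
move=> /forallP c0; set a := c ord0 ord0.
have e0 : 0 < 1 + `|a| by rewrite ltr_pwDl.
(* This step is short enough to keep coordinate 0 nonnegative, as 1 + |a| + a >= 0. *)
exists (1 + `|a|)^-1; first by rewrite invr_gt0.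
apply/simplexP; exists (delta_mx 0 ord0 + (1 + `|a|)^-1 *: c); last by rewrite E.
move=> i; rewrite cE; case: (unliftP ord0 i) => [j|] -> /=.
  by rewrite add0r mulr_ge0 ?invr_ge0 ?(ltW e0).
rewrite -/a -(pmulr_rge0 _ e0) mulrDr mulr1 mulrA divff ?gt_eqF// mul1r.
by rewrite -addrA addr_ge0// -lerBlDr sub0r ler_normr lexx orbT.
Qed.

End cone_geometry.

(** * Random simplices *)

Section tuple_law.
Context dT (T : measurableType dT) (R : realType) (P : probability T R).
Context d (E : measurableType d) (mu : {sigma_finite_measure set E -> \bar R}).
Variables (n : nat) (Y : 'I_n -> T -> E) (g : E -> R).
Hypotheses (mY : forall i, measurable_fun setT (Y i)) (mg : measurable_fun setT g).
Hypotheses (g0 : forall x, 0 <= g x) (g1 : (\int[mu]_x (g x)%:E = 1)%E).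
Hypothesis law : forall A : 'I_n -> set E, (forall i, measurable (A i)) ->
  P (\bigcap_(i in setT) (Y i @^-1` A i)) =
  (\prod_i \int[mu]_(x in A i) (g x)%:E)%E.

Let box (A : 'I_n -> set E) : set (n.-tuple E) :=
  [set x | forall i, A i (tnth x i)].

Let boxes : set (set (n.-tuple E)) :=
  [set B | exists2 A, (forall i, measurable (A i)) & B = box A].

Let measurable_box A : (forall i, measurable (A i)) -> measurable (box A).
Proof.
move=> mA; rewrite (_ : box A = \bigcap_(i in setT) (@tnth n E ^~ i @^-1` A i)).
  apply: fin_bigcap_measurable => // i _.
  by rewrite -[X in measurable X]setTI; apply: measurable_tnth.
by apply/seteqP; split=> x /= H i => [_|]; exact: H.
Qed.

Let measurable_boxes : measurable = <<s boxes >>.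
Proof.
apply/seteqP; split; last first.
  apply: smallest_sub; first exact: sigma_algebra_measurable.
  by move=> _ [A mA ->]; exact: measurable_box.
apply: smallest_sub; first exact: smallest_sigma_algebra.
rewrite -bigcup_seq => B [i _] /= [A mA <-].
apply: sub_sigma_algebra => /=; exists (fun j => if j == i then A else setT).
  by move=> j; case: ifP.
apply/seteqP; split=> x /=.
  by move=> [_ Ax] j; case: eqP => [->|].
by move=> H; split=> //; have := H i; rewrite eqxx.
Qed.

Let boxesI : setI_closed boxes.
Proof.
move=> _ _ [A mA ->] [B mB ->]; exists (fun i => A i `&` B i).
  by move=> i; exact: measurableI.
apply/seteqP; split=> x /=.
  by move=> [HA HB] i; split; [exact: HA|exact: HB].
by move=> H; split=> i; case: (H i).
Qed.

Let mk t : n.-tuple E := [tuple Y i t | i < n].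

Let mmk : measurable_fun setT mk.
Proof. by apply: measurable_mktuple => i; exact: mY. Qed.

Let h (x : n.-tuple E) : R := \prod_i g (tnth x i).

Let mh : measurable_fun setT (fun x => (h x)%:E).
Proof. by rewrite /h; mfun. Qed.

Let h0 x : (0 <= (h x)%:E)%E.
Proof. by rewrite lee_fin; apply: prodr_ge0. Qed.

Let agree B := P (mk @^-1` B) = (\int[tuple_measure mu n]_(x in B) (h x)%:E)%E.

Let agree_box A : (forall i, measurable (A i)) -> agree (box A).
Proof.
move=> mA; rewrite /agree.
have -> : mk @^-1` box A = \bigcap_(i in setT) (Y i @^-1` A i).
  apply/seteqP; split=> t /= H i => [_|]; have := H i; rewrite tnth_mktuple //.
  exact.
rewrite law//.
have mgE D : measurable_fun D (fun x => (g x)%:E).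
  exact: measurable_funS (mfun_E mg).
have fin i : (\int[mu]_(x in A i) (g x)%:E)%E \is a fin_num.
  rewrite ge0_fin_numE; last by apply: integral_ge0 => x _; rewrite lee_fin.
  apply: (@le_lt_trans _ _ 1%E); last exact: ltry.
  by rewrite -g1; apply: ge0_subset_integral => // x _; rewrite lee_fin.
have EI i : (\int[mu]_x ((\1_(A i) x) * g x)%:E)%E =
    (fine (\int[mu]_(x in A i) (g x)%:E))%:E.
  rewrite fineK// [RHS]integral_mkcond; apply: eq_integral => x _.
  by rewrite patchE indicE; case: ifP; rewrite ?mul1r ?mul0r.
transitivity (\prod_i (fine (\int[mu]_(x in A i) (g x)%:E))%:E)%E.
  by apply: eq_bigr => i _; rewrite fineK.
rewrite prodEFin -(integral_tuple_prod (mu := mu)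
  (h := fun i x => \1_(A i) x * g x)); last 3 first.
- by move=> i; apply: mfun_M => //; exact: measurable_indic.
- by move=> i x; rewrite mulr_ge0// indicE.
- exact: EI.
rewrite [RHS]integral_mkcond; apply: eq_integral => x _.
rewrite patchE big_split /= -/(h x).
case: ifPn => [/set_mem Ax|/negP xA].
  by rewrite big1 ?mul1r// => i _; rewrite indicE mem_set.
have [i Ai] : exists i, ~ A i (tnth x i).
  by apply/existsNP => H; apply: xA; exact: mem_set.
by rewrite (bigD1 i)//= indicE memNset// !mul0r.
Qed.

(** Both sides are measures of [B] of total mass 1 that agree on boxes; the boxes are stable under
    intersection and generate the sigma-algebra, so Dynkin's lemma applies. *)
Lemma tuple_law (B : set (n.-tuple E)) : measurable B ->
  P [set t | B [tuple Y i t | i < n]] =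
  (\int[tuple_measure mu n]_(x in B) (\prod_i g (tnth x i))%:E)%E.
Proof.
move=> mB; suff : agree B by [].
have aT : agree setT.
  have -> : setT = box (fun=> setT) by apply/seteqP; split.
  exact: agree_box.
have mpre D : measurable D -> measurable (mk @^-1` D).
  by move=> mD; rewrite -[X in measurable X]setTI; exact: mmk.
have mhD D : measurable_fun D (fun x => (h x)%:E) by exact: measurable_funS mh.
apply: (dynkin_induction measurable_boxes boxesI aT).
- by move=> _ [A mA ->]; exact: agree_box.
- move=> S mS PS.
  have : (P (mk @^-1` S) + P (mk @^-1` (~` S)) =
    \int[tuple_measure mu n]_(x in S) (h x)%:E +
    \int[tuple_measure mu n]_(x in ~` S) (h x)%:E)%E.
    rewrite -measureU; last 3 first.
    - exact: mpre.
    - by apply: mpre; exact: measurableC.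
    - by rewrite -preimage_setI setICr preimage_set0.
    rewrite -preimage_setU -ge0_integral_setU//; last 2 first.
    - exact: measurableC.
    - by rewrite disj_set2E setICr.
    by rewrite setUCr; exact: aT.
  rewrite -PS => /(congr1 (fun x => x - P (mk @^-1` S))%E).
  have fS : P (mk @^-1` S) \is a fin_num.
    by rewrite fin_num_measure//; exact: mpre.
  by rewrite ![(P (mk @^-1` S) + _)%E]addeC !addeK.
- move=> F mF tF PF; rewrite /agree preimage_bigcup ge0_integral_bigcup//.
  rewrite measure_bigcup//; last 2 first.
  - by move=> k _; exact: mpre.
  - apply/trivIsetP => i j _ _ ij; rewrite -preimage_setI.
    by move/trivIsetP : tF => /(_ _ _ _ _ ij) ->//; rewrite preimage_set0.
  rewrite (eq_eseriesl (Q := xpredT)) => [|k]; last by rewrite in_setT.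
  by apply: eq_eseriesr => k _; exact: PF.
- by rewrite -measurable_boxes.
Qed.

End tuple_law.

(** * The expected angle sum *)

Section angle_expectation.
Context (R : realType).

Lemma enorm_dot d (x : 'rV[R]_d) : enorm x ^+ 2 = dot x x.
Proof.
rewrite /enorm sqr_sqrtr; last by apply: sumr_ge0 => i _; rewrite sqr_ge0.
by apply: eq_bigr => i _; rewrite expr2.
Qed.

Lemma enorm_gt0 d (x : 'rV[R]_d) : x != 0 -> 0 < enorm x.
Proof.
move=> x0; rewrite lt_neqAle sqrtr_ge0 andbT eq_sym -sqrf_eq0 enorm_dot.
by rewrite dot_eq0.
Qed.

Lemma unit_ballE d : @unit_ball R d = [set x | dot x x < 1].
Proof.
apply/funext => x; rewrite /unit_ball /= -enorm_dot.
by rewrite expr_lt1// sqrtr_ge0.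
Qed.

Lemma beta_kernelE d (x : 'rV[R]_d) : beta_kernel 2^-1 x = bker 1 x.
Proof.
rewrite /beta_kernel unit_ballE enorm_dot indicE /bker.
have [x1|x1] := ltP (dot x x) 1.
  by rewrite mem_set// mulr1 mul1r powR12_sqrt// subr_ge0 ltW.
by rewrite memNset ?mulr0 ?mul0r//= ltNge x1.
Qed.

Lemma simplex_perm d n (x : 'I_n -> 'rV[R]_d) (s : {perm 'I_n}) :
  simplex (x \o s) = simplex x.
Proof.
apply/seteqP; split=> p [w [w0 w1 ->]].
  exists (w \o (s^-1)%g); split=> [i|//|]; first exact: w0.
    by rewrite -w1 (reindex_perm s); apply: eq_bigr => i _ /=; rewrite permK.
  by rewrite [RHS](reindex_perm s); apply: eq_bigr => i _ /=; rewrite permK.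
exists (w \o s); split=> [i||]; first exact: w0.
  by rewrite -w1 [RHS](reindex_perm s).
by rewrite (reindex_perm s).
Qed.

(** The cone is invariant under scaling, so the projection to the sphere disappears;
    [ball_const R n.+1 0] is the volume of the ball. *)
Lemma internal_angle_cone n (x : n.+2.-tuple 'rV[R]_n.+1) :
  \det (hmx x) != 0 ->
  (internal_angle (simplex (tnth x)) (tnth x ord0))%:E =
  ((ball_const R n.+1 0)^-1%:E *
   \int[@lebesgue_rV R n.+1]_z (bker 0 z * (cone x z)%:R)%:E)%E.
Proof.
move=> d0; have mC := @measurable_cone.
have volE (b : 'rV[R]_n.+1 -> bool) : measurable_fun setT b ->
    lebesgue_rV n.+1 [set z | (dot z z < 1) && b z] =
    (\int[@lebesgue_rV R n.+1]_z (bker 0 z * (b z)%:R)%:E)%E.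
  move=> mb; rewrite measure_bool; last by apply: mfun_and => //; mfun.
  apply: eq_integral => z _; rewrite /bker expr0 mulr1 -natrM.
  by case: (_ < _); case: (b z).
rewrite /internal_angle /sphere_uniform.
have -> : lebesgue_rV n.+1 unit_ball = (ball_const R n.+1 0)%:E.
  rewrite -integral_bker; transitivity
    (lebesgue_rV n.+1 [set z : 'rV[R]_n.+1 | (dot z z < 1) && true]).
    by rewrite unit_ballE; congr (lebesgue_rV _ _); apply/funext => z /=; rewrite andbT.
  by rewrite volE//; apply: eq_integral => z _; rewrite mulr1.
have -> : unit_ball `&` [set z | tangent_cone (simplex (tnth x)) (tnth x ord0)
    ((enorm z)^-1 *: z)] = [set z | (dot z z < 1) && cone x z].
  have E z : tangent_cone (simplex (tnth x)) (tnth x ord0) ((enorm z)^-1 *: z)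
      <-> cone x z.
    rewrite tangent_coneP//; have [->|z0] := eqVneq z 0; first by rewrite scaler0.
    by rewrite cone_scale// invr_gt0 enorm_gt0.
  rewrite unit_ballE; apply/seteqP; split=> z /=.
    by move=> [-> /E].
  by move=> /andP[-> /E].
rewrite volE; last by apply: mC; mfun.
rewrite /= mulrC EFinM; congr (_ * _)%E; rewrite fineK//.
rewrite ge0_fin_numE; last by apply: integral_ge0 => z _; pos.
apply: (@le_lt_trans _ _ (ball_const R n.+1 0)%:E); last exact: ltry.
rewrite -integral_bker; apply: ge0_le_integral => //.
- by move=> z _; pos.
- by apply: mfun_E; apply: mfun_M; [mfun|apply: mfun_natb; apply: mC; mfun].
- by mfun.
- move=> z _; rewrite lee_fin; case: (cone x z); rewrite ?mulr1// mulr0.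
  exact: bker_ge0.
Qed.

Section iid.
Context (dT : measure_display) (T : measurableType dT) (P : probability T R).
Variables (m : nat) (X : 'I_m.+2 -> {RV P >-> 'rV[R]_m.+1}).
Hypothesis iidX : iid_beta 2^-1 X.

Let c1 : R := ball_const R m.+1 1.
Let c1_gt0 : 0 < c1. Proof. exact: ball_const_gt0. Qed.

Let g (x : 'rV[R]_m.+1) : R := c1^-1 * bker 1 x.

Let g_ge0 x : 0 <= g x.
Proof. by rewrite mulr_ge0 ?bker_ge0// invr_ge0 ltW. Qed.

Let mg : measurable_fun setT g. Proof. by rewrite /g; mfun. Qed.

Let g1 : (\int[@lebesgue_rV R m.+1]_x (g x)%:E = 1)%E.
Proof.
under eq_integral do rewrite EFinM.
rewrite ge0_integralZl_EFin; side.
by rewrite integral_bker -EFinM mulVf ?gt_eqF.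
Qed.

(** The unspecified constant of proportionality is forced by the total mass 1. *)
Let density i A : measurable A ->
  P (X i @^-1` A) = (\int[@lebesgue_rV R m.+1]_(x in A) (g x)%:E)%E.
Proof.
have [_ /(_ i)[c c0 H]] := iidX; suff -> : g = fun x => c * beta_kernel 2^-1 x.
  by move=> mA; rewrite -H.
apply/funext => x; rewrite beta_kernelE; congr (_ * _).
have := H _ measurableT; rewrite [LHS](probability_setT (distribution P (X i))).
under eq_integral do rewrite beta_kernelE EFinM.
rewrite ge0_integralZl_EFin; side.
rewrite integral_bker -EFinM => -[] E.
have c10 : c1 != 0 by rewrite gt_eqF.
by apply: (mulIf c10); rewrite mulVf.
Qed.

(** A permuted sample: any vertex can be moved to the first place, and the points being i.i.d., the
    law does not depend on [s]. *)
Let Y (s : {perm 'I_m.+2}) t : m.+2.-tuple 'rV[R]_m.+1 :=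
  [tuple X (s i) t | i < m.+2].

Let mY s : measurable_fun setT (Y s).
Proof. by apply: measurable_mktuple => i; exact: measurable_funP. Qed.

Let law (s : {perm 'I_m.+2}) (A : 'I_m.+2 -> set 'rV[R]_m.+1) :
  (forall i, measurable (A i)) ->
  P (\bigcap_(i in setT) (X (s i) @^-1` A i)) =
  (\prod_i \int[@lebesgue_rV R m.+1]_(x in A i) (g x)%:E)%E.
Proof.
move=> mA; have [indep _] := iidX.
have := indep [set: 'I_m.+2]%SET (A \o (s^-1)%g) (fun i => mA _).
rewrite (_ : \bigcap_(i in _) _ = \bigcap_(i in setT) (X (s i) @^-1` A i)).
  move=> ->; rewrite (reindex_perm s) /=; apply: eq_big => i.
    by rewrite inE.
  by move=> _; rewrite permK; exact: density.
apply/seteqP; split=> t /= H i _; have := H.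
  by move=> /(_ (s i)); rewrite /= permK; apply; rewrite inE.
by move=> /(_ ((s^-1)%g i) Logic.I); rewrite /= permKV.
Qed.

Let law_bool s (b : m.+2.-tuple 'rV[R]_m.+1 -> bool) :
  measurable_fun setT b ->
  (\int[P]_t (b (Y s t))%:R%:E =
   \int[tuple_measure (@lebesgue_rV R m.+1) m.+2]_x
     (c1^-1 ^+ m.+2 * (bprod 1 x * (b x)%:R))%:E)%E.
Proof.
move=> mb; rewrite -measure_bool; last exact: measurableT_comp mb (mY s).
transitivity (\int[tuple_measure (@lebesgue_rV R m.+1) m.+2]_(x in [set x | b x])
  (\prod_i g (tnth x i))%:E)%E.
  apply: (tuple_law (Y := fun i => X (s i)) _ mg g_ge0 g1 (@law s)
    (measurable_bool mb)).
  by move=> i; exact: measurable_funP.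
rewrite integral_mkcond; apply: eq_integral => x _; rewrite patchE.
rewrite big_split /= prodr_const card_ord.
case: ifPn => [/set_mem /= ->|]; first by rewrite mulr1.
by rewrite notin_setE => /negP/negbTE ->; rewrite !mulr0.
Qed.

Let singular0 s : P [set t | \det (hmx (Y s t)) == 0] = 0%E.
Proof.
have mD : measurable_fun setT (fun x : m.+2.-tuple 'rV[R]_m.+1 =>
  \det (hmx x) == 0) by mfun.
rewrite measure_bool; last exact: measurableT_comp mD (mY s).
rewrite (law_bool s mD).
rewrite -[RHS](integral0 (tuple_measure (@lebesgue_rV R m.+1) m.+2) setT).
apply: (ge0_integral_off_null (@measurable_singular R m.+1)) => //.
- exact: singular_measure0.
- by move=> x; rewrite lee_fin mulr_ge0 ?exprn_ge0 ?invr_ge0 ?(ltW c1_gt0)//; pos.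
by move=> x /= /negP/negbTE ->; rewrite !mulr0.
Qed.

Variable K : R.
Hypothesis KE : (\int[tuple_measure (@lebesgue_rV R m.+1) m.+2]_x
  (bprod 1 x * (cone x (axis R m))%:R)%:E = K%:E)%E.

Let cK_ge0 : 0 <= c1^-1 ^+ m.+2 * K.
Proof.
apply: mulr_ge0; first by rewrite exprn_ge0// invr_ge0 ltW.
by rewrite -lee_fin -KE; apply: integral_ge0 => x _; pos.
Qed.

Let cone_prob s z : z != 0 ->
  (\int[P]_t (cone (Y s t) z)%:R%:E = (c1^-1 ^+ m.+2 * K)%:E)%E.
Proof.
move=> z0; have mC := @measurable_cone.
rewrite (law_bool _ (b := fun x => cone x z)); last by apply: mC; mfun.
under eq_integral do rewrite EFinM.
rewrite ge0_integralZl_EFin; side; last 2 first.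
- by apply: mfun_E; apply: mfun_M; [mfun|apply: mfun_natb; apply: mC; mfun].
- by rewrite exprn_ge0// invr_ge0 ltW.
by rewrite integral_cone// KE -EFinM.
Qed.

Let origin_null : lebesgue_rV m.+1 [set (0 : 'rV[R]_m.+1)] = 0%E.
Proof.
have := @lebesgue_rV_box R m.+1 (fun=> 0) (fun=> 0) (fun=> lexx 0).
rewrite big_ord_recl subrr mul0r => E; rewrite -[RHS]E; congr (lebesgue_rV _ _).
apply/seteqP; split=> x /=; first by move=> -> i; rewrite mxE lexx.
by move=> H; apply/rowP => i; rewrite mxE; apply/esym/le_anti/H.
Qed.

(** After exchanging expectation and integral over z, the probability that z lies in the cone is the
    same for every z other than 0, and the volume of the ball cancels. *)
Let mean_angle s :
  (\int[P]_t ((ball_const R m.+1 0)^-1%:E *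
     \int[@lebesgue_rV R m.+1]_z (bker 0 z * (cone (Y s t) z)%:R)%:E) =
   (c1^-1 ^+ m.+2 * K)%:E)%E.
Proof.
have mC := @measurable_cone.
have b0 := ball_const_gt0 R m.+1 0.
have mF : measurable_fun setT (fun p : T * 'rV[R]_m.+1 =>
    (bker 0 p.2 * (cone (Y s p.1) p.2)%:R)%:E).
  apply: mfun_E; apply: mfun_M; first by mfun.
  apply: mfun_natb; apply: mC; last by mfun.
  exact: measurableT_comp (mY s) measurable_fst.
rewrite ge0_integralZl_EFin//; last 3 first.
- by move=> t _; pos.
- by apply: mfun_integral => // t z; pos.
- by rewrite invr_ge0 ltW.
rewrite (fubini_tonelli (fun p : T * 'rV[R]_m.+1 =>
    (bker 0 p.2 * (cone (Y s p.1) p.2)%:R)%:E))//; last by move=> p; pos.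
transitivity ((ball_const R m.+1 0)^-1%:E * \int[@lebesgue_rV R m.+1]_z
   ((c1^-1 ^+ m.+2 * K)%:E * (bker 0 z)%:E))%E.
  congr (_ * _)%E.
  (* The origin must be excluded, as it lies in every nondegenerate cone. *)
  apply: (@ge0_integral_off_null _ _ R (@lebesgue_rV R m.+1) [set 0]).
  - rewrite (_ : [set 0] = [set z : 'rV[R]_m.+1 | dot z z == 0]).
      by apply: measurable_bool; mfun.
    by apply/seteqP; split=> z /=; rewrite dot_eq0 => /eqP.
  - exact: origin_null.
  - by move=> z; pos.
  - by move=> z; rewrite -EFinM lee_fin mulr_ge0 ?bker_ge0// cK_ge0.
  move=> z /eqP z0; under eq_integral do rewrite EFinM /=.
  rewrite ge0_integralZl_EFin//; last 2 first.
  - by apply: mfun_E; apply: mfun_natb; apply: mC; [exact: mY|mfun].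
  - exact: bker_ge0.
  by rewrite cone_prob// muleC.
rewrite ge0_integralZl_EFin//; last 2 first.
- by move=> z _; pos.
- by mfun.
rewrite integral_bker -!EFinM; congr EFin.
by rewrite mulrCA mulVf ?mulr1// gt_eqF.
Qed.

Lemma expectation_angle_sum :
  ('E_P[fun t => angle_sum (fun i => X i t)] =
   (m.+2%:R * ((ball_const R m.+1 1)^-1 ^+ m.+2 * K))%:E)%E.
Proof.
have mC := @measurable_cone.
pose s (i : 'I_m.+2) := tperm ord0 i.
pose A i t := ((ball_const R m.+1 0)^-1%:E *
  \int[@lebesgue_rV R m.+1]_z (bker 0 z * (cone (Y (s i) t) z)%:R)%:E)%E.
have A0 i t : (0 <= A i t)%E.
  apply: mule_ge0; last by apply: integral_ge0 => z _; pos.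
  by rewrite lee_fin invr_ge0; apply: ltW; exact: ball_const_gt0.
have mA i : measurable_fun setT (A i).
  apply: emfun_M; first by mfun.
  apply: mfun_integral => [t z|]; first by pos.
  apply: mfun_E; apply: mfun_M; first by mfun.
  apply: mfun_natb; apply: mC; last by mfun.
  exact: measurableT_comp (mY _) measurable_fst.
rewrite unlock; transitivity (\int[P]_t \sum_i A i t)%E.
  (* The angle sum is replaced by the measurable functions [A i] outside the null event of a
     degenerate simplex; nothing is asked about its own measurability. *)
  apply: (@ge0_integral_off_null _ _ R P [set t | \det (hmx (Y 1%g t)) == 0]).
  - apply: measurable_bool; apply: mfun_eqr; last by mfun.
    by apply: measurable_det_hmx; exact: mY.
  - exact: singular0.
  - move=> t; rewrite lee_fin; apply: sumr_ge0 => i _.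
    by apply: divr_ge0; exact: fine_ge0.
  - by move=> t; apply: sume_ge0.
  move=> t /negP d0; rewrite -sumEFin; apply: eq_bigr => i _.
  have -> : simplex (fun i => X i t) = simplex (tnth (Y (s i) t)).
    rewrite -(simplex_perm _ (s i)); congr simplex.
    by apply/funext => j; rewrite tnth_mktuple.
  have -> : X i t = tnth (Y (s i) t) ord0 by rewrite tnth_mktuple tpermL.
  apply: internal_angle_cone.
  have -> : hmx (Y (s i) t) = row_perm (s i) (hmx (Y 1%g t)).
    by apply/matrixP => j k; rewrite !mxE !tnth_mktuple perm1.
  rewrite row_permE det_mulmx mulf_neq0//.
  by rewrite -unitfE -unitmxE unitmx_perm.
rewrite ge0_integral_sum//.
under eq_bigr do rewrite mean_angle.
by rewrite sumEFin sumr_const card_ord mulr_natl.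
Qed.

End iid.
End angle_expectation.

(** * Gamma values *)

Section gamma_values.
Context (R : realType).
Local Notation s := (Num.sqrt (pi : R)).

Let s_gt0 : 0 < s. Proof. by rewrite sqrtr_gt0 pi_gt0. Qed.

Let s2 : s ^+ 2 = pi. Proof. by rewrite sqr_sqrtr// pi_ge0. Qed.

Let GammaE k : Gamma (k%:R / 2 : R) = Gh R k. Proof. by []. Qed.

(** Legendre's duplication formula at half-integers, by the recursion [GhSS]. *)
Lemma Gh_duplication j :
  Gh R j.+2 * Gh R j.+3 = j.+1`!%:R * s / 2 ^+ j.+1.
Proof.
elim: j => [|j IH]; first by rewrite Gh2 Gh3 !mul1r.
rewrite GhSS mulrCA mulrC -mulrA [Gh R j.+3 * _]mulrC IH.
by rewrite (factS j.+1) natrM (exprS _ j.+1); field; rewrite expf_neq0.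
Qed.

(** Duplication splits the factorial in the numerator into two half-integer Gamma values, one of
    which cancels. *)
Lemma central_binomialE k :
  central_binomial (k.+1%:R : R) = 2 ^+ k.+1 / s * (Gh R k.+2 / Gh R k.+3).
Proof.
have g3 := Gh_gt0 R k.+1.
rewrite /central_binomial.
have -> : k.+1%:R + 1 = (2 * k.+1).+2%:R / 2 :> R.
  by rewrite -addn2 natrD natrM; field.
have -> : k.+1%:R / 2 + 1 = k.+1.+2%:R / 2 :> R.
  by rewrite -(addn2 k.+1) natrD; field.
rewrite !GammaE Gh_fact.
have -> : k.+1`!%:R = Gh R k.+2 * Gh R k.+3 * 2 ^+ k.+1 / s.
  by rewrite Gh_duplication; field; rewrite gt_eqF//= expf_neq0.
have s0 : s != 0 by rewrite gt_eqF.
move: (Gh R k.+2) (Gh R k.+3) (lt0r_neq0 g3) => a b b0.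
by field; rewrite b0 s0.
Qed.

(* Here n = k + 1, and n^2 = k (k + 2) + 1. *)
Definition Vval k : R :=
  let N : R := k.+1%:R in
  N * (N ^+ 2 + 1) * (N ^+ 2 + N + 2) / (2 ^+ k.+2 * (N + 3)) * (pi / s ^+ k.+1)
  * (Gh R k.+3 / Gh R k.+4) ^+ k
  * (Gh R (k * k.+2).+2 / Gh R (k * k.+2).+3).

Let sqE k : k.+1%:R ^+ 2 = (k * k.+2).+1%:R :> R.
Proof. by rewrite -natrX; congr (_%:R); lia. Qed.

Lemma Vval_central_binomial k :
  let N : R := k.+1%:R in
  N * (N ^+ 2 + 1) * (N ^+ 2 + N + 2) * pi
    / ((N + 3) * 2 ^+ (k.+1 * (2 * k.+1 + 1)))
    * central_binomial (N + 1) ^+ (k.+1 - 1) * central_binomial (N ^+ 2) = Vval k.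
Proof.
move=> N; rewrite /Vval -/N.
have -> : N + 1 = k.+2%:R by rewrite /N natr1.
rewrite {3}/N sqE !central_binomialE subn1 /=.
rewrite -(sqE k) -/N.
set P := Gh R k.+3 / Gh R k.+4; set Q := Gh R (k * k.+2).+2 / Gh R (k * k.+2).+3.
clearbody P Q.
rewrite exprMn expr_div_n -(exprM 2 k.+2 k).
(* The first two summands cancel against the powers of 2 from the central binomials, leaving 2^(n +
   1). *)
have -> : (k.+1 * (2 * k.+1 + 1) = k.+2 * k + ((k * k.+2).+1 + k.+2))%N by lia.
rewrite (exprD 2 (k.+2 * k)) (exprD 2 (_).+1 k.+2) (exprSr _ k).
have N3 : N + 3 != 0 by rewrite gt_eqF// ltr_pwDr.
have s0 : s != 0 by rewrite gt_eqF.
have sE := s2; move: (s) s0 sE => t t0 <-.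
have e0 (e : nat) : 2 ^+ e != 0 :> R by rewrite expf_neq0.
move: (2 ^+ (k.+2 * k)) (2 ^+ (k * k.+2).+1) (2 ^+ k.+2)
  (e0 (k.+2 * k)%N) (e0 (k * k.+2).+1) (e0 k.+2) => a b c a0 b0 c0.
clearbody N; field.
have tk : t ^+ k != 0 by rewrite expf_neq0.
by rewrite a0 b0 c0 N3 t0 tk.
Qed.

Lemma Vval_Gamma k :
  let N : R := k.+1%:R in
  N * (N ^+ 2 + 1) * (N ^+ 2 + N + 2)
    / (2 ^+ (k.+1 + 1) * (N + 3) * pi `^ ((N - 2) / 2))
    * (Gamma ((N + 2) / 2) / Gamma ((N + 3) / 2)) ^+ (k.+1 - 1)
    * (Gamma ((N ^+ 2 + 1) / 2) / Gamma ((N ^+ 2 + 2) / 2)) = Vval k.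
Proof.
move=> N; rewrite /Vval -/N.
have -> : N + 2 = k.+1.+2%:R by rewrite -(addn2 k.+1) natrD.
have -> : N + 3 = k.+2.+2%:R by rewrite -(addn3 k.+1) natrD.
have -> : (N ^+ 2 + 1) / 2 = (k * k.+2).+2%:R / 2 by rewrite sqE natr1.
have -> : (N ^+ 2 + 2) / 2 = (k * k.+2).+1.+2%:R / 2.
  by rewrite sqE -(addn2 (_).+1) natrD.
rewrite !GammaE subn1 addn1 /=.
have -> : pi `^ ((N - 2) / 2) = s ^+ k.+1 / pi.
  have -> : (N - 2) / 2 = 2^-1 * k.+1%:R - 1 by rewrite /N; field.
  rewrite powRB; last by rewrite (gt_eqF (pi_gt0 R)) implybT.
  rewrite powRr1 ?pi_ge0// powRrM powR12_sqrt ?pi_ge0//.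
  by rewrite powR_mulrn// sqrtr_ge0.
congr (_ * _ * _).
rewrite -[RHS]mulrA; congr (_ * _).
by rewrite invfM invf_div.
Qed.

Lemma Vval0 : Vval 0 = 1.
Proof.
have s0 : s != 0 by rewrite gt_eqF.
rewrite /Vval Gh2 Gh3 expr0.
have sE := s2; move: (s) s0 sE => t t0 <-.
by field.
Qed.

Lemma ball_const_ratio m :
  ball_const R 1 1 / ball_const R m.+1 1 = Gh R m.+4 / s ^+ m.
Proof.
have g4 := Gh_gt0 R m.+2; have s0 : s != 0 by rewrite gt_eqF.
rewrite /ball_const !add1n Gh3 (Gh_fact R 1 : Gh R 4 = 1).
rewrite (exprS _ m); move: (s) (Gh R m.+4) s0 (lt0r_neq0 g4) => t a t0 a0.
by field; rewrite t0 a0 expf_neq0.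
Qed.

(** Origin of the factor (n^2 + n + 2) / (n + 3): for n = m + 2 it is m + 8 / (m + 5). *)
Lemma Lval_closed m : let G := s ^+ m.+1 / Gh R m.+4.+1 in
  Lval R m = m.+1%:R * G ^+ m.+1 * (m%:R ^+ 2 + 5 * m%:R + 8) / (m%:R + 5).
Proof.
move=> G; have g5 := Gh_gt0 R m.+3.
have m5 : m%:R + 5 != 0 :> R by rewrite gt_eqF// ltr_pwDr.
have -> : Lval R m = m.+1%:R * (2 * (G ^+ m * (4 * G / (m%:R + 5))) + m%:R * G ^+ m.+1).
  rewrite /Lval; congr (_ * (2 * (_ ^+ _ * _) + _ * _ ^+ _)).
  - by rewrite /ball_const (Gh_fact R 1 : Gh R 4 = 1) mulr1 add2n.
  - rewrite /ball_const (Gh_fact R 2 : Gh R 6 = 2) /G.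
    rewrite (_ : (4 + m.+1).+2 = m.+3.+4)%N; last by lia.
    rewrite GhSS (_ : m.+3.+2%:R = m%:R + 5); last by rewrite addrC -(natrD _ 5 m).
    move: (s ^+ m.+1) (Gh R m.+4.+1) (lt0r_neq0 g5) => a b b0.
    by field; rewrite m5 b0.
  - by rewrite /ball_const (Gh_fact R 1 : Gh R 4 = 1) mulr1 add2n.
by clearbody G; rewrite (exprS G m); field.
Qed.

(** From left to right: the number of vertices, the normalization of the densities, the integration
    of the first coordinates, the value of [Mint], and in the denominator the flip and the factorial
    of [integral_simplex]. *)
Lemma angle_constant m :
  m.+2%:R * ((ball_const R m.+1 1)^-1 ^+ m.+2 * (ball_const R 1 1 ^+ m.+2 *
    (Lval R m / (hyper_const R m * ball_const R 1 (m.+2 ^ 2))) /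
    (2 * m.+2`!%:R))) = Vval m.+1.
Proof.
have cW : (ball_const R m.+1 1)^-1 ^+ m.+2 * ball_const R 1 1 ^+ m.+2 =
    Gh R m.+4 ^+ m.+2 / s ^+ (m * m.+2).
  by rewrite -exprMn mulrC ball_const_ratio expr_div_n -exprM.
have -> (a b c : R) : m.+2%:R * (a * (b * c / (2 * m.+2`!%:R))) =
    m.+2%:R / 2 * (a * b) * c / m.+2`!%:R.
  by field; rewrite pnatr_eq0 -lt0n fact_gt0.
rewrite cW Lval_closed.
have fE : m.+2`!%:R = Gh R m.+3 * Gh R m.+4 * 2 ^+ m.+2 / s.
  by rewrite Gh_duplication; field; rewrite gt_eqF//= expf_neq0.
have qE : m.+2%:R ^+ 2 + 1 = (m.+1 * m.+3).+2%:R :> R by rewrite sqE natr1.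
rewrite fE /hyper_const /ball_const /Vval qE.
rewrite (_ : (m.+2 ^ 2 = (m.+1 * m.+3).+1)%N); last by lia.
set q := (m.+1 * m.+3)%N in qE *.
rewrite (_ : (q.+1 + 1).+2 = q.+4); last by lia.
(* Since q + 2 = n^2 + 1, this recursion step is the origin of that factor. *)
rewrite (GhSS R q) expr1.
have g3 := lt0r_neq0 (Gh_gt0 R m.+1); have g4 := lt0r_neq0 (Gh_gt0 R m.+2).
have g5 := lt0r_neq0 (Gh_gt0 R m.+3).
have q2 := lt0r_neq0 (Gh_gt0 R q); have q3 := lt0r_neq0 (Gh_gt0 R q.+1).
have w0 : q.+2%:R != 0 :> R by rewrite pnatr_eq0.
have s0 : s != 0 by rewrite gt_eqF.
have h1 : m.+1%:R != 0 :> R by rewrite pnatr_eq0.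
have h2 : m.+2%:R = m%:R + 2 :> R by rewrite addrC -(natrD _ 2 m).
have h5 : m%:R + 5 != 0 :> R by rewrite gt_eqF// ltr_pwDr.
rewrite h2 !expr_div_n -(exprM s m.+1 m.+1).
rewrite (_ : (m.+1 * m.+1 = (m * m.+2).+1)%N); last by lia.
rewrite (exprS _ (m * m.+2)) (exprS (Gh R m.+4) m.+1) (exprS s m.+1) (exprS 2 m.+2).
have -> : m%:R + 2 + 3 = m%:R + 5 :> R by ring.
have two0 : 2 != 0 :> R by rewrite pnatr_eq0.
have sE := s2; move: (s) s0 sE => t t0 <-.
move: (t ^+ (m * m.+2)) (t ^+ m.+1) (2 ^+ m.+2) (Gh R m.+4 ^+ m.+1)
  (Gh R m.+1.+4 ^+ m.+1) (expf_neq0 (m * m.+2) t0) (expf_neq0 m.+1 t0)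
  (expf_neq0 m.+2 two0) (expf_neq0 m.+1 g5)
  => u v c a b u0 v0 c0 b0.
move: (Gh R m.+3) (Gh R m.+4) (Gh R q.+2) (Gh R q.+3) (q.+2%:R) (m.+1%:R) (m%:R)
  g3 g4 q2 q3 w0 h1 h5 => x y z r w e M x0 y0 z0 r0 w0 e0 M5.
by field; rewrite x0 y0 z0 r0 w0 e0 M5 u0 v0 c0 b0 t0.
Qed.

End gamma_values.

(** [Mint] is found by solving the Blaschke-Petkantschin formula, whose other side is explicit and
    finite. *)
Lemma cone_axis_value (R : realType) m :
  (\int[tuple_measure (@lebesgue_rV R m.+1) m.+2]_x
     (bprod 1 x * (cone x (axis R m))%:R)%:E =
   (ball_const R 1 1 ^+ m.+2 *
     (Lval R m / (hyper_const R m * ball_const R 1 (m.+2 ^ 2))) /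
     (2 * m.+2`!%:R))%:E)%E.
Proof.
have f0 : 2 * m.+2`!%:R != 0 :> R by rewrite mulf_neq0// pnatr_eq0 -lt0n fact_gt0.
have c0 : hyper_const R m * ball_const R 1 (m.+2 ^ 2) != 0.
  by rewrite mulf_neq0// gt_eqF ?hyper_const_gt0 ?ball_const_gt0.
apply: ereal_eq_div => //; rewrite [in RHS]EFinM integral_cone_axis EFinM.
congr (_ * _)%E; apply/esym/ereal_eq_div => //.
by rewrite -LintE integral_hyperplanes.
Qed.

Theorem theorem3p8 (R : realType) (n : nat) (n_gt0 : (0 < n)%N)
    (dT : measure_display) (T : measurableType dT) (P : probability T R)
    (X : 'I_n -> {RV P >-> 'rV[R]_n.-1}) (iidX : iid_beta (2^-1 : R) X) :
  let N : R := n%:R in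
  let V1 : R :=
    N * (N ^+ 2 + 1) * (N ^+ 2 + N + 2) * pi
    / ((N + 3) * 2 ^+ (n * (2 * n + 1)))
    * central_binomial (N + 1) ^+ (n - 1) * central_binomial (N ^+ 2) in
  let V2 : R :=
    N * (N ^+ 2 + 1) * (N ^+ 2 + N + 2)
    / (2 ^+ (n + 1) * (N + 3) * pi `^ ((N - 2) / 2))
    * (Gamma ((N + 2) / 2) / Gamma ((N + 3) / 2)) ^+ (n - 1)
    * (Gamma ((N ^+ 2 + 1) / 2) / Gamma ((N ^+ 2 + 2) / 2)) in
  J1 X = V1%:E /\ V1 = V2.
Proof.
move=> N V1 V2; case: n n_gt0 X iidX @N @V1 @V2 => // k _ X iidX N V1 V2.
rewrite /V2 (Vval_Gamma R k) /V1 (Vval_central_binomial R k); split=> //.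
(* For n = 1 the convention is matched by [Vval0]; otherwise n = m + 2. *)
case: k X iidX {N V1 V2} => [|m] X iidX; first by rewrite Vval0.
by rewrite /J1 /= (expectation_angle_sum iidX (cone_axis_value R m)) angle_constant.
Qed.
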